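(* Let $m\ge 3$, let $A\in Z_m([a,b])$ be a Shin--Zettl matrix of order $m$ on the finite interval $[a,b]$ with $A=A^+$, and let $L_{\min}$, $L_{\max}$ be the associated minimal and maximal operators in $L_2([a,b],\mathbb{C})$. For a linear operator $K$ on $\mathbb{C}^m$ let $L_K$ and $L^K$ be the restrictions of $L_{\max}$ to the sets of $y\in\operatorname{Dom}(L_{\max})$ satisfying respectively $$(K-I)\Gamma_{[1]}y+i(K+I)\Gamma_{[2]}y=0\quad\text{(for }L_K),\qquad (K-I)\Gamma_{[1]}y-i(K+I)\Gamma_{[2]}y=0\quad\text{(for }L^K).$$ Then: (i) For every contraction $K$ on $\mathbb{C}^m$ (i.e. $\|K\|\le 1$), $L_K$ is a maximal dissipative extension of $L_{\min}$ and $L^K$ is a maximal accumulative extension of $L_{\min}$. (ii) Conversely, for every maximal dissipative (respectively, maximal accumulative) extension $\widetilde L$ of $L_{\min}$ there exists a contraction $K$ on $\mathbb{C}^m$ such that $\widetilde L=L_K$ (respectively, $\widetilde L=L^K$). (iii) The extensions $L_K$ and $L^K$ are self-adjoint if and only if $K$ is a unitary operator on $\mathbb{C}^m$. (iv) These correspondences between the operators $K$ and the extensions $\widetilde L$ are all bijective: $K\mapsto L_K$ (respectively $K\mapsto L^K$) is a bijection from the contractions on $\mathbb{C}^m$ onto the maximal dissipative (respectively, maximal accumulative) extensions of $L_{\min}$, and each restricts to a bijection from the unitary operators onto the self-adjoint extensions of $L_{\min}$ in $L_2([a,b],\mathbb{C})$.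
   Context: Shin--Zettl matrices. $Z_m([a,b])$ is the set of $m\times m$ complex matrix-valued functions $A=(a_{k,s})$ on the finite interval $[a,b]$ such that $a_{k,s}\equiv 0$ for $s>k+1$, all entries $a_{k,s}\in L_1([a,b],\mathbb{C})$, and $a_{k,k+1}\ne 0$ a.e. on $[a,b]$ for $k=1,\dots,m-1$. Quasi-derivatives. Given $A$, define recursively $D^{[0]}y:=y$; $D^{[k]}y:=a_{k,k+1}^{-1}\bigl((D^{[k-1]}y)'-\sum_{s=1}^k a_{k,s}D^{[s-1]}y\bigr)$ for $k=1,\dots,m-1$; $D^{[m]}y:=(D^{[m-1]}y)'-\sum_{s=1}^m a_{m,s}D^{[s-1]}y$, on $\operatorname{Dom}(A):=\{y : D^{[k]}y\in AC([a,b],\mathbb{C}),\ k=0,\dots,m-1\}$. The quasi-differential expression is $l(y):=i^mD^{[m]}y$. Operators in $L_2([a,b],\mathbb{C})$. $L_{\max}y=l(y)$ with $\operatorname{Dom}(L_{\max})=\{y\in\operatorname{Dom}(A): D^{[m]}y\in L_2([a,b],\mathbb{C})\}$; $L_{\min}$ is the restriction of $L_{\max}$ to $\{y\in\operatorname{Dom}(L_{\max}): D^{[k]}y(a)=D^{[k]}y(b)=0,\ k=0,\dots,m-1\}$. Formal adjoint. $A^+:=-\Lambda_m^{-1}\overline{A^T}\Lambda_m$, where $\Lambda_m$ is the $m\times m$ matrix whose only non-zero entries are $(\Lambda_m)_{j,m+1-j}=(-1)^j$, $j=1,\dots,m$. When $A=A^+$ it is known that $L_{\min}$ is closed, densely defined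 and symmetric with deficiency indices $(m,m)$, and $L_{\min}^*=L_{\max}$, $L_{\max}^*=L_{\min}$. Boundary maps $\Gamma_{[1]},\Gamma_{[2]}:\operatorname{Dom}(L_{\max})\to\mathbb{C}^m$. If $m=2n$, $n\ge2$: for $k=1,\dots,n$, $(\Gamma_{[1]}y)_k=i^{2n}(-1)^kD^{[2n-k]}y(a)$, $(\Gamma_{[1]}y)_{n+k}=i^{2n}(-1)^{k-1}D^{[2n-k]}y(b)$, $(\Gamma_{[2]}y)_k=D^{[k-1]}y(a)$, $(\Gamma_{[2]}y)_{n+k}=D^{[k-1]}y(b)$. If $m=2n+1$, $n\ge1$: for $k=1,\dots,n$, $(\Gamma_{[1]}y)_k=i^{2n+1}(-1)^kD^{[2n+1-k]}y(a)$, $(\Gamma_{[1]}y)_{n+k}=i^{2n+1}(-1)^{k-1}D^{[2n+1-k]}y(b)$, $(\Gamma_{[2]}y)_k=D^{[k-1]}y(a)$, $(\Gamma_{[2]}y)_{n+k}=D^{[k-1]}y(b)$, and $(\Gamma_{[1]}y)_{2n+1}=i^{2n+1}\bigl(D^{[n]}y(b)+D^{[n]}y(a)\bigr)$, $(\Gamma_{[2]}y)_{2n+1}=\gamma D^{[n]}y(b)+\delta D^{[n]}y(a)$ with $\gamma=\frac{(-1)^n}{2}+i$, $\delta=\frac{(-1)^{n+1}}{2}+i$. Dissipativity. A densely defined linear operator $T$ in a Hilbert space $\mathcal{H}$ (inner product linear in the first argument) is dissipative (resp. accumulative) if $\operatorname{Im}(Tf,f)\ge0$ (resp. $\le0$)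 for all $f\in\operatorname{Dom}(T)$; it is maximal dissipative (resp. maximal accumulative) if in addition it has no non-trivial dissipative (resp. accumulative) extension in $\mathcal{H}$. *)

(* Defs.v *)
From HB Require Import structures.
From mathcomp Require Import all_boot all_order all_algebra.
From mathcomp Require Import ring_quotient complex ring.
From mathcomp Require Import all_classical all_reals all_analysis.
From mathcomp Require Import measurable_realfun.

Set Implicit Arguments.
Unset Strict Implicit.
Unset Printing Implicit Defensive.

Import Order.TTheory GRing.Theory Num.Theory.
Import numFieldNormedType.Exports.

Local Open Scope classical_set_scope.
Local Open Scope ring_scope.
Local Open Scope complex_scope.

(* An unbounded operator is identified with its graph, a set of pairs [(f, T f)].
[ip] is the inner product, linear in its first argument. *)

Section Operators.
Context {R : realType} {H : lmodType R[i]} (ip : H -> H -> R[i]).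
Implicit Types T S : set (H * H).

Definition ip_norm (f : H) : R := Num.sqrt (complex.Re (ip f f)).

Definition linear_operator T : Prop :=
  [/\ T (0, 0),
      forall (c : R[i]) p q, T p -> T q -> T (c *: p + q) &
      forall f g h, T (f, g) -> T (f, h) -> g = h].

Definition domain T : set H := [set f | exists g, T (f, g)].

Definition densely_defined T : Prop :=
  forall (f : H) (e : R), 0 < e -> exists2 g, domain T g & ip_norm (f - g) < e.

Definition dissipative T : Prop :=
  [/\ linear_operator T, densely_defined T &
      forall f g, T (f, g) -> 0 <= complex.Im (ip g f)].

Definition accumulative T : Prop :=
  [/\ linear_operator T, densely_defined T &
      forall f g, T (f, g) -> complex.Im (ip g f) <= 0].

Definition maximal_dissipative T : Prop :=
  dissipative T /\ forall S, dissipative S -> T `<=` S -> S = T.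

Definition maximal_accumulative T : Prop :=
  accumulative T /\ forall S, accumulative S -> T `<=` S -> S = T.

Definition adjoint T : set (H * H) :=
  [set p | forall f g, T (f, g) -> ip g p.1 = ip f p.2].

Definition self_adjoint T : Prop :=
  [/\ linear_operator T, densely_defined T & adjoint T = T].

End Operators.

(* A complex-valued function on [[a, b]] is represented by a total function on [R] whose values outside
[[a, b]] are irrelevant. *)

Section ComplexFunctions.
Context {R : realType} (a b : R).
Local Notation mu := (@lebesgue_measure R).
Implicit Types f g : R -> R[i].

Definition ae_equal f g : Prop := f = g %[ae mu in `[a, b]%classic].

Definition complex_integrable f : Prop :=
  mu.-integrable `[a, b] (fun x => (complex.Re (f x))%:E) /\
  mu.-integrable `[a, b] (fun x => (complex.Im (f x))%:E).

Definition complex_integral f : R[i] :=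
  (\int[mu]_(x in `[a, b]) complex.Re (f x)) +i*
  (\int[mu]_(x in `[a, b]) complex.Im (f x)).

Definition square_integrable f : Prop :=
  [/\ measurable_fun `[a, b] (fun x : measurableTypeR R => complex.Re (f x)),
      measurable_fun `[a, b] (fun x : measurableTypeR R => complex.Im (f x)) &
      mu.-integrable `[a, b] (fun x => (Normc.normc (f x) ^+ 2)%:E)].

Definition abs_continuous f : Prop :=
  forall e : R, 0 < e -> exists2 d : R, 0 < d &
    forall (n : nat) (I : 'I_n -> R * R),
      (forall k, a <= (I k).1 /\ (I k).1 <= (I k).2 /\ (I k).2 <= b) ->
      trivIset setT (fun k => `](I k).1, (I k).2[%classic) ->
      \sum_(k < n) ((I k).2 - (I k).1) < d ->
      \sum_(k < n) Normc.normc (f (I k).2 - f (I k).1) < e.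

(* At a point where [f] is not differentiable the value is meaningless. *)
Definition complex_derive f (x : R) : R[i] :=
  derive1 (fun t => complex.Re (f t)) x +i* derive1 (fun t => complex.Im (f t)) x.

(* If [f] coincides almost everywhere on [[a, b]] with an absolutely continuous
   function (whose values on [[a, b]] are then unique, for [a < b]), that
   function; otherwise [f] itself. *)
Definition ac_representative f : R -> R[i] :=
  xget f [set g | abs_continuous g /\ ae_equal f g].

Definition L2fun_pred : {pred R -> R[i]} :=
  [pred f : R -> R[i] | `[< square_integrable f >]].

Let normc_sq (z : R[i]) :
  Normc.normc z ^+ 2 = complex.Re z ^+ 2 + complex.Im z ^+ 2.
Proof. by case: z => x y /=; rewrite sqr_sqrtr// addr_ge0// sqr_ge0. Qed.

Lemma L2fun_submod_closed : submod_closed L2fun_pred.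
Proof.
split.
  apply/asboolP; split=> /=.
  - exact: measurable_cst.
  - exact: measurable_cst.
  - rewrite (_ : (fun _ => _) = cst 0%E); first exact: integrable0.
    by apply/funext => x /=; rewrite !(expr0n, addr0, sqrtr0).
move=> c f g /asboolP[rf imf sf] /asboolP[rg img sg].
have ReE x : complex.Re ((c *: f + g) x) =
    complex.Re c * complex.Re (f x) - complex.Im c * complex.Im (f x)
    + complex.Re (g x).
  rewrite [(c *: f + g) x]/(c * f x + g x).
  by move: (f x) (g x) => [? ?] [? ?]; clear; case: c.
have ImE x : complex.Im ((c *: f + g) x) =
    complex.Re c * complex.Im (f x) + complex.Im c * complex.Re (f x)
    + complex.Im (g x).
  rewrite [(c *: f + g) x]/(c * f x + g x).
  by move: (f x) (g x) => [? ?] [? ?]; clear; case: c.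
have mRe : measurable_fun `[a, b]
    (fun x : measurableTypeR R => complex.Re ((c *: f + g) x)).
  rewrite (funext ReE).
  by apply: measurable_funD => //; apply: measurable_funB => //;
    apply: measurable_funM.
have mIm : measurable_fun `[a, b]
    (fun x : measurableTypeR R => complex.Im ((c *: f + g) x)).
  rewrite (funext ImE).
  by apply: measurable_funD => //; apply: measurable_funD => //;
    apply: measurable_funM.
apply/asboolP; split=> //.
pose M := 2 * Normc.normc c ^+ 2.
pose h (x : R) : \bar R := (M%:E * (Normc.normc (f x) ^+ 2)%:E
             + 2%:E * (Normc.normc (g x) ^+ 2)%:E)%E.
apply: (@le_integrable _ _ R mu _ (measurable_itv _)
  (fun x => (Normc.normc ((c *: f + g) x) ^+ 2)%:E) h).
- apply/measurable_EFinP; rewrite (funext (fun x => normc_sq ((c *: f + g) x))).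
  by apply: measurable_funD; apply: measurable_funX.
- move=> x _; rewrite /h -!EFinM -EFinD !abse_EFin lee_fin.
  have nsq z : 0 <= Normc.normc z ^+ 2 :> R by rewrite sqr_ge0.
  rewrite ger0_norm// ger0_norm; last first.
    by rewrite addr_ge0// mulr_ge0// mulr_ge0.
  rewrite /M !normc_sq ReE ImE -subr_ge0.
  set c1 := complex.Re c; set c2 := complex.Im c.
  set f1 := complex.Re (f x); set f2 := complex.Im (f x).
  set g1 := complex.Re (g x); set g2 := complex.Im (g x).
  have -> : 2 * (c1 ^+ 2 + c2 ^+ 2) * (f1 ^+ 2 + f2 ^+ 2)
      + 2 * (g1 ^+ 2 + g2 ^+ 2)
      - ((c1 * f1 - c2 * f2 + g1) ^+ 2 + (c1 * f2 + c2 * f1 + g2) ^+ 2)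
    = (c1 * f1 - c2 * f2 - g1) ^+ 2 + (c1 * f2 + c2 * f1 - g2) ^+ 2 by ring.
  by rewrite addr_ge0// sqr_ge0.
- have mI : measurable (`[a, b]%classic : set (measurableTypeR R)) by [].
  exact: (integrableD mI (integrableZl mI M sf) (integrableZl mI 2 sg)).
Qed.

HB.instance Definition _ :=
  GRing.isSubmodClosed.Build R[i] (R -> R[i]) L2fun_pred L2fun_submod_closed.

Record L2fun := MkL2fun {
  L2fun_val :> R -> R[i];
  L2fun_valP : L2fun_val \in L2fun_pred
}.

HB.instance Definition _ := [isSub for L2fun_val].
HB.instance Definition _ := [Choice of L2fun by <:].
HB.instance Definition _ := [SubChoice_isSubLmodule of L2fun by <:].

Definition null_pred : {pred L2fun} := [pred f : L2fun | `[< ae_equal f 0 >]].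

Lemma null_zmod_closed : zmod_closed null_pred.
Proof.
split=> [|f g /asboolP f0 /asboolP g0]; apply/asboolP.
  by apply: aeW => x _.
move: f0 g0; rewrite /ae_equal; apply: (@filterS2 _ _ (ae_filter_ringOfSetsType mu)) => x f0 g0 xab.
rewrite [(f - g : L2fun) x](_ : _ = f x - g x)//.
by rewrite f0// g0// subr0.
Qed.

HB.instance Definition _ :=
  GRing.isZmodClosed.Build L2fun null_pred null_zmod_closed.

(* Almost everywhere equality classes of square-integrable functions. *)
Definition L2 : Type := Quotient.quot null_pred.

HB.instance Definition _ := Choice.on L2.
HB.instance Definition _ := EqQuotient.on L2.
HB.instance Definition _ := GRing.Zmodule.on L2.

Local Open Scope quotient_scope.

Lemma L2_piP (f g : L2fun) : reflect (ae_equal f g) (\pi_L2 f == \pi_L2 g).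
Proof.
have -> : (\pi_L2 f == \pi_L2 g) = (f - g \in null_pred).
  by rewrite (Quotient.idealrBE (null_pred : zmodClosed _)).
apply: (iffP (@asboolP (ae_equal (f - g : L2fun) 0)));
  apply: (@filterS _ _ (ae_filter_ringOfSetsType mu)) => x.
  by move=> fg xab; apply/eqP; rewrite -subr_eq0; apply/eqP; exact: fg.
by move=> fg xab; rewrite [LHS](_ : _ = f x - g x)// fg// subrr.
Qed.

Lemma L2_piD (f g : L2fun) : \pi_L2 (f + g) = \pi_L2 f + \pi_L2 g.
Proof. by rewrite !piE. Qed.

Definition L2_scale (c : R[i]) (f : L2) : L2 := \pi_L2 (c *: repr f).

Lemma L2_pi_scale c (f : L2fun) : \pi_L2 (c *: f) = L2_scale c (\pi_L2 f).
Proof.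
apply/eqP/L2_piP.
have /eqP/L2_piP : \pi_L2 f = \pi_L2 (repr (\pi_L2 f)) by rewrite reprK.
apply: (@filterS _ _ (ae_filter_ringOfSetsType mu)) => x fE xab.
rewrite [LHS](_ : _ = c * f x)// [RHS](_ : _ = c * repr (\pi_L2 f) x)//.
by rewrite fE.
Qed.

Lemma L2_scalerA c d (f : L2) :
  L2_scale c (L2_scale d f) = L2_scale (c * d) f.
Proof. by rewrite -L2_pi_scale scalerA. Qed.

Lemma L2_scale1r : left_id 1 L2_scale.
Proof. by move=> f; rewrite /L2_scale scale1r reprK. Qed.

Lemma L2_scalerDr : right_distributive L2_scale +%R.
Proof.
move=> c f g; rewrite -[f]reprK -[g]reprK -L2_piD -!L2_pi_scale.
by rewrite scalerDr L2_piD.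
Qed.

Lemma L2_scalerDl (f : L2) : {morph L2_scale^~ f : c d / c + d}.
Proof. by move=> c d; rewrite /L2_scale scalerDl L2_piD. Qed.

HB.instance Definition _ := GRing.Zmodule_isLmodule.Build R[i] L2
  L2_scalerA L2_scale1r L2_scalerDr L2_scalerDl.

Definition L2_fun (f : L2) : R -> R[i] := repr f : L2fun.

Definition L2_inner (f g : L2) : R[i] :=
  complex_integral (fun x => L2_fun f x * (L2_fun g x)^*).

End ComplexFunctions.

(* The entry of [M] in row [k] and column [s], for [1 <= k, s <= m]. *)
Definition entry {C : nmodType} {m : nat} (M : 'M[C]_m) (k s : nat) : C :=
  if insub k.-1 is Some i then
    if insub s.-1 is Some j then M i j else 0
  else 0.

Section QuasiDifferential.
Context {R : realType} (a b : R) {m : nat}.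
Local Notation C := R[i].
Local Notation mu := (@lebesgue_measure R).
Implicit Types (A : R -> 'M[C]_m) (y : R -> C).

(* Entries in [L_1] are only determined up to null sets, hence so are the
   identities between them. *)
Definition shin_zettl A : Prop :=
  [/\ forall i j : 'I_m, (i.+1 < j)%N ->
        ae_equal a b (fun x => A x i j) (fun=> 0),
      forall i j : 'I_m, complex_integrable a b (fun x => A x i j) &
      forall i j : 'I_m, j = i.+1 :> nat ->
        \forall x \ae mu, x \in `[a, b] -> A x i j != 0].

Definition Lambda : 'M[C]_m :=
  \matrix_(i, j) (if (i + j).+1 == m then (-1) ^+ i.+1 else 0).

Definition formal_adjoint A : R -> 'M[C]_m :=
  fun x => - (invmx Lambda *m (map_mx conjc (A x)^T) *m Lambda).

Definition formally_self_adjoint A : Prop :=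
  \forall x \ae mu, x \in `[a, b] -> A x = formal_adjoint A x.

(* The quasi-derivatives [D^[0] y, ..., D^[k] y], as a table built by recursion
   on [k]. The quotient defining [D^[k] y] for [0 < k < m] only makes sense
   almost everywhere; [D^[k] y] is its absolutely continuous version, which is
   what gives a meaning to its values at [a] and [b]. *)
Fixpoint quasi_table A y (k : nat) : nat -> R -> C :=
  if k is k'.+1 then
    let D := quasi_table A y k' in
    let rest x := complex_derive (D k') x
                  - \sum_(1 <= s < k.+1) entry (A x) k s * D s.-1 x in
    let Dk := if (k < m)%N
              then ac_representative a b
                     (fun x => (entry (A x) k k.+1)^-1 * rest x)
              else rest in
    fun j => if j == k then Dk else D j
  else fun=> y.

Definition quasi_derivative A (k : nat) y : R -> C := quasi_table A y k k.
Local Notation "''D[' A , k ]" := (quasi_derivative A k)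
  (format "''D[' A ,  k ]").

Lemma quasi_tableE A y k j : (j <= k)%N -> quasi_table A y k j = 'D[A, j] y.
Proof.
elim: k => [|k IHk]; first by rewrite leqn0 => /eqP ->.
rewrite leq_eqVlt => /predU1P[->//|]; rewrite ltnS => jk.
by rewrite /= (ltn_eqF (leq_ltn_trans jk (ltnSn k))) IHk.
Qed.

Let quasi_sumE A y k x :
  \sum_(1 <= s < k.+2) entry (A x) k.+1 s * quasi_table A y k s.-1 x
  = \sum_(1 <= s < k.+2) entry (A x) k.+1 s * 'D[A, s.-1] y x.
Proof.
apply: eq_big_nat => s /andP[s1 sk]; rewrite quasi_tableE//.
by rewrite -ltnS prednK.
Qed.

Lemma quasi_derivative0 A y : 'D[A, 0] y = y.
Proof. by []. Qed.

Lemma quasi_derivativeE A y k : (0 < k < m)%N ->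
  'D[A, k] y = ac_representative a b (fun x =>
    (entry (A x) k k.+1)^-1 *
    (complex_derive ('D[A, k.-1] y) x
     - \sum_(1 <= s < k.+1) entry (A x) k s * 'D[A, s.-1] y x)).
Proof.
case: k => // k /= km; rewrite /quasi_derivative /= eqxx km.
by congr ac_representative; apply/funext => x; rewrite quasi_sumE.
Qed.

Lemma quasi_derivative_top A y : (0 < m)%N ->
  'D[A, m] y = fun x =>
    complex_derive ('D[A, m.-1] y) x
    - \sum_(1 <= s < m.+1) entry (A x) m s * 'D[A, s.-1] y x.
Proof.
move=> m0; suff topE k : k.+1 = m -> 'D[A, k.+1] y = fun x =>
    complex_derive ('D[A, k] y) x
    - \sum_(1 <= s < k.+2) entry (A x) k.+1 s * 'D[A, s.-1] y x.
  by have := topE m.-1; rewrite prednK// => ->.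
move=> km; rewrite /quasi_derivative /= eqxx.
have -> : (k.+1 < m)%N = false by rewrite km ltnn.
by apply/funext => x; rewrite quasi_sumE.
Qed.

Definition Dom A : set (R -> C) :=
  [set y | forall k, (k < m)%N -> abs_continuous a b ('D[A, k] y)].

Definition quasi_expression A y : R -> C := fun x => 'i ^+ m * 'D[A, m] y x.

(* Membership in [L_2], for a function known only almost everywhere. *)
Definition in_L2 y : Prop := exists f : L2 a b, ae_equal a b (L2_fun f) y.

Definition Dom_max A : set (R -> C) :=
  [set y | Dom A y /\ in_L2 ('D[A, m] y)].

(* The restriction of the maximal operator to the functions in [S]. *)
Definition L_restriction A (S : set (R -> C)) : set (L2 a b * L2 a b) :=
  [set p | exists y, [/\ Dom_max A y, S y,
                        ae_equal a b (L2_fun p.1) y &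
                        ae_equal a b (L2_fun p.2) (quasi_expression A y)]].

Definition L_max A := L_restriction A setT.

Definition L_min A := L_restriction A
  [set y | forall k, (k < m)%N -> 'D[A, k] y a = 0 /\ 'D[A, k] y b = 0].

(* With [n = m./2], the row [j] of these vectors is the component of index
[k = j.+1] when [j < n], and of index [n + k] with [k = (j - n).+1] when
[n <= j < n.*2]; the remaining row [j = n.*2] exists only for odd [m]. *)

Definition Gamma1 A y : 'cV[C]_m :=
  let n := m./2 in
  \col_j
    if (j < n)%N then
      let k := j.+1 in 'i ^+ m * (-1) ^+ k * 'D[A, m - k] y a
    else if (j < n.*2)%N then
      let k := (j - n).+1 in 'i ^+ m * (-1) ^+ k.-1 * 'D[A, m - k] y b
    else 'i ^+ m * ('D[A, n] y b + 'D[A, n] y a).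

Definition Gamma2 A y : 'cV[C]_m :=
  let n := m./2 in
  let gamma := (-1) ^+ n / 2 + 'i in
  let delta := (-1) ^+ n.+1 / 2 + 'i in
  \col_j
    if (j < n)%N then
      let k := j.+1 in 'D[A, k.-1] y a
    else if (j < n.*2)%N then
      let k := (j - n).+1 in 'D[A, k.-1] y b
    else gamma * 'D[A, n] y b + delta * 'D[A, n] y a.

(* [L_sub A K] is L_K and [L_sup A K] is L^K. *)
Definition L_sub A (K : 'M[C]_m) := L_restriction A
  [set y | (K - 1%:M) *m Gamma1 A y + 'i *: ((K + 1%:M) *m Gamma2 A y) = 0].

Definition L_sup A (K : 'M[C]_m) := L_restriction A
  [set y | (K - 1%:M) *m Gamma1 A y - 'i *: ((K + 1%:M) *m Gamma2 A y) = 0].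

End QuasiDifferential.

Arguments L_restriction {R} a b {m} A S.
Arguments L_max {R} a b {m} A.
Arguments L_min {R} a b {m} A.
Arguments L_sub {R} a b {m} A K.
Arguments L_sup {R} a b {m} A K.

(* Operator norm at most 1 for the Euclidean norm. *)
Definition contraction_mx {R : realType} {m : nat} (K : 'M[R[i]]_m) : Prop :=
  forall v : 'cV[R[i]]_m,
    \sum_(j < m) `|(K *m v) j 0| ^+ 2 <= \sum_(j < m) `|v j 0| ^+ 2.

(* Main.v *)
(* Lagrange's identity turns the boundary maps into a boundary triple for the maximal operator:
   with P = Gamma1 + i Gamma2 and M = Gamma1 - i Gamma2, one has
   |P y|^2 - |M y|^2 = 4 Im (L y, y), the pair (P, M) is onto C^m x C^m, and its kernel is the
   domain of the minimal operator. A maximal dissipative extension of the minimal operator is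
   a restriction of the maximal one on which |M y| <= |P y|; by maximality P is onto, so the
   extension is {K P y = M y} for a unique contraction K, and this is the stated boundary
   condition. Self-adjointness amounts to (P y, P z) = (M y, M z), that is to K being unitary.
   Replacing i by -i gives the accumulative case.

   Surjectivity of the boundary values and density of the minimal domain follow from the
   unique solvability of the first-order system for the quasi-derivatives (Picard iteration
   in a weighted sup norm), the completeness of L2, and the fact that absolutely continuous
   functions are the indefinite integrals of integrable ones (Radon-Nikodym). *)

From HB Require Import structures.
Require Import Defs.
From mathcomp Require Import all_boot all_order all_algebra.
From mathcomp Require Import complex ring lra zify.
From mathcomp Require Import all_classical all_reals all_analysis.
From mathcomp Require Import measurable_realfun.

Set Implicit Arguments.
Unset Strict Implicit.
Unset Printing Implicit Defensive.

Import Order.TTheory GRing.Theory Num.Theory.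
Import numFieldNormedType.Exports.
Local Open Scope classical_set_scope.
Local Open Scope ring_scope.

(** * Absolutely continuous functions *)

Section MonotoneDensity.
Context {R : realType}.
Local Notation mu := (@lebesgue_measure R).

(** The inclusion of the adjoint of the minimal operator in [L_max] is reduced to finite-dimensional
    algebra. The [m] homogeneous solutions with unit Cauchy data at [a] are linearly independent in
    L2, so their Gram matrix is invertible; by Lagrange's identity, inner products against them
    determine the boundary values at [b] of an element with zero data at [a]. Density of the minimal
    domain follows: a vector orthogonal to it gives a pair [(0, h)] of the adjoint, hence of the
    single-valued [L_max].

    A dissipative extension is not given as a restriction of [L_max]. It lies in the adjoint of the
    minimal operator because positivity on the combinations [c f + h] rules out a linear term in
    [c].

    On the analytic side, a quasi-derivative is an almost everywhere quotient replaced by its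
    absolutely continuous version. The calculus is therefore done on pairs [(f, g)] where [f] is an
    indefinite integral of [g]; pointwise derivatives serve only to identify [g] almost
    everywhere. *)

Definition nonoverlap (p q : R * R) := (p.2 <= q.1) || (q.2 <= p.1).

Definition subsegment (a b : R) (p : R * R) := [&& a <= p.1, p.1 <= p.2 & p.2 <= b].

(** Lists of segments replace the indexed families of [abs_continuous] because the variation
    argument refines and concatenates them; [disjoint_family_seq] carries estimates on families over
    to lists. *)
Definition real_abs_continuous (a b : R) (f : R -> R) : Prop :=
  forall e : R, 0 < e -> exists2 d : R, 0 < d &
    forall s : seq (R * R), all (subsegment a b) s -> pairwise nonoverlap s ->
      \sum_(p <- s) (p.2 - p.1) < d -> \sum_(p <- s) `|f p.2 - f p.1| < e.

Lemma real_abs_continuous_unif a b f e : real_abs_continuous a b f -> 0 < e ->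
  exists2 d, 0 < d & forall x y, a <= x <= b -> a <= y <= b -> `|y - x| < d -> `|f y - f x| < e.
Proof.
move=> acf e0; have [d d0 hd] := acf e e0; exists d => // x y.
wlog xy : x y / x <= y => [H xab yab xyd|/andP[ax xb] /andP[ay yb]].
  have [xy|/ltW yx] := leP x y; first exact: H.
  by rewrite distrC; apply: H => //; rewrite distrC.
rewrite ger0_norm ?subr_ge0// => xyd.
have := hd [:: (x, y)]; rewrite /= !big_seq1 /= /subsegment /= ax xy yb.
exact.
Qed.

Variables (a b : R) (f : R -> R).
Hypothesis ab : a < b.
Hypothesis fnd : {in `[a, b] &, nondecreasing_fun f}.
Hypothesis fac : real_abs_continuous a b f.

Let clamp (x : R) := Num.max a (Num.min b x).

Let clamp_in x : a <= clamp x <= b.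
Proof. by rewrite /clamp le_max lexx /= ge_max (ltW ab) ge_min lexx. Qed.

Let clampE x : a <= x <= b -> clamp x = x.
Proof. by move=> /andP[ax xb]; rewrite /clamp (min_idPr xb) (max_idPr ax). Qed.

Let clamp_nd x y : x <= y -> clamp x <= clamp y.
Proof.
by move=> xy; rewrite /clamp ge_max !le_max lexx /= le_min !ge_min lexx /= xy !orbT.
Qed.

Let clamp_lip x y : `|clamp y - clamp x| <= `|y - x|.
Proof.
wlog xy : x y / x <= y => [H|].
  by have [/H//|/ltW/H] := leP x y; rewrite distrC [leRHS]distrC.
rewrite !ger0_norm ?subr_ge0 ?clamp_nd// /clamp /Num.max /Num.min.
by repeat case: ifP; move=> /=; lra.
Qed.

(** A Lebesgue-Stieltjes measure needs a nondecreasing right-continuous function on the whole line: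
    [f] is extended by its end values. *)
Definition clampf (x : R) := f (clamp x).

Let clampf_nd : nondecreasing clampf.
Proof.
by move=> x y xy; apply: fnd; rewrite ?in_itv /= ?clamp_in//; exact: clamp_nd.
Qed.

Let clampf_rc : right_continuous clampf.
Proof.
apply: right_continuousW => x; apply/cvgrPdist_lt => e e0.
have [d d0 hd] := real_abs_continuous_unif fac e0.
near=> y; apply: hd; rewrite ?clamp_in// (le_lt_trans (clamp_lip _ _))//.
Unshelve. all: by end_near. Qed.

HB.instance Definition _ := isCumulative.Build R _ R clampf clampf_nd clampf_rc.

Let nu := lebesgue_stieltjes_measure clampf.

Let nu_itv x y : a <= x -> x <= y -> y <= b -> nu `]x, y]%classic = (f y - f x)%:E.
Proof.
move=> ax xy yb.
rewrite /nu /lebesgue_stieltjes_measure /measure_extension /= measurable_mu_extE/=; last exact: is_ocitv.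
rewrite wlength_itv_bnd//= /clampf !clampE//; first by rewrite ax (le_trans xy).
by rewrite yb (le_trans ax).
Qed.

Let D : set (measurableTypeR R) := `]a, b]%classic.
Let mD : measurable D. Proof. exact: measurable_itv. Qed.
Let Doo : (nu D < +oo)%E.
Proof. by rewrite nu_itv ?lexx// ?ltry// ltW. Qed.

Let nuD : {finite_measure set (measurableTypeR R) -> \bar R} := mfrestr mD Doo.

(** The outer inclusion bounds the Stieltjes measure of the trace of [I] by the increment of [f]
    over [p]; the inner one bounds the length of [p] by that of [I]. *)
Let piece (I : set R) : open I -> is_interval I -> (I `&` D) !=set0 ->
  exists p : R * R, [/\ subsegment a b p, p.1 < p.2, I `&` D `<=` `]p.1, p.2] & `]p.1, p.2[ `<=` I].
Proof.
move=> oI iI [z [Iz]]; rewrite /D /= in_itv /= => /andP[az zb].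
pose J := I `&` `]a, b].
have Jz : J z by split=> //=; rewrite in_itv /= az zb.
have J0 : J !=set0 by exists z.
have Jb : ubound J b by move=> t [_] /=; rewrite in_itv /= => /andP[].
have Ja : lbound J a by move=> t [_] /=; rewrite in_itv /= => /andP[/ltW].
have Jinf : has_inf J by split=> //; exists a.
have Jsup : has_sup J by split=> //; exists b.
(* Every point of [J] has points of [J] on its left, so the infimum is not attained; this is what
   makes [p] half-open on the left. *)
have infJ t : J t -> inf J < t.
  move=> [It] /=; rewrite in_itv /= => /andP[at_ tb].
  have : \forall y \near t^'-, J y.
    near=> y; split.
      near: y; apply: cvg_within; exact: open_nbhs_nbhs.
    rewrite /= in_itv /=; apply/andP; split; first by near: y; exact: nbhs_left_gt.
    by apply/ltW; apply: lt_le_trans tb; near: y; exact: nbhs_left_lt.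
  move=> nJ; near t^'- => y.
  apply: (@le_lt_trans _ _ y); last by near: y; exact: nbhs_left_lt.
  by apply: ge_inf; [case: Jinf|near: y].
exists (inf J, sup J); split => /=.
- apply/and3P; split => /=; [exact: lb_le_inf| | exact: ge_sup].
  by rewrite (le_trans (ltW (infJ _ Jz)))//; apply: ub_le_sup => //; case: Jsup.
- by rewrite (lt_le_trans (infJ _ Jz))//; apply: ub_le_sup => //; case: Jsup.
- move=> t Jt /=; rewrite in_itv /= infJ//=.
  by apply: ub_le_sup => //; case: Jsup.
- move=> t /=; rewrite in_itv /= => /andP[it ts].
  have [u [Iu _] ut] := inf_lt J0 it.
  have [v [Iv _] tv] := sup_gt J0 ts.
  by apply: (iI u v) => //; rewrite !ltW.
Unshelve. all: by end_near. Qed.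

(** Outer regularity covers a null set by an open set shorter than the [d] that absolute continuity
    attaches to [e]. Its components meeting []a, b]] yield nonoverlapping segments of total length
    below [d], so every partial sum of their measures is at most [e]. *)
Let nuD_dominates : nuD `<< mu.
Proof.
apply/null_content_dominatesP => N mN N0.
apply/eqP; rewrite eq_le measure_ge0 andbT.
apply/lee_addgt0Pr => e e0; rewrite add0e.
have [d d0 hd] := fac e0.
have Noo : (mu N < +oo)%E by rewrite N0 ltry.
have [U [oU NU UN]] := lebesgue_regularity_outer mN Noo d0.
have muU : (mu U < d%:E)%E.
  rewrite (_ : U = N `|` (U `\` N)); last by rewrite setDUK.
  rewrite (le_lt_trans (measureU2 _ _ _))//; first exact: measurableD (open_measurable oU) mN.
  by rewrite [X in (X + _)%E]N0 add0e.
pose I := open_disjoint_itv oU.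
have mI q : measurable (I q) by apply: open_measurable; exact: open_disjoint_itv_open.
have mID q : measurable (I q `&` D : set (measurableTypeR R)) by exact: (measurableI _ _ (mI q) mD).
have mUD : measurable (\bigcup_q (I q `&` D) : set (measurableTypeR R)) by apply: bigcup_measurable => q _; exact: mID.
have UI : U = \bigcup_q I q by exact: open_disjoint_itv_bigcup.
have tI := @open_disjoint_itv_trivIset _ _ oU.
have NI : (nuD N <= \sum_(0 <= q <oo) nu (I q `&` D))%E.
  rewrite /nuD /= /mfrestr /mrestr.
  apply: (@le_trans _ _ (nu (\bigcup_q (I q `&` D)))).
    apply: le_measure; rewrite ?inE; first exact: measurableI.
      exact: mUD.
    by rewrite -setI_bigcupl -UI; exact: setSI.
  exact: (@measure_sigma_subadditive _ R (measurableTypeR R) nu _ _ mID mUD).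
apply: (le_trans NI); apply: lime_le.
  by apply: is_cvg_nneseries => q _ _; exact: measure_ge0.
near=> n.
(* The value [(a, b)] for an empty trace is a dummy: such indices are filtered out of [s]. *)
have /choice[P hP] (q : nat) : exists p : R * R, (I q `&` D) !=set0 ->
    [/\ subsegment a b p, p.1 < p.2, I q `&` D `<=` `]p.1, p.2] & `]p.1, p.2[ `<=` I q].
  have [nz|z] := pselect ((I q `&` D) !=set0); last by exists (a, b).
  have [||p hp] := piece _ _ nz; last by exists p.
  - exact: open_disjoint_itv_open.
  - exact: open_disjoint_itv_is_interval.
pose s := [seq q <- index_iota 0 n | `[< (I q `&` D) !=set0 >]].
have hs q : q \in s -> (I q `&` D) !=set0 by rewrite mem_filter => /andP[/asboolP].
apply: (@le_trans _ _ (\sum_(q <- s) (f (P q).2 - f (P q).1)%:E)%E).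
  rewrite /s big_filter [leRHS]big_mkcond /=; apply: lee_sum => q _.
  case: asboolP => [nz|nz]; last first.
    have -> : I q `&` D = set0 by apply/seteqP; split=> // t It; apply: nz; exists t.
    by rewrite [X in (X <= _)%E](_ : _ = 0%E) //; exact: (@measure0 _ _ _ nu).
  have [/and3P[aP PP Pb] _ IP _] := hP _ nz.
  rewrite -nu_itv//; apply: le_measure; rewrite ?inE//; exact: measurableI.
have nrm : (\sum_(q <- s) (f (P q).2 - f (P q).1) <= \sum_(p <- map P s) `|f p.2 - f p.1|).
  by rewrite big_map; apply: ler_sum => q _; exact: ler_norm.
rewrite sumEFin lee_fin (le_trans nrm)// ltW// hd//.
- by apply/allP => _ /mapP[q qs ->]; have [] := hP _ (hs _ qs).
- rewrite pairwise_map.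
  have us : uniq s by rewrite filter_uniq// iota_uniq.
  move: us; rewrite uniq_pairwise; apply: (@sub_in_pairwise _ (mem s)); last exact/allP.
  move=> q r qs rs /= qr.
  have [/and3P[aq qq qb] ltq _ Pq] := hP _ (hs _ qs).
  have [/and3P[ar rr rb] ltr _ Pr] := hP _ (hs _ rs).
  (* If two pieces overlapped, the midpoint of the overlap would lie in both [I q] and [I r], which
     are disjoint. *)
  rewrite /nonoverlap leNgt [X in _ || X]leNgt -negb_and; apply/negP => /andP[qr1 qr2].
  have [z [z1 z2]] : exists z, (Num.max (P q).1 (P r).1 < z) /\ (z < Num.min (P q).2 (P r).2).
    have mm : Num.max (P q).1 (P r).1 < Num.min (P q).2 (P r).2.
      by rewrite gt_max !lt_min ltq ltr qr1 qr2.
    by exists (((Num.max (P q).1 (P r).1) + (Num.min (P q).2 (P r).2)) / 2); rewrite !midf_lt.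
  move: z1 z2; rewrite gt_max lt_min => /andP[z1 z2] /andP[z3 z4].
  have Iqz : I q z by apply: Pq; rewrite /= in_itv /= z1 z3.
  have Irz : I r z by apply: Pr; rewrite /= in_itv /= z2 z4.
  have := tI q r Logic.I Logic.I (ex_intro _ z (conj Iqz Irz)).
  by move/eqP; rewrite (negbTE qr).
- rewrite big_map -lte_fin; apply: le_lt_trans muU.
  rewrite UI measure_bigcup//; last by move=> q _; exact: mI.
  apply: (@le_trans _ _ (\sum_(q <- index_iota 0 n) mu (I q))%E).
    rewrite -sumEFin /s big_filter [leLHS]big_mkcond /=; apply: lee_sum => q _.
    case: asboolP => [nz|_]; last exact: measure_ge0.
    have [/and3P[aP PP Pb] ltP _ PI] := hP _ nz.
    apply: (@le_trans _ _ (mu `](P q).1, (P q).2[%classic)).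
      by rewrite lebesgue_measure_itv /= lte_fin ltP -EFinB.
    by apply: le_measure; rewrite ?inE; [exact: measurable_itv|exact: mI|exact: PI].
  rewrite (eq_bigl (fun i => i \in [set: nat])) => [|i]; last by rewrite in_setT.
  by apply: nneseries_lim_ge => i _ _; exact: measure_ge0.
Unshelve. all: by end_near. Qed.

(** The Radon-Nikodym density of the Stieltjes measure of [clampf], made real-valued by [fine]. *)
Lemma monotone_density : exists2 g : R -> R, mu.-integrable `[a, b] (EFin \o g) &
  forall x, a <= x <= b -> \int[mu]_(t in `[a, x]) g t = f x - f a.
Proof.
have [h [h0 hfin hint hE]] := radon_nikodym_sigma_finite nuD_dominates.
have hg : EFin \o (fine \o h) = h by apply/funext => x /=; rewrite fineK.
have gint : mu.-integrable [set: R] (EFin \o (fine \o h)) by rewrite hg.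
exists (fine \o h).
  by apply: integrableS gint => //; exact: measurable_itv.
move=> x /andP[ax xb].
rewrite -Rintegral_itv_obnd_cbnd; last first.
  by apply: integrableS gint => //; exact: measurable_itv.
rewrite /Rintegral.
have -> : (\int[mu]_(t in `]a, x]) ((fine \o h) t)%:E)%E = (\int[mu]_(t in `]a, x]) h t)%E.
  by apply: eq_integral => t _ /=; rewrite fineK.
rewrite -hE; last exact: measurable_itv.
rewrite /nuD /= /mfrestr /mrestr setIidl; last first.
  by rewrite /D; apply: subset_itvl; rewrite bnd_simp.
rewrite [X in fine X](_ : _ = (f x - f a)%:E) //; exact: (nu_itv (lexx a) ax xb).
Qed.

End MonotoneDensity.

(* [R] also carries a measurable structure with the default display, which unification tends to pick. *)
Lemma measurable_itvR (R : realType) (i : interval R) :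
  measurable ([set` i] : set (measurableTypeR R)).
Proof. exact: measurable_itv. Qed.

Section IntegrableReal.
Context d (T : measurableType d) (R : realType) (mu : {measure set T -> \bar R}).
Variables (D : set T) (f g : T -> R).
Hypotheses (mD : measurable D) (fi : mu.-integrable D (EFin \o f))
  (gi : mu.-integrable D (EFin \o g)).

Lemma integrable_realD : mu.-integrable D (EFin \o (fun x => f x + g x)).
Proof.
rewrite (_ : _ \o _ = (EFin \o f) \+ (EFin \o g))%E; first exact: integrableD.
exact/funext.
Qed.

Lemma integrable_realB : mu.-integrable D (EFin \o (fun x => f x - g x)).
Proof.
rewrite (_ : _ \o _ = (EFin \o f) \- (EFin \o g))%E; first exact: integrableB.
exact/funext.
Qed.

Lemma integrable_realZ (c : R) : mu.-integrable D (EFin \o (fun x => c * f x)).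
Proof.
rewrite (_ : _ \o _ = (fun x => c%:E * (f x)%:E))%E; first exact: integrableZl.
exact/funext.
Qed.

Lemma integrable_real_norm : mu.-integrable D (EFin \o (fun x => `|f x|)).
Proof. exact: (integrable_norm fi). Qed.

End IntegrableReal.

(** * Total variation and Jordan decomposition of absolutely continuous functions *)

Section AbsContinuousDensity.
Context {R : realType}.
Local Notation mu := (@lebesgue_measure R).
Local Notation TV := (@total_variation R).
Implicit Types (a b : R) (f : R -> R).

Fixpoint pieces (x : R) (l : seq R) : seq (R * R) :=
  if l is h :: t then (x, h) :: pieces h t else [::].

Lemma pieces_subsegment x y l : itv_partition x y l -> all (subsegment x y) (pieces x l).
Proof.
suff H z : z <= x -> itv_partition x y l -> all (subsegment z y) (pieces x l) by exact: H.
elim: l x z => //= h t IH x z zx [/= /andP[xh ht] hy].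
rewrite /subsegment /= zx (ltW xh) IH ?andbT//; last by rewrite (le_trans zx)// ltW.
exact: (@itv_partition_le _ _ _ _ t).
Qed.

Lemma pieces_nonoverlap x y l : itv_partition x y l -> pairwise nonoverlap (pieces x l).
Proof.
elim: l x => //= h t IH x [/= /andP[xh ht] hy].
rewrite IH// andbT; apply/allP => q /(allP (pieces_subsegment (conj ht hy))).
by move=> /and3P[hq _ _]; rewrite /nonoverlap /= hq.
Qed.

Lemma pieces_length x y l : itv_partition x y l ->
  \sum_(q <- pieces x l) (q.2 - q.1) = y - x.
Proof.
elim: l x => [x /itv_partition_nil ->|h t IH x /= /itv_partition_cons hy].
  by rewrite big_nil subrr.
by rewrite big_cons (IH h)//=; ring.
Qed.

Lemma pieces_variation f x y l : itv_partition x y l ->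
  \sum_(q <- pieces x l) `|f q.2 - f q.1| = variation x y f l.
Proof.
move=> xyl; rewrite variation_zip//.
elim: l x xyl => [x _|h t IH x /= /itv_partition_cons hy]; first by rewrite !big_nil.
by rewrite !big_cons (IH h).
Qed.

Lemma nonoverlapC : symmetric (@nonoverlap R).
Proof. by move=> p q; rewrite /nonoverlap orbC. Qed.

Lemma nonoverlap_subsegment (p q r : R * R) : subsegment p.1 p.2 q -> nonoverlap p r -> nonoverlap q r.
Proof.
move=> /and3P[pq _ qp] /orP[pr|rp]; rewrite /nonoverlap.
  by rewrite (le_trans qp pr).
by rewrite (le_trans rp pq) orbT.
Qed.

(** The suprema defining the variations are taken one segment at a time. In the generalization, the
    segments of [s] are already pieces of partitions while those of [t] still carry their total
    variation; refining a segment keeps the total length, so the same [d] serves throughout. Passing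
    to suprema costs the strict inequality. *)
Lemma abs_continuous_total_variation a b f e : real_abs_continuous a b f -> 0 < e ->
  exists2 d, 0 < d & forall t, all (subsegment a b) t -> pairwise nonoverlap t ->
    \sum_(p <- t) (p.2 - p.1) < d -> (\sum_(p <- t) TV p.1 p.2 f <= e%:E)%E.
Proof.
move=> acf e0; have [d d0 hd] := acf e e0; exists d => // t.
suff H s : all (subsegment a b) (s ++ t) -> pairwise nonoverlap (s ++ t) ->
    \sum_(p <- s ++ t) (p.2 - p.1) < d ->
    ((\sum_(p <- s) `|f p.2 - f p.1|)%:E + \sum_(p <- t) TV p.1 p.2 f <= e%:E)%E.
  by move=> t1 t2 t3; have := H [::] t1 t2 t3; rewrite big_nil add0e.
elim: t s => [|p t IH] s.
  rewrite cats0 big_nil adde0 lee_fin => s1 s2 s3; apply/ltW; exact: hd.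
rewrite all_cat /= => /and3P[s1 p1 t1].
rewrite pairwise_cat allrel_consr /= => /and4P[/andP[sp st] s2 pt t2].
rewrite big_cat big_cons /= => len.
have /and3P[ap pp pb] := p1.
have IHs : ((\sum_(p <- s) `|f p.2 - f p.1|)%:E + \sum_(p <- t) TV p.1 p.2 f <= e%:E)%E.
  apply: IH; rewrite ?all_cat ?s1//.
    by rewrite pairwise_cat st s2.
  rewrite big_cat /=; apply: le_lt_trans len.
  by rewrite lerD2l lerDr subr_ge0.
have t0 : (0 <= \sum_(p <- t) TV p.1 p.2 f)%E.
  rewrite big_seq; apply: sume_ge0 => q /(allP t1) /and3P[_ qq _].
  exact: total_variation_ge0.
have tfin : (\sum_(p <- t) TV p.1 p.2 f)%E \is a fin_num.
  rewrite ge0_fin_numE//; apply: le_lt_trans (ltry e).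
  by apply: le_trans IHs; rewrite leeDr// lee_fin sumr_ge0.
rewrite big_cons; move: pp; rewrite le_eqVlt => /predU1P[pp|pp].
  by rewrite pp total_variationxx add0e.
rewrite addeCA -leeBrDr; last by rewrite fin_numD.
apply: ge_ereal_sup => _ [_ [l pl <-] <-].
rewrite leeBrDr; last by rewrite fin_numD.
rewrite addeA -EFinD [X in (X%:E + _)%E]addrC -(pieces_variation f pl) -big_cat /=.
apply: IH.
- rewrite !all_cat s1 t1 andbT /=.
  apply/allP => q /(allP (pieces_subsegment pl)) /and3P[pq qq qp].
  by rewrite /subsegment qq (le_trans ap pq) (le_trans qp pb).
- rewrite !pairwise_cat allrel_catl st s2 t2 (pieces_nonoverlap pl) /= !andbT.
  apply/andP; split.
    apply/allrelP => q r /(allP (pieces_subsegment pl)) qp rt.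
    by apply: (nonoverlap_subsegment qp); exact: (allP pt).
  apply/allrelP => q r qs /(allP (pieces_subsegment pl)) rp.
  by rewrite nonoverlapC; apply: (nonoverlap_subsegment rp); rewrite nonoverlapC; exact: (allP sp).
- by rewrite !big_cat /= (pieces_length pl) -addrA.
Qed.

(** Jordan decomposition [f = F - (F - f)], with [F] the variation of [f] from [a]: both terms are
    nondecreasing and absolutely continuous, so [monotone_density] applies to each. *)
Lemma real_abs_continuous_density a b f : a < b -> real_abs_continuous a b f ->
  exists2 g : R -> R, mu.-integrable `[a, b] (EFin \o g) &
    forall x, a <= x <= b -> \int[mu]_(t in `[a, x]) g t = f x - f a.
Proof.
move=> ab acf.
have TVfin : TV a b f \is a fin_num.
  (* Take the [d] of [e = 1] and cut [[a, b]] into [N] segments shorter than [d]: each has variation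
     at most 1, so the total is at most [N]. *)
  have [d d0 hd] := abs_continuous_total_variation acf ltr01.
  pose N := (Num.trunc ((b - a) / d)).+1.
  have ba0 : 0 < b - a by rewrite subr_gt0.
  have Nd : (b - a) / N%:R < d.
    rewrite ltr_pdivrMr ?ltr0n// mulrC -ltr_pdivrMr// /N.
    by apply: truncnS_gt.
  have N0 : N%:R != 0 :> R by rewrite pnatr_eq0.
  pose x k := a + (b - a) / N%:R * k%:R.
  have x0 : x 0 = a by rewrite /x mulr0 addr0.
  have xN : x N = b by rewrite /x divfK// addrC subrK.
  have xmono : {homo x : m n / (m <= n)%N >-> m <= n}.
    by move=> k l kl; rewrite lerD2l ler_wpM2l ?ler_nat// divr_ge0// ltW.
  suff H k : (k <= N)%N -> (TV a (x k) f <= k%:R%:E)%E.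
    rewrite ge0_fin_numE ?total_variation_ge0 ?ltW//.
    by apply: le_lt_trans (ltry N%:R); have := H N (leqnn _); rewrite xN.
  elim: k => [_|k IH kN]; first by rewrite x0 total_variationxx.
  have ax : a <= x k by rewrite -x0 xmono.
  rewrite (@total_variationD _ a (x k.+1) (x k)) ?xmono//.
  rewrite -natr1 EFinD; apply: leeD; first exact: (IH (ltnW kN)).
  have := hd [:: (x k, x k.+1)]; rewrite !big_seq1 /=; apply => //.
    by rewrite /subsegment /= ax -xN !xmono.
  by apply: le_lt_trans Nd; rewrite /x -natr1; lra.
have fin x y : a <= x -> x <= y -> y <= b -> TV x y f \is a fin_num.
  move=> ax xy yb.
  move: TVfin; rewrite (total_variationD f ax (le_trans xy yb)).
  by rewrite (total_variationD f xy yb) !fin_numD => /and3P[].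
pose F x := fine (TV a x f).
have FE x y : a <= x -> x <= y -> y <= b -> TV x y f = (F y - F x)%:E.
  move=> ax xy yb; rewrite /F (total_variationD f ax xy) fineD ?fin//; last exact: le_trans yb.
  by rewrite addrC addKr fineK ?fin.
have dF x y : a <= x -> x <= y -> y <= b -> `|f y - f x| <= F y - F x.
  by move=> ax xy yb; rewrite -lee_fin -FE// total_variation_ge.
have Fnd : {in `[a, b] &, nondecreasing_fun F}.
  move=> x y; rewrite !in_itv /= => /andP[ax _] /andP[_ yb] xy.
  by rewrite -subr_ge0; apply: le_trans (dF _ _ ax xy yb).
have Gnd : {in `[a, b] &, nondecreasing_fun (fun x => F x - f x)}.
  move=> x y; rewrite !in_itv /= => /andP[ax _] /andP[_ yb] xy.
  have := le_trans (ler_norm _) (dF _ _ ax xy yb); lra.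
have acF e : 0 < e -> exists2 d : R, 0 < d & forall s, all (subsegment a b) s -> pairwise nonoverlap s ->
    \sum_(p <- s) (p.2 - p.1) < d -> \sum_(p <- s) (F p.2 - F p.1) < e.
  move=> e0; have e20 : 0 < e / 2 by rewrite divr_gt0.
  have [d d0 hd] := abs_continuous_total_variation acf e20; exists d => // s s1 s2 s3.
  apply: (@le_lt_trans _ _ (e / 2)); last by rewrite ltr_pdivrMr// ltr_pMr// ltr1n.
  rewrite -lee_fin; apply: le_trans (hd _ s1 s2 s3).
  rewrite -sumEFin le_eqVlt; apply/orP; left; apply/eqP.
  rewrite big_seq [RHS]big_seq; apply: eq_bigr => p /(allP s1) /and3P[? ? ?].
  by rewrite FE.
have [gF gFi gFE] : exists2 g : R -> R, mu.-integrable `[a, b] (EFin \o g) &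
    forall x, a <= x <= b -> \int[mu]_(t in `[a, x]) g t = F x - F a.
  apply: monotone_density => // e /acF[d d0 hd]; exists d => // s s1 s2 s3.
  apply: le_lt_trans (hd _ s1 s2 s3); rewrite big_seq [leRHS]big_seq.
  apply: ler_sum => p /(allP s1) /and3P[ap pp pb].
  by rewrite ger0_norm// subr_ge0 Fnd// in_itv /= ?ap ?pb ?(le_trans pp)//= (le_trans ap).
have [gG gGi gGE] : exists2 g : R -> R, mu.-integrable `[a, b] (EFin \o g) &
    forall x, a <= x <= b -> \int[mu]_(t in `[a, x]) g t = (F x - f x) - (F a - f a).
  apply: (@monotone_density _ a b (fun x => F x - f x)) => // e e0.
  have e20 : 0 < e / 2 by rewrite divr_gt0.
  have [d d0 hd] := acF _ e20; exists d => // s s1 s2 s3.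
  (* An increment of [F - f] is at most twice that of [F], since [F] dominates the increments of
     [f]. *)
  apply: (@le_lt_trans _ _ (\sum_(p <- s) 2 * (F p.2 - F p.1))).
    rewrite big_seq [leRHS]big_seq.
    apply: ler_sum => p /(allP s1) /and3P[ap pp pb].
    have := dF _ _ ap pp pb; rewrite !ler_norml => /andP[]; lra.
  by rewrite -mulr_sumr mulrC -ltr_pdivlMr//; exact: hd.
exists (fun x => gF x - gG x).
  by apply: integrable_realB => //; exact: measurable_itv.
move=> x axb; have /andP[ax xb] := axb.
have sub : `[a, x] `<=` `[a, b] by apply: subset_itvl; rewrite bnd_simp.
rewrite RintegralB ?gFE ?gGE//; first by ring.
  by apply: integrableS gFi => //; exact: measurable_itv.
by apply: integrableS gGi => //; exact: measurable_itv.
Qed.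

End AbsContinuousDensity.

Lemma ae_neq (R : realType) (c : R) : \forall x \ae (@lebesgue_measure R), x <> c.
Proof.
exists [set c]; split; [exact: measurable_set1|exact: lebesgue_measure_set1|].
by move=> x /= /contrapT.
Qed.

(** * Indefinite integrals of integrable functions *)

Section Primitive.
Context {R : realType} (a b : R).
Hypothesis ab : a < b.
Local Notation mu := (@lebesgue_measure R).
Implicit Types (f g : R -> R).

(** A relation rather than an operator: the density [g] is determined only almost everywhere, and
    [primitive_ae] allows any integrable change of it on a null set. *)
Definition primitive f g : Prop := mu.-integrable `[a, b] (EFin \o g) /\
  forall x, a <= x <= b -> f x = f a + \int[mu]_(t in `[a, x]) g t.

Lemma integrable_sub g x y : a <= x -> y <= b ->
  mu.-integrable `[a, b] (EFin \o g) -> mu.-integrable `[x, y] (EFin \o g).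
Proof.
move=> ax yb; apply: integrableS => //; try exact: measurable_itv.
by apply: subset_itv; rewrite bnd_simp.
Qed.

Lemma primitive_itv f g x y : primitive f g -> a <= x -> x <= y -> y <= b ->
  f y - f x = \int[mu]_(t in `]x, y]) g t.
Proof.
move=> [gi fE] ax xy yb.
rewrite (fE y) ?(le_trans ax xy)// (fE x) ?ax ?(le_trans xy)//.
rewrite opprD addrACA subrr add0r.
rewrite Rintegral_itvB ?bnd_simp//; exact: integrable_sub.
Qed.

(** Absolute continuity of the integral of the norm of [g], extended by 0 and integrated over the
    union of the intervals. The indexed form serves both [abs_continuous] and, through
    [disjoint_family_seq], [real_abs_continuous]. *)
Lemma primitive_abs_small f g e : primitive f g -> 0 < e ->
  exists2 d : R, 0 < d & forall (n : nat) (I : 'I_n -> R * R),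
    (forall k, a <= (I k).1 /\ (I k).1 <= (I k).2 /\ (I k).2 <= b) ->
    trivIset setT (fun k => `](I k).1, (I k).2[%classic) ->
    \sum_(k < n) ((I k).2 - (I k).1) < d ->
    \sum_(k < n) `|f (I k).2 - f (I k).1| < e.
Proof.
move=> fg e0; have [gi fE] := fg.
pose h := g \_ `[a, b].
have hi : mu.-integrable [set: R] (EFin \o h).
  rewrite /h -restrict_EFin.
  have mab : measurable (`[a, b]%classic : set (measurableTypeR R)) by exact: measurable_itv.
  exact: ((@integrable_mkcond _ _ _ mu _ _ mab).1 gi).
have [d [d0 hd]] := integral_normr_continuous hi e0.
exists d => // n I Iab tI Id.
pose J k : set (measurableTypeR R) := `](I k).1, (I k).2[%classic.
have mJ k : measurable (J k) by exact: measurable_itv.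
pose U := \big[setU/set0]_(k < n) J k.
have mU : measurable U by exact: bigsetU_measurable.
have muU : (mu U < d%:E)%E.
  have len k : mu (J k) = ((I k).2 - (I k).1)%:E.
    rewrite /J lebesgue_measure_itv /= lte_fin.
    have [_ [le12 _]] := Iab k; case: ltP => [_|le21]; first by rewrite EFinB.
    have /eqP -> : (I k).1 == (I k).2 by rewrite eq_le le12 le21.
    by rewrite subrr.
  rewrite /U measure_semi_additive_ord//.
  rewrite (_ : (\sum_(_ < n) _)%E = (\sum_(k < n) ((I k).2 - (I k).1))%:E)%E ?lte_fin//.
  by rewrite -sumEFin; apply: eq_bigr => k _; exact: len.
have nhi : mu.-integrable [set: R] (EFin \o (fun t => `|h t|)) by exact: integrable_real_norm.
apply: le_lt_trans (hd _ mU muU).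
rewrite -lee_fin /Rintegral fineK; last first.
  by apply: integrable_fin_num => //; apply: integrableS nhi.
have mnh : measurable_fun U (fun t : measurableTypeR R => (`|h t|)%:E).
  by case/integrableP: nhi => mh _; apply: measurable_funS mh.
have uI : uniq (index_enum 'I_n) by rewrite /index_enum unlock -enumT enum_uniq.
have tIs : trivIset [set` index_enum 'I_n] J by exact: sub_trivIset tI.
rewrite (ge0_integral_bigsetU mu mJ uI tIs mnh); last by move=> x _; rewrite lee_fin.
rewrite -sumEFin; apply: lee_sum => k _.
have [ak [le12 kb]] := Iab k.
have nhJ : mu.-integrable (J k) (EFin \o (fun t => `|h t|)) by apply: integrableS nhi.
rewrite -[leRHS]fineK; last exact: integrable_fin_num.
rewrite lee_fin (primitive_itv fg)//.
have gxy : mu.-integrable `](I k).1, (I k).2] (EFin \o g).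
  apply: integrableS gi; [exact: measurable_itv|exact: measurable_itv|].
  by apply: subset_itv; rewrite bnd_simp.
apply: (le_trans (le_normr_Rintegral (measurable_itvR _) gxy)).
rewrite -Rintegral_itv_bndo_bndc; last first.
  apply: integrable_real_norm; apply: integrableS gxy;
    [exact: measurable_itv|exact: measurable_itv|].
  by apply: subset_itv; rewrite bnd_simp.
rewrite le_eqVlt; apply/orP; left; apply/eqP; apply: eq_Rintegral => t.
rewrite inE /= in_itv /= => /andP[at_ tb]; rewrite /h patchE ifT// inE /= in_itv /=.
by rewrite (le_trans ak (ltW at_)) (le_trans (ltW tb) kb).
Qed.

Lemma primitive_derive f g : primitive f g ->
  \forall x \ae mu, `[a, b]%classic x -> is_derive x 1 f (g x).
Proof.
move=> [gi fE].
pose h := g \_ `[a, b].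
have hi : mu.-integrable [set: R] (EFin \o h).
  rewrite /h -restrict_EFin.
  have mab : measurable (`[a, b]%classic : set (measurableTypeR R)) by exact: measurable_itv.
  exact: ((@integrable_mkcond _ _ _ mu _ _ mab).1 gi).
have loch : locally_integrable [set: R] h.
  by apply: open_integrable_locally => //; exact: openT.
have hiy y : mu.-integrable [set` Interval (BLeft a) (BRight y)] (EFin \o h).
  by apply: integrableS hi => //; exact: measurable_itv.
(* The derivative is two-sided whereas [fE] holds only inside [[a, b]], so the end points are
   discarded as a null set. *)
move: (ae_neq a) (ae_neq b) (FTC1 hiy loch).
apply: (@filterS3 _ _ (ae_filter_ringOfSetsType mu)) => x /eqP xa /eqP xb /=.
rewrite lte_fin => H; rewrite /= in_itv /= => /andP[ax xb'].
have {xa}ax : a < x by rewrite lt_neqAle eq_sym xa.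
have {xb'}xb : x < b by rewrite lt_neqAle xb.
have [dH HE] := H ax.
have hx : h x = g x by rewrite /h patchE ifT// inE /= in_itv /= !ltW.
rewrite -hx -HE derive1E.
have /derivableP dF := dH.
have dC : is_derive x 1 (cst (f a) : R -> R) 0 by exact: is_derive_cst.
have dD := is_deriveD dC dF; rewrite add0r in dD.
apply: near_eq_is_derive dD.
near=> y => /=.
rewrite /cst /= (fE y); last by apply/andP; split; apply/ltW; near: y; [exact: lt_nbhsr|exact: lt_nbhsl].
congr (_ + _); apply: eq_Rintegral => t; rewrite inE /= in_itv /= => /andP[at_ ty].
rewrite /h patchE ifT// inE /= in_itv /= at_ (le_trans ty)//.
by apply/ltW; near: y; exact: lt_nbhsl.
Unshelve. all: by end_near. Qed.

End Primitive.

(** * Calculus of primitives *)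

Section PrimitiveCalculus.
Context {R : realType} (a b : R).
Hypothesis ab : a < b.
Local Notation mu := (@lebesgue_measure R).
Implicit Types (f g h : R -> R).

Let I : set (measurableTypeR R) := `[a, b]%classic.
Let mI : measurable I. Proof. exact: measurable_itvR. Qed.
Lemma disjoint_family_seq (D : R * R -> R) (d e : R) :
    (forall (n : nat) (J : 'I_n -> R * R),
      (forall k, a <= (J k).1 /\ (J k).1 <= (J k).2 /\ (J k).2 <= b) ->
      trivIset setT (fun k => `](J k).1, (J k).2[%classic) ->
      \sum_(k < n) ((J k).2 - (J k).1) < d -> \sum_(k < n) D (J k) < e) ->
  forall s, all (subsegment a b) s -> pairwise nonoverlap s ->
    \sum_(p <- s) (p.2 - p.1) < d -> \sum_(p <- s) D p < e.
Proof.
move=> H s s1 s2; rewrite !(big_nth (0, 0)) !big_mkord => s3.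
apply: (H (size s) (fun k => nth (0, 0) s k)) => //.
  by move=> k; have /and3P[] := allP s1 _ (mem_nth (0, 0) (ltn_ord k)).
apply/trivIsetP => i j _ _.
wlog ij : i j / (i < j)%N => [W|_].
  rewrite neq_ltn => /orP[ij|ji]; first by apply: W => //; rewrite neq_ltn ij.
  by rewrite setIC; apply: W => //; rewrite neq_ltn ji.
have := pairwiseP (0, 0) s2 i j; rewrite !inE => /(_ (ltn_ord i) (ltn_ord j) ij).
rewrite /nonoverlap => ov; apply/seteqP; split=> // x [] /=.
rewrite !in_itv /= => /andP[x1 x2] /andP[x3 x4].
by case/orP: ov => [/(lt_le_trans x2)/lt_trans/(_ x3)|/(lt_le_trans x4)/lt_trans/(_ x1)]; rewrite ltxx.
Qed.

Lemma primitive_real_abs_continuous f g : primitive a b f g -> real_abs_continuous a b f.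
Proof.
move=> fg e e0; have [d d0 hd] := primitive_abs_small fg e0; exists d => //.
exact: (disjoint_family_seq (D := fun p => `|f p.2 - f p.1|)).
Qed.

Lemma abs_continuous_primitive f : real_abs_continuous a b f -> exists g, primitive a b f g.
Proof.
move=> /(real_abs_continuous_density ab)[g gi gE]; exists g; split=> // x xab.
by rewrite gE// addrC subrK.
Qed.

Lemma primitive_continuous f g : primitive a b f g -> {within `[a, b], continuous f}.
Proof.
move=> [gi fE].
have := parameterized_integral_continuous (ltW ab) gi.
rewrite /parameterized_integral => cG.
have cF : {within `[a, b], continuous (fun x => f a + \int[mu]_(t in `[a, x]) g t)}.
  by move=> x; apply: (@cvgD _ R^o); [exact: cvg_cst|exact: cG].
move: cF; apply: subspace_eq_continuous => x; rewrite inE /= in_itv /= => xab.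
by rewrite [RHS]fE.
Qed.

Lemma primitive_measurable f g : primitive a b f g -> measurable_fun I f.
Proof.
move=> /primitive_continuous cf.
exact: subspace_continuous_measurable_fun.
Qed.

Lemma primitive_bounded f g : primitive a b f g ->
  exists2 M, 0 <= M & forall x, a <= x <= b -> `|f x| <= M.
Proof.
move=> [gi fE].
have ngi : mu.-integrable I (EFin \o (fun t => `|g t|)) by exact: integrable_real_norm.
exists (`|f a| + \int[mu]_(t in I) `|g t|).
  by rewrite addr_ge0// Rintegral_ge0.
move=> x /andP[ax xb]; rewrite fE ?ax//.
apply: (le_trans (ler_normD _ _)); rewrite lerD2l.
have gx : mu.-integrable `[a, x] (EFin \o g) by exact: integrable_sub gi.
apply: (le_trans (le_normr_Rintegral (measurable_itvR _) gx)).
rewrite /Rintegral fine_le//.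
- exact: (integrable_fin_num (measurable_itvR _) (integrable_real_norm gx)).
- exact: integrable_fin_num.
apply: ge0_subset_integral => //.
  by case/integrableP: ngi.
by apply: subset_itvl; rewrite bnd_simp.
Qed.

Lemma integrable_bounded_mul (h g : R -> R) (M : R) : measurable_fun I h ->
  (forall x, a <= x <= b -> `|h x| <= M) -> mu.-integrable I (EFin \o g) ->
  mu.-integrable I (EFin \o (fun x => h x * g x)).
Proof.
move=> mh hM gi.
rewrite (_ : _ \o _ = (EFin \o h) \* (EFin \o g))%E; last exact/funext.
apply: integrableMr => //.
exists M; split; first exact: num_real.
by move=> N MN x; rewrite /I /= in_itv /= => xab; apply: le_trans (ltW MN); exact: hM.
Qed.

Lemma primitive_mul_integrable f f' g : primitive a b f f' -> mu.-integrable I (EFin \o g) ->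
  mu.-integrable I (EFin \o (fun x => f x * g x)).
Proof.
move=> ff' gi; have [M _ fM] := primitive_bounded ff'.
exact: integrable_bounded_mul (primitive_measurable ff') fM gi.
Qed.

Lemma ae_Rintegral_eq g h (D : set (measurableTypeR R)) : measurable D -> D `<=` I ->
  measurable_fun D g -> measurable_fun D h ->
  (\forall x \ae mu, I x -> g x = h x) ->
  \int[mu]_(t in D) g t = \int[mu]_(t in D) h t.
Proof.
move=> mD DI mg mh gh; rewrite /Rintegral; congr fine.
apply: ae_eq_integral => //; [exact/measurable_EFinP|exact/measurable_EFinP|].
by apply: filterS gh => x gh Dx; rewrite gh//; exact: DI.
Qed.

Lemma primitive_ae f g h : primitive a b f g -> mu.-integrable I (EFin \o h) ->
  (\forall x \ae mu, I x -> g x = h x) -> primitive a b f h.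
Proof.
move=> [gi fE] hi gh; split=> // x xab; rewrite fE//; congr (_ + _).
have /andP[ax xb] := xab.
have gx : mu.-integrable `[a, x] (EFin \o g) by exact: integrable_sub gi.
have hx : mu.-integrable `[a, x] (EFin \o h) by exact: integrable_sub hi.
apply: ae_Rintegral_eq => //.
- by apply: subset_itvl; rewrite bnd_simp.
- by case/integrableP: gx => /measurable_EFinP.
- by case/integrableP: hx => /measurable_EFinP.
Qed.

Lemma primitive_eq f g h : primitive a b f g ->
  (forall x, a <= x <= b -> f x = h x) -> primitive a b h g.
Proof.
move=> [gi fE] fh; split=> // x xab; rewrite -!fh ?lexx ?(ltW ab)//; exact: fE.
Qed.

Lemma primitive_lin (c : R) f f' g g' : primitive a b f f' -> primitive a b g g' ->
  primitive a b (fun x => c * f x + g x) (fun x => c * f' x + g' x).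
Proof.
move=> [fi fE] [gi gE].
have cfi : mu.-integrable I (EFin \o (fun x => c * f' x)) by exact: integrable_realZ.
split; first by exact: integrable_realD.
move=> x xab; have /andP[ax xb] := xab; rewrite fE// gE//.
rewrite RintegralD ?RintegralZl ?(integrable_sub _ _ fi) ?(integrable_sub _ _ gi)
  ?(integrable_sub _ _ cfi)//; try exact: measurable_itvR.
by ring.
Qed.

Lemma primitive_cst (c : R) : primitive a b (cst c) (cst 0).
Proof.
split.
  rewrite (_ : _ \o _ = cst 0%E); first exact: integrable0.
  exact/funext.
by move=> x _; rewrite /cst /= Rintegral_cst ?mul0r ?addr0//; exact: measurable_itvR.
Qed.

Lemma real_abs_continuous_mul f g f' g' : primitive a b f f' -> primitive a b g g' ->
  real_abs_continuous a b (fun x => f x * g x).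
Proof.
move=> ff' gg' e e0.
have [M M0 fM] := primitive_bounded ff'.
have [N N0 gN] := primitive_bounded gg'.
pose K := M + N + 1.
have K0 : 0 < K by rewrite /K ltr_wpDl// addr_ge0.
have eK0 : 0 < e / K / 2 by rewrite !divr_gt0.
have [d1 d10 h1] := primitive_real_abs_continuous ff' eK0.
have [d2 d20 h2] := primitive_real_abs_continuous gg' eK0.
exists (Num.min d1 d2); first by rewrite lt_min d10.
move=> s s1 s2; rewrite lt_min => /andP[sd1 sd2].
have {}h1 := h1 s s1 s2 sd1; have {}h2 := h2 s s1 s2 sd2.
apply: (@le_lt_trans _ _ (\sum_(p <- s) (K * `|f p.2 - f p.1| + K * `|g p.2 - g p.1|))).
  rewrite big_seq [leRHS]big_seq; apply: ler_sum => p /(allP s1) /and3P[ap pp pb].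
  have -> : f p.2 * g p.2 - f p.1 * g p.1 = g p.2 * (f p.2 - f p.1) + f p.1 * (g p.2 - g p.1) by ring.
  apply: (le_trans (ler_normD _ _)); rewrite !normrM; apply: lerD; apply: ler_wpM2r => //.
    apply: (@le_trans _ _ N); last by rewrite /K; lra.
    by apply: gN; rewrite pb andbT (le_trans ap pp).
  apply: (@le_trans _ _ M); last by rewrite /K; lra.
  by apply: fM; rewrite ap /= (le_trans pp pb).
rewrite big_split /= -!mulr_sumr -mulrDr -ltr_pdivlMl//.
have -> : K^-1 * e = e / K / 2 + e / K / 2 by field; rewrite gt_eqF.
exact: ltrD.
Qed.

(** The product is absolutely continuous, hence has some density [k]. At almost every point all
    three derivatives exist, and the product rule identifies [k] there. [primitive_expR] follows the
    same pattern with the chain rule. *)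
Lemma primitive_mul f g f' g' : primitive a b f f' -> primitive a b g g' ->
  primitive a b (fun x => f x * g x) (fun x => f' x * g x + f x * g' x).
Proof.
move=> ff' gg'.
have [k fgk] := abs_continuous_primitive (real_abs_continuous_mul ff' gg').
have i1 := primitive_mul_integrable gg' ff'.1.
have i2 := primitive_mul_integrable ff' gg'.1.
apply: (primitive_ae fgk).
  rewrite (_ : (fun x => _) = (fun x => g x * f' x + f x * g' x)); first exact: integrable_realD.
  by apply/funext => x; rewrite mulrC.
move: (primitive_derive ff') (primitive_derive gg') (primitive_derive fgk).
apply: (@filterS3 _ _ (ae_filter_ringOfSetsType mu)) => x + + + Ix.
move=> /(_ Ix) df /(_ Ix) dg /(_ Ix) [_ <-].
have [_ ->] := is_deriveM df dg.
by rewrite /GRing.scale /= addrC mulrC [in RHS]addrC [f x * _]mulrC addrC [_ * g x]mulrC addrC.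
Qed.

Lemma primitive_expR f f' : primitive a b f f' ->
  primitive a b (fun x => expR (f x)) (fun x => f' x * expR (f x)).
Proof.
move=> ff'; have [M M0 fM] := primitive_bounded ff'.
(* The exponential is Lipschitz below [M] with constant [expR M], by [1 + t <= expR t] at
   [t = y - x]. *)
have lip x y : x <= M -> y <= M -> `|expR x - expR y| <= expR M * `|x - y|.
  wlog xy : x y / y <= x => [H xM yM|xM _].
    have [yx|/ltW xy] := leP y x; first exact: H.
    by rewrite distrC [X in _ * X]distrC; exact: H.
  rewrite !ger0_norm ?subr_ge0 ?ler_expR//.
  apply: (@le_trans _ _ (expR x * (x - y))); last first.
    by apply: ler_wpM2r; rewrite ?subr_ge0 ?ler_expR.
  have := expR_ge1Dx (y - x); rewrite -(ler_pM2l (expR_gt0 x)) -expRD [x + (y - x)]addrC subrK.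
  lra.
have ace : real_abs_continuous a b (fun x => expR (f x)).
  move=> e e0; have eM0 : 0 < e / expR M by rewrite divr_gt0// expR_gt0.
  have [d d0 hd] := primitive_real_abs_continuous ff' eM0; exists d => // s s1 s2 s3.
  apply: (@le_lt_trans _ _ (\sum_(p <- s) expR M * `|f p.2 - f p.1|)).
    rewrite big_seq [leRHS]big_seq; apply: ler_sum => p /(allP s1) /and3P[ap pp pb].
    by apply: lip; apply: (le_trans (ler_norm _)); apply: fM; rewrite ?pb ?ap ?(le_trans ap pp) ?(le_trans pp pb).
  by rewrite -mulr_sumr mulrC -ltr_pdivlMr ?expR_gt0//; exact: hd.
have [k fk] := abs_continuous_primitive ace.
apply: (primitive_ae fk).
  rewrite (_ : (fun x => _) = (fun x => expR (f x) * f' x)).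
    exact: primitive_mul_integrable fk ff'.1.
  by apply/funext => x; rewrite mulrC.
move: (primitive_derive ff') (primitive_derive fk).
apply: (@filterS2 _ _ (ae_filter_ringOfSetsType mu)) => x + + Ix.
move=> /(_ Ix) df /(_ Ix) [_ <-].
have [_ e] := is_derive1_comp (is_derive_expR (f x)) df.
by apply: etrans e _; rewrite mulrC.
Qed.

(** By continuity, a non-zero value at [x0] persists on a segment of positive length, clipped to
    [[a, b]], which no null set contains. *)
Lemma primitive_ae0 f g : primitive a b f g -> (\forall x \ae mu, I x -> f x = 0) ->
  forall x, a <= x <= b -> f x = 0.
Proof.
move=> fg [N [mN N0 fN]] x0 x0ab; apply: contrapT => /eqP fx0.
have e0 : 0 < `|f x0| by rewrite normr_gt0.
have [d d0 hd] := real_abs_continuous_unif (primitive_real_abs_continuous fg) e0.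
have /andP[ax xb] := x0ab.
have [r r0 rd] : exists2 r, 0 < r & r < d by exists (d / 2); lra.
pose u := Num.max a (x0 - r); pose v := Num.min b (x0 + r).
have uv : u < v by rewrite gt_max !lt_min; apply/andP; split; apply/andP; split; move: r0 rd ax xb ab; clear; lra.
have sub : `[u, v] `<=` N.
  move=> x; rewrite /= in_itv /= ge_max le_min => /andP[/andP[ax' xd'] /andP[xb' xd]].
  apply: fN => /= fx.
  have Ix : a <= x <= b by rewrite ax' xb'.
  have lt : `|x - x0| < d by rewrite ltr_norml; apply/andP; split; lra.
  have := hd _ _ x0ab Ix lt; rewrite fx; last by rewrite /I /= in_itv.
  by rewrite sub0r normrN ltxx.
have : (mu `[u, v] <= mu N)%E by apply: le_measure => //; rewrite inE; [exact: measurable_itvR|].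
rewrite N0 lebesgue_measure_itv /= lte_fin uv -EFinB lee_fin; lra.
Qed.

Lemma primitive_indefinite (c : R) g : mu.-integrable I (EFin \o g) ->
  primitive a b (fun x => c + \int[mu]_(t in `[a, x]) g t) g.
Proof.
by move=> gi; split=> // x _; rewrite set_itv1 Rintegral_set1 addr0.
Qed.

End PrimitiveCalculus.

(** * Linear differential systems *)

Section GeometricSequence.
Context {R : realType}.

(* [v n - 2 K 2^-n] increases, [v n + 2 K 2^-n] decreases: the limit is the common bound. *)
Lemma geometric_limit (v : nat -> R) (K : R) : 0 <= K ->
  (forall n, `|v n.+1 - v n| <= K * 2^-1 ^+ n) ->
  exists l, forall n, `|l - v n| <= 2 * K * 2^-1 ^+ n.
Proof.
move=> K0 dv.
pose w n := v n - 2 * K * 2^-1 ^+ n; pose z n := v n + 2 * K * 2^-1 ^+ n.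
have stepw n : w n <= w n.+1.
  have := dv n; rewrite ler_norml /w exprS => /andP[]; set t := K * _; have -> : 2 * K * (2^-1 * 2^-1 ^+ n) = t by rewrite /t; field.
  have -> : 2 * K * 2^-1 ^+ n = 2 * t by rewrite /t; ring.
  lra.
have stepz n : z n.+1 <= z n.
  have := dv n; rewrite ler_norml /z exprS => /andP[]; set t := K * _; have -> : 2 * K * (2^-1 * 2^-1 ^+ n) = t by rewrite /t; field.
  have -> : 2 * K * 2^-1 ^+ n = 2 * t by rewrite /t; ring.
  lra.
have wmono : {homo w : m n / (m <= n)%N >-> m <= n} by apply: homo_leq => // x y t; exact: le_trans.
have zmono : {homo z : m n / (m <= n)%N >-> n <= m} by apply: homo_leq => // x y t xy /le_trans; apply.
have wz m n : w m <= z n.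
  apply: (le_trans (wmono _ _ (leq_maxl m n))).
  apply: le_trans (zmono _ _ (leq_maxr m n)).
  by rewrite /w /z lerD2l ge0_cp// mulr_ge0// ?mulr_ge0// exprn_ge0.
exists (sup (range w)) => n.
have l1 : w n <= sup (range w).
  by apply: ub_le_sup; [exists (z 0) => _ [m _ <-]|exists n].
have l2 : sup (range w) <= z n.
  by apply: ge_sup; [exists (w 0); exists 0%N|move=> _ [m _ <-]].
by rewrite ler_norml; apply/andP; split; move: l1 l2; rewrite /w /z; lra.
Qed.

Lemma geometric_eq0 (x K : R) : (forall n, `|x| <= K * 2^-1 ^+ n) -> x = 0.
Proof.
move=> H; apply/eqP; rewrite -normr_le0 leNgt; apply/negP => x0.
have K0 : 0 <= K by have := H 0; rewrite expr0 mulr1; apply: le_trans.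
pose N := (Num.truncn (K / `|x|)).+1.
have KN : K / `|x| < N%:R by exact: truncnS_gt.
have := H N; rewrite exprVn -ler_pdivrMr ?invr_gt0 ?exprn_gt0// invrK leNgt => /negP; apply.
move: KN; rewrite ltr_pdivrMr// mulrC => /lt_le_trans; apply.
rewrite ler_pM2l// -natrX ler_nat ltnW//; exact: ltn_expl.
Qed.

Lemma geometric_cvg (v : nat -> R) (l K : R) :
  (forall n, `|l - v n| <= K * 2^-1 ^+ n) -> v n @[n --> \oo] --> l.
Proof.
move=> H; apply/cvgrPdist_lt => e e0.
have g0 : K * 2^-1 ^+ n @[n --> \oo] --> K * (0 : R).
  by apply: cvgMr; apply: cvg_expr; rewrite ger0_norm ?invr_ge0// invf_lt1 ?ltr1n.
rewrite mulr0 in g0; have /cvgrPdist_lt/(_ e e0) := g0.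
apply: filterS => n; rewrite sub0r normrN => h.
by apply: le_lt_trans (H n) _; apply: le_lt_trans (ler_norm _) h.
Qed.

End GeometricSequence.

Lemma integrable_real_sum d (T : measurableType d) (R : realType)
    (mu : {measure set T -> \bar R}) (D : set T) (J : finType) (F : J -> T -> R) :
  measurable D -> (forall j, mu.-integrable D (EFin \o F j)) ->
  mu.-integrable D (EFin \o (fun x => \sum_j F j x)).
Proof.
move=> mD Fi; elim: (index_enum J) => [|j s IH].
  rewrite (_ : _ \o _ = cst 0%E); first exact: integrable0.
  by apply/funext => x /=; rewrite big_nil.
rewrite (_ : (fun x => _) = (fun x => F j x + \sum_(k <- s) F k x)); first exact: integrable_realD.
by apply/funext => x; rewrite big_cons.
Qed.

(** * Picard iteration for systems with integrable coefficients *)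

Section LinearSystem.
Context {R : realType} (a b : R).
Hypothesis ab : a < b.
Local Notation mu := (@lebesgue_measure R).
Variables (J : finType) (A : J -> J -> R -> R) (F : J -> R -> R) (c : J -> R).

Let I : set (measurableTypeR R) := `[a, b]%classic.
Let mI : measurable I. Proof. exact: measurable_itvR. Qed.

Hypothesis Ai : forall i j, mu.-integrable I (EFin \o A i j).
Hypothesis Fi : forall i, mu.-integrable I (EFin \o F i).

Let alpha (x : R) : R := \sum_i \sum_j `|A i j x|.
Let alpha_i : mu.-integrable I (EFin \o alpha).
Proof.
apply: (@integrable_real_sum _ _ _ mu) => // i; apply: (@integrable_real_sum _ _ _ mu) => // j.
exact: integrable_real_norm.
Qed.

(** The [0 +] here and the [+ 0] in [E] are the shapes delivered by [primitive_indefinite] and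
    [primitive_lin]. *)
Let P (x : R) : R := 0 + \int[mu]_(t in `[a, x]) alpha t.
Let Pprim : primitive a b P alpha. Proof. exact: primitive_indefinite. Qed.
(* The integral operator of the system is a contraction of ratio 1/2 for the sup norm
   with weight [E^-1]. *)
Let E (x : R) : R := expR (2 * P x + 0).
Let Eprim : primitive a b E (fun x => (2 * alpha x + 0) * E x).
Proof. by apply: primitive_expR => //; apply: primitive_lin => //; exact: primitive_cst. Qed.

Let alpha_ge0 x : 0 <= alpha x.
Proof. by apply: sumr_ge0 => i _; exact: sumr_ge0. Qed.

Let E_ge1 x : 1 <= E x.
Proof.
have P0 : 0 <= P x by rewrite /P add0r; apply: Rintegral_ge0.
have := expR_ge1Dx (2 * P x + 0); rewrite -/(E x); lra.
Qed.

Let alphaE_i (K : R) : mu.-integrable I (EFin \o (fun x => K * (alpha x * E x))).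
Proof.
apply: (@integrable_realZ _ _ _ mu) => //.
rewrite (_ : (fun x => _) = (fun x => E x * alpha x)); first exact: primitive_mul_integrable Eprim alpha_i.
by apply/funext => x; rewrite mulrC.
Qed.

(** Measurable and bounded on [[a, b]]: enough for the products with the integrable coefficients to
    be integrable, and stable under the limit of the iterates. *)
Let admissible (v : J -> R -> R) : Prop := forall j, measurable_fun I (v j) /\
  exists M, forall x, a <= x <= b -> `|v j x| <= M.

Let rhs (v : J -> R -> R) i (x : R) : R := \sum_j A i j x * v j x + F i x.

Let Av_i v i j : admissible v -> mu.-integrable I (EFin \o (fun x => A i j x * v j x)).
Proof.
move=> /(_ j)[mv [M vM]].
rewrite (_ : (fun x => _) = (fun x => v j x * A i j x)).
  exact: integrable_bounded_mul mv vM (Ai i j).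
by apply/funext => x; rewrite mulrC.
Qed.

Let rhs_i v i : admissible v -> mu.-integrable I (EFin \o rhs v i).
Proof.
move=> av; apply: (@integrable_realD _ _ _ mu) => //.
by apply: (@integrable_real_sum _ _ _ mu) => // j; exact: Av_i.
Qed.

Let step v i (x : R) : R := c i + \int[mu]_(t in `[a, x]) rhs v i t.

Let step_prim v i : admissible v -> primitive a b (step v i) (rhs v i).
Proof. by move=> av; exact: (primitive_indefinite (c i) (rhs_i i av)). Qed.

Let step_admissible v : admissible v -> admissible (step v).
Proof.
move=> av j; have sp := step_prim j av; split; first exact: primitive_measurable sp.
by have [M _ H] := primitive_bounded sp; exists M.
Qed.

(** The weight solves [E' = 2 alpha E], so integrating [K alpha E] from [a] to [x] gives
    [K / 2 * (E x - E a)], which is at most [K / 2 * E x]. *)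
Let step_lip v w K : admissible v -> admissible w ->
  (forall j x, a <= x <= b -> `|v j x - w j x| <= K * E x) ->
  forall j x, a <= x <= b -> `|step v j x - step w j x| <= K / 2 * E x.
Proof.
move=> av aw vw j x /andP[ax xb].
have sub : `[a, x] `<=` I by apply: subset_itvl; rewrite bnd_simp.
have ix g : mu.-integrable I (EFin \o g) -> mu.-integrable `[a, x] (EFin \o g).
  exact: integrable_sub.
rewrite /step opprD addrACA subrr add0r -RintegralB; last 3 first.
- exact: measurable_itvR.
- exact/ix/rhs_i.
- exact/ix/rhs_i.
have di : mu.-integrable I (EFin \o (fun t => rhs v j t - rhs w j t)).
  by apply: (@integrable_realB _ _ _ mu) => //; exact: rhs_i.
apply: (le_trans (le_normr_Rintegral (measurable_itvR _) (ix _ di))).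
have K0 : 0 <= K.
  have := vw j a; rewrite lexx (ltW ab) => /(_ isT) /(le_trans (normr_ge0 _)).
  by rewrite pmulr_lge0// (lt_le_trans ltr01).
apply: (@le_trans _ _ (\int[mu]_(t in `[a, x]) (K / 2 * ((2 * alpha t + 0) * E t)))).
  apply: le_Rintegral.
  - exact: measurable_itvR.
  - by apply: ix; exact: integrable_real_norm.
  - apply: ix; rewrite (_ : (fun t => _) = (fun t => K * (alpha t * E t))).
      exact: alphaE_i.
    by apply/funext => t; field.
  move=> t tx; have tab : a <= t <= b by have := sub _ tx; rewrite /I /= in_itv.
  have -> : rhs v j t - rhs w j t = \sum_k A j k t * (v k t - w k t).
    rewrite /rhs opprD addrACA subrr addr0 -sumrB.
    by apply: eq_bigr => k _; rewrite mulrBr.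
  apply: (le_trans (ler_norm_sum _ _ _)).
  apply: (@le_trans _ _ (\sum_k `|A j k t| * (K * E t))).
    by apply: ler_sum => k _; rewrite normrM; apply: ler_wpM2l => //; exact: vw.
  rewrite -mulr_suml.
  have -> : K / 2 * ((2 * alpha t + 0) * E t) = alpha t * (K * E t) by field.
  apply: ler_wpM2r; first by rewrite mulr_ge0// (le_trans ler01).
  rewrite /alpha [leRHS](bigD1 j)//= lerDl; apply: sumr_ge0 => i _; exact: sumr_ge0.
have Ei := Eprim.1.
rewrite (@RintegralZl _ _ _ mu)//; last exact: ix.
have xab : a <= x <= b by rewrite ax.
have := Eprim.2 x xab; set S := \int[mu]_(t in _) _ => ES.
have {ES} -> : S = E x - E a by rewrite ES addrC addKr.
have := E_ge1 a; set K2 := K / 2; have : 0 <= K2 by rewrite divr_ge0.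
by move=> k0 e1; apply: (ler_wpM2l k0); rewrite gerBl (le_trans ler01).
Qed.

Let u (n : nat) : J -> R -> R := iter n step (fun j => cst (c j)).

Let u_admissible n : admissible (u n).
Proof.
elim: n => [j|n IH]; last exact: step_admissible.
by split; [exact: measurable_cst|exists `|c j|].
Qed.

Lemma linear_system_solution : exists v : J -> R -> R, forall i,
  v i a = c i /\ primitive a b (v i) (fun x => \sum_j A i j x * v j x + F i x).
Proof.
have [C C0 uC] : exists2 C, 0 <= C & forall j x, a <= x <= b -> `|u 1 j x - u 0 j x| <= C.
  have /choice[M hM] j : exists M, 0 <= M /\ forall x, a <= x <= b -> `|u 1 j x - u 0 j x| <= M.
    have [_ [M1 h1]] := u_admissible 1 j; have [_ [M0 h0]] := u_admissible 0 j.
    exists (M1 + M0); split.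
      apply: (@le_trans _ _ (`|u 1 j a| + `|u 0 j a|)); first by rewrite addr_ge0.
      by apply: lerD; [apply: h1|apply: h0]; rewrite lexx ltW.
    move=> x xab; apply: (le_trans (ler_normB _ _)).
    by apply: lerD; [exact: h1|exact: h0].
  exists (\sum_j M j); first by apply: sumr_ge0 => j _; have [] := hM j.
  move=> j x xab; have [_ /(_ _ xab) h] := hM j; apply: (le_trans h).
  by rewrite (bigD1 j)//= lerDl; apply: sumr_ge0 => k _; have [] := hM k.
have du n : forall j x, a <= x <= b -> `|u n.+1 j x - u n j x| <= C * 2^-1 ^+ n * E x.
  elim: n => [|n IH] j x xab.
    rewrite expr0 mulr1; apply: (le_trans (uC _ _ xab)).
    by rewrite ler_peMr.
  rewrite exprSr mulrA; exact: (step_lip (u_admissible n.+1) (u_admissible n) IH).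
have /choice[v hv] j : exists v : R -> R, forall x, a <= x <= b ->
    forall n, `|v x - u n j x| <= 2 * (C * E x) * 2^-1 ^+ n.
  have /choice[v hv] x : exists l, a <= x <= b ->
      forall n, `|l - u n j x| <= 2 * (C * E x) * 2^-1 ^+ n.
    have [xab|nxab] := boolP (a <= x <= b); last by exists 0.
    have [||l hl] := @geometric_limit R (fun n => u n j x) (C * E x).
    - by rewrite mulr_ge0// (le_trans ler01 (E_ge1 x)).
    - by move=> n; have := du n j x xab; rewrite mulrAC.
    by exists l.
  by exists v => x; exact: hv.
have vu n j x : a <= x <= b -> `|v j x - u n j x| <= 2 * C * 2^-1 ^+ n * E x.
  by move=> xab; apply: (le_trans (hv j x xab n)); rewrite le_eqVlt; apply/orP; left; apply/eqP; ring.
(* The limit is measurable as a pointwise limit, and bounded because both [u 0] and the weight [E]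
   are. *)
have av : admissible v.
  move=> j; split; last first.
    have [_ [M hM]] := u_admissible 0 j; have [N _ hN] := primitive_bounded Eprim.
    exists (M + 2 * C * N) => x xab.
    have := vu 0 j x xab; rewrite expr0 mulr1 => h.
    have -> : v j x = u 0 j x + (v j x - u 0 j x) by rewrite addrC subrK.
    apply: (le_trans (ler_normD _ _)); apply: lerD; first exact: hM.
    apply: (le_trans h); apply: ler_wpM2l; first by rewrite mulr_ge0.
    by apply: (le_trans (ler_norm _)); exact: hN.
  apply: (@measurable_fun_cvg _ _ _ _ (fun n => u n j)).
    by move=> n; have [] := u_admissible n j.
  move=> x; rewrite /I /= in_itv /= => xab.
  exact: geometric_cvg (hv j x xab).
exists v => i.
(* Both [v] and [step v] are within a multiple of [2^-n] of the iterate [u n.+1], so [v] is a fixed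
   point. *)
have sv x : a <= x <= b -> v i x = step v i x.
  move=> xab; apply/eqP; rewrite -subr_eq0; apply/eqP.
  apply: (@geometric_eq0 R _ (2 * C * E x)) => n.
  have h1 := vu n.+1 i x xab.
  have h2 : `|u n.+1 i x - step v i x| <= 2 * C * 2^-1 ^+ n / 2 * E x.
    by apply: (step_lip (u_admissible n) av) xab => j y yab; rewrite distrC; exact: vu.
  have -> : v i x - step v i x = (v i x - u n.+1 i x) + (u n.+1 i x - step v i x) by ring.
  apply: (le_trans (ler_normD _ _)); apply: (le_trans (lerD h1 h2)).
  by rewrite le_eqVlt; apply/orP; left; apply/eqP; rewrite exprS; field.
split.
  rewrite sv ?lexx ?ltW// /step set_itv1 Rintegral_set1 addr0 //.
apply: (@primitive_eq _ a b ab (step v i)); first exact: step_prim.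
by move=> x /sv.
Qed.

End LinearSystem.

Local Open Scope complex_scope.

(** * Boundary triples *)

Section Dot.
Context {R : realType} {m : nat}.
Implicit Types u v w : 'cV[R[i]]_m.

Definition dot u v : R[i] := \sum_j u j 0 * (v j 0)^*.

Lemma dotDl c u v w : dot (c *: u + v) w = c * dot u w + dot v w.
Proof.
rewrite /dot mulr_sumr -big_split; apply: eq_bigr => j _.
by rewrite !mxE mulrDl mulrA.
Qed.

Lemma dotC u v : dot v u = (dot u v)^*.
Proof.
rewrite /dot rmorph_sum; apply: eq_bigr => j _ /=.
by rewrite rmorphM /= conjcK mulrC.
Qed.

Lemma dotDr c u v w : dot w (c *: u + v) = c^* * dot w u + dot w v.
Proof. by rewrite dotC dotDl rmorphD rmorphM /= -!dotC. Qed.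

Lemma dot0l v : dot 0 v = 0.
Proof. by rewrite /dot big1// => j _; rewrite mxE mul0r. Qed.

Lemma dot0r v : dot v 0 = 0.
Proof. by rewrite dotC dot0l conjc0. Qed.

Lemma dotE u : dot u u = \sum_j `|u j 0| ^+ 2.
Proof. by apply: eq_bigr => j _; rewrite sqr_normc. Qed.

Lemma dot_ge0 u : 0 <= dot u u.
Proof. by rewrite dotE sumr_ge0// => j _; rewrite exprn_ge0. Qed.

Lemma dot_eq0 u : dot u u = 0 -> u = 0.
Proof.
rewrite dotE => /eqP; rewrite psumr_eq0 => [/allP h|j _]; last exact: exprn_ge0.
apply/colP => j; rewrite mxE; apply/eqP.
by have := h j (mem_index_enum j); rewrite /= expf_eq0 /= normr_eq0.
Qed.

Lemma dot_inj u v : (forall w, dot w u = dot w v) -> u = v.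
Proof.
move=> h; apply/subr0_eq/dot_eq0.
by rewrite -[u - v]addrC -scaleN1r dotDr h rmorphN1 mulN1r addNr.
Qed.

Lemma dot_mulmx (M : 'M[R[i]]_m) u v :
  dot u (M *m v) = dot (M^t* *m u)%sesqui v.
Proof.
rewrite /dot; under eq_bigr => j _ do rewrite !mxE rmorph_sum mulr_sumr.
rewrite exchange_big /=; apply: eq_bigr => k _; rewrite !mxE mulr_suml.
apply: eq_bigr => j _; rewrite !mxE /= -[RHS]mulrA [RHS]mulrCA.
by rewrite -rmorphM.
Qed.

End Dot.

Lemma contraction_mxP {R : realType} {m : nat} (K : 'M[R[i]]_m) :
  contraction_mx K <-> forall v, dot (K *m v) (K *m v) <= dot v v.
Proof. by split=> h v; have := h v; rewrite !dotE. Qed.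

Lemma unitarymx_isometryP {R : realType} {m : nat} (K : 'M[R[i]]_m) :
  K \is unitarymx <-> forall u v, dot (K *m u) (K *m v) = dot u v.
Proof.
split=> [Ku u v|h].
  move/unitarymxP: Ku => /mulmx1C KK.
  by rewrite dot_mulmx mulmxA KK mul1mx.
apply/unitarymxP/mulmx1C.
apply/matrixP => i j.
pose e (k : 'I_m) : 'cV[R[i]]_m := delta_mx k 0.
have dote (M : 'M[R[i]]_m) k l : dot (M *m e l) (e k) = M k l.
  rewrite /dot (bigD1 k)//= big1 => [|s sk].
    by rewrite addr0 -colE !mxE !eqxx rmorph1 mulr1.
  by rewrite !mxE (negbTE sk) rmorph0 mulr0.
by rewrite -dote -mulmxA -dot_mulmx h -[e j in LHS]mul1mx dote.
Qed.

(** * Orthogonal vectors to proper subspaces in finite dimension *)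

Section Orthogonal.
Context {R : realType} {m : nat}.

(** [W] is only a predicate, so it is first encoded by a matrix [B] with rows in [W] and row space
    all of [W]. The vector [u] lies outside that row space, so some column of [cokermx B] is not
    killed by it; that column, conjugated, is the vector sought. *)
Lemma proper_subspace_orthogonal (W : set 'cV[R[i]]_m) :
    (forall c u v, W u -> W v -> W (c *: u + v)) -> W 0 ->
    (exists u, ~ W u) ->
  exists2 v, v != 0 & forall w, W w -> dot w v = 0.
Proof.
move=> Wlin W0 [u nWu].
have Wcomb (D : 'rV[R[i]]_m) (B : 'M[R[i]]_m) :
    (forall i, W (row i B)^T) -> W (D *m B)^T.
  move=> WB; rewrite mulmx_sum_row raddf_sum /=.
  apply: (big_ind W) => // [s t Ws Wt|i _].
    by rewrite -[s]scale1r; exact: Wlin.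
  by rewrite linearZ /= -[_ *: _]addr0; exact: Wlin.
have maxB : exists B : 'M[R[i]]_m, (forall i, W (row i B)^T) /\
    forall w, W w -> (w^T <= B)%MS.
  (* Induction on the rank still missing: a vector of [W] outside the row space of [B] is adjoined
     and raises the rank. *)
  suff H k : forall B : 'M[R[i]]_m, (m - \rank B <= k)%N -> (forall i, W (row i B)^T) ->
      exists B' : 'M[R[i]]_m, (forall i, W (row i B')^T) /\
        forall w, W w -> (w^T <= B')%MS.
    by apply: (H m 0) => [|i]; rewrite ?leq_subr// row0 trmx0.
  elim: k => [|k IH] B kB WB.
    exists B; split=> // w _; apply: submx_full; rewrite /row_full eqn_leq.
    by rewrite rank_leq_col -subn_eq0 -leqn0.
  have [Ball|/existsNP[w /not_implyP[Ww /negP wB]]] :=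
    pselect (forall w, W w -> (w^T <= B)%MS); first by exists B.
  have WS (v : 'rV[R[i]]_m) : (v <= B + w^T)%MS -> W v^T.
    move=> /sub_addsmxP[[x y] ->] /=; rewrite raddfD /= addrC [y]mx11_scalar mul_scalar_mx.
    rewrite linearZ /= trmxK; apply: Wlin => //.
    exact: Wcomb.
  apply: (IH (B + w^T)%MS) => [|i]; last by apply: WS; exact: row_sub.
  have ltr : (\rank B < \rank (B + w^T))%N.
    apply: rank_ltmx; rewrite /ltmx addsmxSl /=.
    by apply: contra wB => /(submx_trans (addsmxSr _ _)).
  by move: kB ltr (rank_leq_col (B + w^T)%MS); clear; lia.
have [B [WB Bmax]] := maxB.
have nuB : ~~ (u^T <= B)%MS.
  apply/negP => /submxP[D uE]; apply: nWu.
  by rewrite -[u]trmxK uE; exact: Wcomb.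
have [z Bz z0] : exists2 z : 'cV[R[i]]_m, B *m z = 0 & z != 0.
  move: nuB; rewrite submxE => /matrix0Pn[i0 [j nz]].
  exists (col j (cokermx B)); first by rewrite colE mulmxA mulmx_coker mul0mx.
  apply/negP => /eqP z0; move: nz.
  move/(congr1 (mulmx u^T)): z0; rewrite mulmx0 colE mulmxA -colE => /matrixP/(_ 0 0).
  by rewrite !mxE [i0]ord1 => ->; rewrite eqxx.
(* Conjugated because [dot] is antilinear in its second argument, while [B *m z = 0] is bilinear. *)
exists (map_mx conjc z).
  apply: contra_neq z0 => /matrixP h; apply/matrixP => i j; have := h i j.
  by rewrite !mxE => /(congr1 conjc); rewrite conjcK conjc0.
move=> w /Bmax /submxP[D wE].
have -> : dot w (map_mx conjc z) = (w^T *m z) 0 0.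
  by rewrite mxE /dot; apply: eq_bigr => j _; rewrite !mxE; congr (_ * _); exact: conjcK.
by rewrite wE -mulmxA Bz mulmx0 mxE.
Qed.

End Orthogonal.

(** * Abstract boundary triples and their dissipative extensions *)

Section BoundaryTriple.
Context {R : realType} {H : lmodType R[i]} (ip : H -> H -> R[i]) {m : nat}.
Hypothesis ipDl : forall c f g h, ip (c *: f + g) h = c * ip f h + ip g h.
Hypothesis ipC : forall f g, ip g f = (ip f g)^*.

Let ipDr c f g h : ip h (c *: f + g) = c^* * ip h f + ip h g.
Proof. by rewrite ipC ipDl rmorphD rmorphM /= -!ipC. Qed.

Let ip0l f : ip 0 f = 0.
Proof. by have := ipDl (-1) 0 0 f; rewrite scaler0 addr0 mulN1r addNr. Qed.

Let ip0r f : ip f 0 = 0.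
Proof. by rewrite ipC ip0l conjc0. Qed.

(* [s = 1] is dissipativity and [s = -1] accumulativity. *)
Definition sdissipative (s : R) (T : set (H * H)) : Prop :=
  [/\ linear_operator T, densely_defined ip T &
      forall f g, T (f, g) -> 0 <= s * complex.Im (ip g f)].

(* Positivity at [c *: f + h] is affine in [c], since [ip g f] is real; letting [c]
   run along a suitable half-line kills the linear coefficient. *)
Lemma sdissipative_adjoint (s : R) (S T : set (H * H)) : s ^+ 2 = 1 ->
  T `<=` adjoint ip T -> sdissipative s S -> T `<=` S -> S `<=` adjoint ip T.
Proof.
move=> s1 Tsym [[_ Slin _] _ Spos] TS [h k] Shk f g Tfg /=.
have fgR : (ip g f)^* = ip g f by rewrite -ipC -(Tsym _ Tfg f g Tfg).
set w := ip g h - ip f k; suff w0 : w = 0 by apply/eqP; rewrite -subr_eq0 -/w w0.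
set C := s * complex.Im (ip k h).
have expand (c : R[i]) : ip (c *: g + k) (c *: f + h) =
    c * c^* * ip g f + (c * ip g h + c^* * ip k f) + ip k h.
  by rewrite ipDl !ipDr; ring.
have pos (t : R) : 0 <= t -> 0 <= - (t * (complex.Re w ^+ 2 + complex.Im w ^+ 2)) + C.
  (* For this [c] the imaginary part of the two cross terms, multiplied by [s], is exactly
     [- t |w|^2] because [s ^+ 2 = 1]; the quadratic term is real and disappears. *)
  move=> t0; pose c : R[i] := (- s * t)%:C * 'i * w^*.
  have := Spos _ _ (Slin c _ _ (TS _ Tfg) Shk) => /=.
  rewrite expand [ip k f]ipC.
  rewrite /C -[X in _ -> 0 <= - (t * X) + _]mul1r -s1 /c.
  move: fgR; rewrite /w.
  case: (ip g f) => [a1 b1] [/eqP]; rewrite eq_sym -subr_eq0 opprK -mulr2n mulrn_eq0 /= => /eqP ->.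
  case: (ip g h) => [a2 b2]; case: (ip f k) => [a3 b3]; case: (ip k h) => [a4 b4] /=.
  set X := (X in 0 <= X -> _); set Y := (Y in _ -> 0 <= Y).
  suff -> : X = Y by [].
  by rewrite /X /Y; ring.
have w2 : complex.Re w ^+ 2 + complex.Im w ^+ 2 = 0.
  set N := _ + _ in pos *; have N0 : 0 <= N by rewrite addr_ge0// sqr_ge0.
  have C0 : 0 <= C by have := pos 0 (lexx _); rewrite mul0r oppr0 add0r.
  apply/eqP; rewrite eq_le N0 andbT leNgt; apply/negP => Ngt0.
  have : 0 <= - ((C + 1) / N * N) + C by apply: pos; apply: divr_ge0 => //; exact: addr_ge0.
  by rewrite divfK ?gt_eqF//; lra.
move: w2; case: (w) => x y /= /eqP; rewrite paddr_eq0 ?sqr_ge0//.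
by rewrite !sqrf_eq0 => /andP[/eqP -> /eqP ->].
Qed.

Variables (Lmax : set (H * H)) (P M : H * H -> 'cV[R[i]]_m) (s : R).
Hypothesis s1 : s ^+ 2 = 1.
Hypothesis Lmax_linear : linear_operator Lmax.
Hypothesis Plin : forall c p q, Lmax p -> Lmax q -> P (c *: p + q) = c *: P p + P q.
Hypothesis Mlin : forall c p q, Lmax p -> Lmax q -> M (c *: p + q) = c *: M p + M q.
Hypothesis green : forall p q, Lmax p -> Lmax q ->
  dot (P p) (P q) - dot (M p) (M q) =
    - (2 * s)%:C * 'i * (ip p.2 q.1 - ip p.1 q.2).
Hypothesis PM_surj : forall u v, exists p, [/\ Lmax p, P p = u & M p = v].

Definition Lker : set (H * H) := [set p | [/\ Lmax p, P p = 0 & M p = 0]].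
Hypothesis Lker_dense : densely_defined ip Lker.
Hypothesis adjoint_Lker : adjoint ip Lker `<=` Lmax.

Definition Lext (K : 'M[R[i]]_m) : set (H * H) :=
  [set p | Lmax p /\ K *m P p = M p].

Let Lmax0 : Lmax 0. Proof. by have [] := Lmax_linear. Qed.

Let LmaxB p q : Lmax p -> Lmax q -> Lmax (p - q).
Proof.
have [_ lin _] := Lmax_linear => Lp Lq.
by rewrite -scaleN1r addrC; exact: lin.
Qed.

Let PB p q : Lmax p -> Lmax q -> P (p - q) = P p - P q.
Proof. by move=> Lp Lq; rewrite -scaleN1r addrC Plin// scaleN1r addrC. Qed.

Let MB p q : Lmax p -> Lmax q -> M (p - q) = M p - M q.
Proof. by move=> Lp Lq; rewrite -scaleN1r addrC Mlin// scaleN1r addrC. Qed.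

Let P0 : P 0 = 0. Proof. by have := PB Lmax0 Lmax0; rewrite !subrr. Qed.
Let M0 : M 0 = 0. Proof. by have := MB Lmax0 Lmax0; rewrite !subrr. Qed.

Let coef_neq0 : - (2 * s)%:C * 'i != 0 :> R[i].
Proof.
have s0 : s != 0 by apply: contra_eq_neq s1 => ->; rewrite expr0n /= eq_sym oner_neq0.
apply: mulf_neq0; last by rewrite eq_complex /= oner_eq0 andbF.
by rewrite oppr_eq0 eq_complex /= eqxx andbT mulf_eq0 pnatr_eq0.
Qed.

Let sub_adjointE p q : Lmax p -> Lmax q ->
  ip q.2 p.1 = ip q.1 p.2 <-> dot (P q) (P p) = dot (M q) (M p).
Proof.
move=> Lp Lq; split=> [e|/eqP].
  by apply/eqP; rewrite -subr_eq0 green// e subrr mulr0.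
by rewrite -subr_eq0 green// mulf_eq0 (negbTE coef_neq0) /= subr_eq0 => /eqP.
Qed.

Let pos_dot p : Lmax p ->
  (0 <= s * complex.Im (ip p.2 p.1)) = (dot (M p) (M p) <= dot (P p) (P p)).
Proof.
move=> Lp; rewrite -[RHS]subr_ge0 green// [ip p.1 p.2]ipC.
case: (ip p.2 p.1) => x y /=.
rewrite [X in _ = (0 <= X)](_ : _ = (4 * (s * y))%:C); last first.
  by apply/eqP; rewrite eq_complex /=; apply/andP; split; apply/eqP; ring.
by rewrite lecE /= eqxx /= [RHS]pmulr_rge0 // ltr0n.
Qed.

Let linear_sub S : S `<=` Lmax -> S 0 ->
  (forall c p q, S p -> S q -> S (c *: p + q)) -> linear_operator S.
Proof.
have [_ _ uniq] := Lmax_linear => sub S0 lin; split=> // f g h Sg Sh.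
by apply: (uniq f); exact: sub.
Qed.

Let dense_sup S T : densely_defined ip S -> S `<=` T -> densely_defined ip T.
Proof.
move=> dS ST f e e0; have [g [k Sk] fg] := dS f e e0.
by exists g => //; exists k; exact: ST.
Qed.

Let Lker_sym : Lker `<=` adjoint ip Lker.
Proof.
move=> p [Lp Pp Mp] f g [Lfg Pfg Mfg].
by apply/(sub_adjointE Lp Lfg); rewrite Pp Mp !dot0r.
Qed.

(** [Lker] is symmetric, so a dissipative extension of it stays inside its adjoint. This is what
    places an arbitrary extension within reach of the boundary maps. *)
Lemma sdissipative_sub_Lmax S : sdissipative s S -> Lker `<=` S -> S `<=` Lmax.
Proof.
move=> dS LS; apply: subset_trans adjoint_Lker.
exact: sdissipative_adjoint dS LS.
Qed.

Lemma Lker_sub_Lext K : Lker `<=` Lext K.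
Proof. by move=> p [Lp Pp Mp]; split; rewrite // Pp Mp mulmx0. Qed.

Let Lext_linear K : linear_operator (Lext K).
Proof.
apply: linear_sub => [p []//||c p q [Lp Kp] [Lq Kq]].
  by split; rewrite // P0 M0 mulmx0.
split; first by have [_ lin _] := Lmax_linear; exact: lin.
by rewrite Plin// Mlin// mulmxDr -scalemxAr Kp Kq.
Qed.

Let Lext_onto K u : exists2 p, Lext K p & P p = u.
Proof. by have [p [Lp <- Mp]] := PM_surj u (K *m u); exists p. Qed.

Lemma Lext_inj : injective Lext.
Proof.
move=> K K' KK'; apply/matrixP => i j.
have [p Kp Pp] := Lext_onto K (delta_mx j 0).
have [_ K'p] : Lext K' p by rewrite -KK'.
by move: Kp => [_]; rewrite -K'p Pp -!colE => /matrixP/(_ i 0); rewrite !mxE.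
Qed.

Lemma Lext_sdissipative K : contraction_mx K -> sdissipative s (Lext K).
Proof.
move=> /contraction_mxP cK; split=> //; first exact: dense_sup (@Lker_sub_Lext K).
by move=> f g [Lp Kp]; rewrite (pos_dot Lp) -Kp.
Qed.

(** [P] is already onto on [Lext K], so any [p] in [S] differs from some [q] in [Lext K] by an
    element with [P = 0]; positivity in [S] then forces [M = 0] on the difference. *)
Lemma Lext_maximal K S : sdissipative s S -> Lext K `<=` S -> S = Lext K.
Proof.
move=> dS KS; apply/seteqP; split=> // p Sp.
have SL : S `<=` Lmax.
  by apply: (sdissipative_sub_Lmax dS); exact: subset_trans (@Lker_sub_Lext K) KS.
have [q Kq Pq] := Lext_onto K (P p).
have Lq : Lmax q by case: Kq.
have Lp := SL _ Sp.
have [[_ Slin _] _ Spos] := dS.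
have Sd : S (p - q) by rewrite -scaleN1r addrC; apply: Slin => //; exact: KS.
split=> //; rewrite -Pq; case: Kq => _ ->.
have := Spos (p - q).1 (p - q).2; rewrite -surjective_pairing => /(_ Sd).
rewrite (pos_dot (LmaxB Lp Lq)) PB// Pq subrr dot0l MB// => le0.
have /dot_eq0/eqP : dot (M p - M q) (M p - M q) = 0.
  by apply/eqP; rewrite eq_le le0 dot_ge0.
by rewrite subr_eq0 => /eqP.
Qed.

Lemma maximal_Lext S : sdissipative s S ->
    (forall T, sdissipative s T -> S `<=` T -> T = S) -> Lker `<=` S ->
  exists2 K, contraction_mx K & S = Lext K.
Proof.
move=> dS maxS LS; have SL := sdissipative_sub_Lmax dS LS.
have [Slin Sdense Spos] := dS; have [S0 SlinD _] := Slin.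
have pos p : S p -> dot (M p) (M p) <= dot (P p) (P p).
  by move=> Sp; rewrite -(pos_dot (SL _ Sp)); apply: Spos; rewrite -surjective_pairing.
have Ponto u : exists2 p, S p & P p = u.
  apply: contrapT => nu.
  have [|||v v0 vorth] := @proper_subspace_orthogonal R m [set w | exists2 p, S p & P p = w].
  - move=> c _ _ [p Sp <-] [q Sq <-]; exists (c *: p + q); first exact: SlinD.
    by rewrite Plin//; exact: SL.
  - by exists 0.
  - by exists u.
  (* If the range of [P] on [S] missed a vector, [S] could be enlarged by [q]: since [v] is
     orthogonal to that range, adding [c *: q] increases the norm of [P] by Pythagoras and leaves
     [M] unchanged. Maximality puts [q] in [S], so [v] is orthogonal to itself. *)
  have [q [Lq Pq Mq]] := PM_surj v 0.
  pose T := [set x | exists c p, S p /\ x = c *: q + p].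
  have ST : S `<=` T by move=> p Sp; exists 0, p; rewrite scale0r add0r.
  have [_ LlinD _] := Lmax_linear.
  have TL : T `<=` Lmax by move=> _ [c [p [Sp ->]]]; apply: LlinD => //; exact: SL.
  have dT : sdissipative s T.
    split.
    - apply: linear_sub => //; first exact: ST.
      move=> c _ _ [d [p [Sp ->]]] [e [r [Sr ->]]].
      exists (c * d + e), (c *: p + r); split; first exact: SlinD.
      by rewrite scalerDr scalerA scalerDl addrACA.
    - exact: dense_sup ST.
    - move=> f g Tfg; rewrite (pos_dot (TL _ Tfg)).
      case: Tfg => c [p [Sp ->]].
      rewrite Plin ?Mlin//; try exact: SL.
      rewrite Pq Mq scaler0 add0r dotDl !dotDr (vorth (P p)); last by exists p.
      rewrite [dot v (P p)]dotC (vorth (P p)); last by exists p.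
      rewrite conjc0 !mulr0 addr0 add0r mulrA (le_trans (pos _ Sp))// lerDr.
      by rewrite mulr_ge0 ?dot_ge0// -sqr_normc exprn_ge0.
  have Sq : S q.
    by rewrite -(maxS _ dT ST); exists 1, 0; rewrite scale1r addr0.
  have := vorth (P q); rewrite Pq => /(_ (ex_intro2 _ _ _ Sq Pq))/dot_eq0.
  by move/eqP; apply/negP.
have [e eS eP] : exists2 e : 'I_m -> H * H, (forall j, S (e j)) &
    forall j, P (e j) = delta_mx j 0.
  have /choice[e he] (j : 'I_m) : exists p, S p /\ P p = delta_mx j 0.
    by have [p] := Ponto (delta_mx j 0); exists p.
  by exists e => j; case: (he j).
pose K : 'M[R[i]]_m := \matrix_(i, j) M (e j) i 0.
(* [q] is the combination of the lifted basis vectors with the same [P] as [p]; the difference has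
   [P = 0], so positivity gives [M p = M q]. *)
have KE p : S p -> M p = K *m P p.
  move=> Sp.
  pose q := \sum_j P p j 0 *: e j.
  have [Sq Pq Mq] : [/\ S q, P q = \sum_j P p j 0 *: P (e j) & M q = \sum_j P p j 0 *: M (e j)].
    rewrite /q; elim: (index_enum _) => [|j r [Sr Pr Mr]].
      by rewrite !big_nil.
    rewrite !big_cons Plin ?Mlin; try exact: SL.
    by rewrite Pr Mr; split=> //; exact: SlinD.
  have Pqp : P q = P p.
    rewrite Pq; apply/colP => i; rewrite summxE (bigD1 i)//= big1 ?addr0.
      by rewrite !mxE eP mxE !eqxx mulr1.
    by move=> j ji; rewrite !mxE eP mxE eq_sym (negbTE ji) mulr0.
  have Lp := SL _ Sp; have Lq := SL _ Sq.
  have Sd : S (p - q) by rewrite -scaleN1r addrC; exact: SlinD.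
  have := pos _ Sd; rewrite PB// Pqp subrr dot0l MB// => le0.
  have /dot_eq0/eqP : dot (M p - M q) (M p - M q) = 0.
    by apply/eqP; rewrite eq_le le0 dot_ge0.
  rewrite subr_eq0 => /eqP ->; rewrite Mq; apply/colP => i.
  by rewrite summxE mxE; apply: eq_bigr => j _; rewrite !mxE mulrC.
have cK : contraction_mx K.
  by apply/contraction_mxP => v; have [p Sp <-] := Ponto v; rewrite -KE// pos.
exists K => //; apply/esym/maxS; first exact: Lext_sdissipative.
by move=> p Sp; split; [exact: SL|rewrite KE].
Qed.

(** A dissipative extension of [S] lies in the adjoint of [S], which is [S] itself. Self-adjoint
    extensions are thus maximal for either sign [s], and [maximal_Lext] covers them. *)
Lemma self_adjoint_sdissipative S : self_adjoint ip S ->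
  sdissipative s S /\ forall T, sdissipative s T -> S `<=` T -> T = S.
Proof.
move=> [Slin Sdense SS]; split.
  split=> // f g Sfg.
  have := Sfg; rewrite -SS => /(_ _ _ Sfg) /=; rewrite [ip f g]ipC.
  case: (ip g f) => x y [/eqP]; rewrite -subr_eq0 opprK -mulr2n mulrn_eq0 /=.
  by move=> /eqP ->; rewrite mulr0.
move=> T dT ST; apply/seteqP; split=> //.
by rewrite -[X in _ `<=` X]SS; apply: sdissipative_adjoint dT ST => //; rewrite SS.
Qed.

(** By Green's identity, the adjoint relation between two elements of [Lmax] says that [P] and [M]
    have the same inner products on them. On [Lext K], where [P] is onto and [M = K P], this is the
    isometry of [K]. *)
Lemma Lext_self_adjoint K : self_adjoint ip (Lext K) <-> K \is unitarymx.
Proof.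
rewrite unitarymx_isometryP; split=> [[_ _ KK] u v|iso].
  have [p Kp Pp] := Lext_onto K u; have [q Kq Pq] := Lext_onto K v.
  have := Kq; rewrite -KK => /(_ p.1 p.2); rewrite -surjective_pairing => /(_ Kp).
  case: Kp Kq => Lp Kp [Lq Kq] /(sub_adjointE Lq Lp).
  by rewrite -Kp -Kq Pp Pq.
split=> //; first exact: dense_sup (@Lker_sub_Lext K).
apply/seteqP; split=> p.
  move=> ap; have Lp : Lmax p.
    by apply: adjoint_Lker => f g /(@Lker_sub_Lext K); exact: ap.
  split=> //; apply: dot_inj => w.
  (* An isometry of a finite-dimensional space is invertible, so testing against all [K *m u]
     determines [M p]. *)
  have [u <-] : exists u, K *m u = w.
    have Ku : K \in unitmx by apply/unitarymx_unit/unitarymx_isometryP.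
    by exists (invmx K *m w); rewrite mulKVmx.
  rewrite iso; have [q Kq <-] := Lext_onto K u.
  have := ap q.1 q.2; rewrite -surjective_pairing => /(_ Kq).
  by case: Kq => Lq Kq /(sub_adjointE Lp Lq); rewrite Kq.
move=> [Lp Kp] f g [Lfg Kfg]; apply/(sub_adjointE Lp Lfg).
by rewrite -Kp -Kfg iso.
Qed.

End BoundaryTriple.

(** * Complex-valued primitives *)

Section ComplexParts.
Context {R : realType}.
Implicit Types z w : R[i].

Lemma complex_ReD z w : complex.Re (z + w) = complex.Re z + complex.Re w.
Proof. by case: z; case: w. Qed.
Lemma complex_ImD z w : complex.Im (z + w) = complex.Im z + complex.Im w.
Proof. by case: z; case: w. Qed.
Lemma complex_ReB z w : complex.Re (z - w) = complex.Re z - complex.Re w.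
Proof. by case: z; case: w. Qed.
Lemma complex_ImB z w : complex.Im (z - w) = complex.Im z - complex.Im w.
Proof. by case: z; case: w. Qed.
Lemma complex_ReM z w :
  complex.Re (z * w) = complex.Re z * complex.Re w - complex.Im z * complex.Im w.
Proof. by case: z; case: w. Qed.
Lemma complex_ImM z w :
  complex.Im (z * w) = complex.Re z * complex.Im w + complex.Im z * complex.Re w.
Proof. by case: z; case: w. Qed.

Lemma complex_eq z w : complex.Re z = complex.Re w -> complex.Im z = complex.Im w -> z = w.
Proof. by case: z => x y; case: w => u v /= -> ->. Qed.

Lemma complex_Re_sum (J : finType) (F : J -> R[i]) :
  complex.Re (\sum_j F j) = \sum_j complex.Re (F j).
Proof. by elim/big_rec2: _ => // j x y _ <-; exact: complex_ReD. Qed.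
Lemma complex_Im_sum (J : finType) (F : J -> R[i]) :
  complex.Im (\sum_j F j) = \sum_j complex.Im (F j).
Proof. by elim/big_rec2: _ => // j x y _ <-; exact: complex_ImD. Qed.

Lemma normc_Re z : `|complex.Re z| <= Normc.normc z.
Proof.
case: z => x y /=; rewrite -[leLHS]sqrtr_sqr ler_wsqrtr//.
by rewrite lerDl sqr_ge0.
Qed.

Lemma normc_Im z : `|complex.Im z| <= Normc.normc z.
Proof.
case: z => x y /=; rewrite -[leLHS]sqrtr_sqr ler_wsqrtr//.
by rewrite lerDr sqr_ge0.
Qed.

Lemma normc_le z : Normc.normc z <= `|complex.Re z| + `|complex.Im z|.
Proof.
case: z => x y /=; rewrite -[leRHS]ger0_norm ?addr_ge0// -sqrtr_sqr ler_wsqrtr//.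
rewrite sqrrD !real_normK ?num_real// lerD2r lerDl mulrn_wge0// mulr_ge0//.
Qed.

End ComplexParts.

Section ComplexPrimitive.
Context {R : realType} (a b : R).
Hypothesis ab : a < b.
Local Notation mu := (@lebesgue_measure R).
Implicit Types f g h : R -> R[i].

Let I : set (measurableTypeR R) := `[a, b]%classic.
Let mI : measurable I. Proof. exact: measurable_itvR. Qed.

Definition complex_primitive f g : Prop :=
  primitive a b (fun x => complex.Re (f x)) (fun x => complex.Re (g x)) /\
  primitive a b (fun x => complex.Im (f x)) (fun x => complex.Im (g x)).

Lemma complex_primitive_ac f g : complex_primitive f g -> abs_continuous a b f.
Proof.
move=> [fr fi] e e0; have e20 : 0 < e / 2 by rewrite divr_gt0.
have [d1 d10 h1] := primitive_abs_small fr e20.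
have [d2 d20 h2] := primitive_abs_small fi e20.
exists (Num.min d1 d2); first by rewrite lt_min d10.
move=> n J Jab tJ; rewrite lt_min => /andP[J1 J2].
have {}h1 := h1 n J Jab tJ J1; have {}h2 := h2 n J Jab tJ J2.
apply: (@le_lt_trans _ _ (\sum_(k < n) (`|complex.Re (f (J k).2) - complex.Re (f (J k).1)|
   + `|complex.Im (f (J k).2) - complex.Im (f (J k).1)|))).
  by apply: ler_sum => k _; rewrite -complex_ReB -complex_ImB; exact: normc_le.
by rewrite big_split /= [ltRHS]splitr; apply: ltrD.
Qed.

Lemma ac_complex_primitive f : abs_continuous a b f -> exists g, complex_primitive f g.
Proof.
move=> acf.
have H (p : R[i] -> R) : {morph p : z w / z - w} -> (forall z, `|p z| <= Normc.normc z) ->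
    exists g : R -> R, primitive a b (fun x => p (f x)) g.
  move=> pB pn; apply: abs_continuous_primitive => // e e0.
  have [d d0 hd] := acf e e0; exists d => //.
  apply: (disjoint_family_seq (D := fun q => `|p (f q.2) - p (f q.1)|)) => n J Jab tJ Jd.
  apply: le_lt_trans (hd n J Jab tJ Jd); apply: ler_sum => k _.
  by rewrite -pB.
have [g gp] := H _ (@complex_ReB R) (@normc_Re R); have [h hp] := H _ (@complex_ImB R) (@normc_Im R).
by exists (fun x => g x +i* h x).
Qed.

Lemma complex_primitive_derive f g : complex_primitive f g ->
  ae_equal a b (complex_derive f) g.
Proof.
move=> [/primitive_derive + /primitive_derive].
apply: (@filterS2 _ _ (ae_filter_ringOfSetsType mu)) => x + + Ix.
move=> /(_ Ix)[_ dr] /(_ Ix)[_ di].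
by apply: complex_eq; rewrite /complex_derive /= derive1E.
Qed.

Lemma complex_primitive_ae f g h : complex_primitive f g -> complex_integrable a b h ->
  ae_equal a b g h -> complex_primitive f h.
Proof.
move=> [fr fi] [hr hi] gh; split.
  by apply: primitive_ae fr hr _; move: gh; apply: (@filterS _ _ (ae_filter_ringOfSetsType mu)) => x gh Ix; rewrite gh.
by apply: primitive_ae fi hi _; move: gh; apply: (@filterS _ _ (ae_filter_ringOfSetsType mu)) => x gh Ix; rewrite gh.
Qed.

Lemma complex_primitive_eq f g h : complex_primitive f g ->
  (forall x, a <= x <= b -> f x = h x) -> complex_primitive h g.
Proof.
by move=> [fr fi] fh; split; [apply: primitive_eq fr _|apply: primitive_eq fi _] => // x xab; rewrite fh.
Qed.

Lemma complex_primitive_integrable f g : complex_primitive f g -> complex_integrable a b g.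
Proof. by move=> [[? _] [? _]]. Qed.

Lemma complex_primitive_cst (c : R[i]) : complex_primitive (cst c) (cst 0).
Proof. by split; exact: (primitive_cst a b). Qed.

Lemma complex_primitiveD f g f' g' : complex_primitive f f' -> complex_primitive g g' ->
  complex_primitive (fun x => f x + g x) (fun x => f' x + g' x).
Proof.
move=> [fr fi] [gr gi]; split.
  have := primitive_lin 1 fr gr.
  by congr primitive; apply/funext => x; rewrite mul1r complex_ReD.
have := primitive_lin 1 fi gi.
by congr primitive; apply/funext => x; rewrite mul1r complex_ImD.
Qed.

Lemma complex_primitive_mul f g f' g' : complex_primitive f f' -> complex_primitive g g' ->
  complex_primitive (fun x => f x * g x) (fun x => f' x * g x + f x * g' x).
Proof.
move=> [fr fi] [gr gi]; split.
  have := primitive_lin (-1) (primitive_mul ab fi gi) (primitive_mul ab fr gr).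
  by congr primitive; apply/funext => x; rewrite ?complex_ReD !complex_ReM; ring.
have := primitive_lin 1 (primitive_mul ab fi gr) (primitive_mul ab fr gi).
by congr primitive; apply/funext => x; rewrite ?complex_ImD !complex_ImM; ring.
Qed.

Lemma complex_primitive_conj f g : complex_primitive f g ->
  complex_primitive (fun x => (f x)^*) (fun x => (g x)^*).
Proof.
move=> [fr fi]; split.
  by move: fr; congr primitive; apply/funext => x; case: (_ x).
have := primitive_lin (-1) fi (primitive_cst a b 0).
by congr primitive; apply/funext => x; rewrite /cst addr0 mulN1r; case: (_ x).
Qed.

Lemma complex_primitiveZ (c : R[i]) f f' : complex_primitive f f' ->
  complex_primitive (fun x => c * f x) (fun x => c * f' x).
Proof.
move=> fp; have := complex_primitive_mul (complex_primitive_cst c) fp.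
by congr complex_primitive; apply/funext => x; rewrite /cst mul0r add0r.
Qed.

Lemma complex_primitive_sum (J : finType) (f g : J -> R -> R[i]) :
  (forall j, complex_primitive (f j) (g j)) ->
  complex_primitive (fun x => \sum_j f j x) (fun x => \sum_j g j x).
Proof.
move=> fg; elim: (index_enum J) => [|j s IH].
  have := complex_primitive_cst 0.
  by congr complex_primitive; apply/funext => x; rewrite big_nil.
have := complex_primitiveD (fg j) IH.
by congr complex_primitive; apply/funext => x; rewrite big_cons.
Qed.

Lemma complex_primitive_integral f g : complex_primitive f g ->
  complex_integral a b g = f b - f a.
Proof.
move=> [[_ fr] [_ fi]]; have bab : a <= b <= b by rewrite lexx ltW.
by apply: complex_eq; rewrite ?complex_ReB ?complex_ImB ?(fr b bab) ?(fi b bab) /= addrC addKr.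
Qed.

(** Makes the values of [ac_representative] on [[a, b]] unambiguous, end points included. *)
Lemma ac_ae_eq f g : abs_continuous a b f -> abs_continuous a b g -> ae_equal a b f g ->
  forall x, a <= x <= b -> f x = g x.
Proof.
move=> /ac_complex_primitive[f' ff'] /ac_complex_primitive[g' gg'] fg x xab.
have [dr di] := complex_primitiveD ff' (complex_primitiveZ (-1) gg').
apply: complex_eq; apply/eqP; rewrite -subr_eq0; apply/eqP.
  have := primitive_ae0 ab dr.
  move=> /(_ _ x xab); rewrite complex_ReD mulN1r => <-; first by case: (g x).
  by move: fg; apply: (@filterS _ _ (ae_filter_ringOfSetsType mu)) => t fg It; rewrite fg// mulN1r subrr.
have := primitive_ae0 ab di.
move=> /(_ _ x xab); rewrite complex_ImD mulN1r => <-; first by case: (g x).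
by move: fg; apply: (@filterS _ _ (ae_filter_ringOfSetsType mu)) => t fg It; rewrite fg// mulN1r subrr.
Qed.

(** Reduction to a real system indexed by [J * bool], where [false] marks real parts and [true]
    imaginary parts; each coefficient becomes the real 2 by 2 block of multiplication by it. *)
Lemma complex_linear_system (J : finType) (A : J -> J -> R -> R[i]) (F : J -> R -> R[i])
    (c : J -> R[i]) :
  (forall i j, complex_integrable a b (A i j)) -> (forall i, complex_integrable a b (F i)) ->
  exists v : J -> R -> R[i], forall i, v i a = c i /\
    complex_primitive (v i) (fun x => \sum_j A i j x * v j x + F i x).
Proof.
move=> Ai Fi.
pose part (p : bool) (z : R[i]) := if p then complex.Im z else complex.Re z.
pose A' (i j : J * bool) (x : R) : R :=
  match i.2, j.2 with
  | false, false | true, true => complex.Re (A i.1 j.1 x)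
  | false, true => - complex.Im (A i.1 j.1 x)
  | true, false => complex.Im (A i.1 j.1 x)
  end.
pose F' (i : J * bool) (x : R) : R := part i.2 (F i.1 x).
have A'i i j : mu.-integrable I (EFin \o A' i j).
  have [rAi iAi] := Ai i.1 j.1; rewrite /A'; case: i.2; case: j.2 => //.
  rewrite (_ : (fun x => _) = (fun x => (-1) * complex.Im (A i.1 j.1 x))).
    exact: integrable_realZ.
  by apply/funext => x; rewrite mulN1r.
have F'i i : mu.-integrable I (EFin \o F' i).
  by rewrite /F' /part; have [] := Fi i.1; case: i.2.
have [v hv] := linear_system_solution ab (fun i => part i.2 (c i.1)) A'i F'i.
exists (fun i x => v (i, false) x +i* v (i, true) x) => i; split.
  by apply: complex_eq => /=; rewrite (hv _).1.
have sumE p x : \sum_(j : J * bool) A' (i, p) j x * v j x =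
    \sum_j (A' (i, p) (j, false) x * v (j, false) x + A' (i, p) (j, true) x * v (j, true) x).
  transitivity (\sum_(j : J) \sum_(q : bool) A' (i, p) (j, q) x * v (j, q) x).
    by rewrite pair_bigA /=; apply: eq_bigr => -[j q] _.
  by apply: eq_bigr => j _; rewrite big_bool /= addrC.
split.
  have := (hv (i, false)).2; congr primitive; apply/funext => x.
  rewrite complex_ReD complex_Re_sum sumE; congr (_ + _); apply: eq_bigr => j _.
  by rewrite complex_ReM /= mulNr.
have := (hv (i, true)).2; congr primitive; apply/funext => x.
rewrite complex_ImD complex_Im_sum sumE; congr (_ + _); apply: eq_bigr => j _.
by rewrite complex_ImM /= addrC.
Qed.

End ComplexPrimitive.

(** * Inner product spaces *)

Lemma powV_le (R : realType) (i j n : nat) : (0 < i <= j)%N -> j%:R^-1 ^+ n <= i%:R^-1 ^+ n :> R.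
Proof.
move=> /andP[i0 ij]; apply: lerXn2r; rewrite ?nnegrE ?invr_ge0//.
by rewrite lef_pV2 ?posrE ?ltr0n ?(leq_trans i0)// ler_nat.
Qed.

Section InnerProduct.
Context {R : realType} {H : lmodType R[i]} (ip : H -> H -> R[i]).
Hypothesis ipDl : forall c f g h, ip (c *: f + g) h = c * ip f h + ip g h.
Hypothesis ipC : forall f g, ip g f = (ip f g)^*.
Hypothesis ip_ge0 : forall f, 0 <= complex.Re (ip f f).
Hypothesis ip_eq0 : forall f, complex.Re (ip f f) = 0 -> f = 0.

Let q f := complex.Re (ip f f).

Let ipDr c f g h : ip h (c *: f + g) = c^* * ip h f + ip h g.
Proof. by rewrite ipC ipDl rmorphD rmorphM /= -!ipC. Qed.

Let ipBl f g h : ip (f - g) h = ip f h - ip g h.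
Proof. by rewrite -scaleN1r addrC ipDl mulN1r addrC. Qed.

Let ip0l f : ip 0 f = 0.
Proof. by have := ipDl (-1) 0 0 f; rewrite scaler0 addr0 mulN1r addNr. Qed.

Let ip_suml (k : nat) (c : 'I_k -> R[i]) (e : 'I_k -> H) h :
  ip (\sum_i c i *: e i) h = \sum_i c i * ip (e i) h.
Proof.
elim: (index_enum _) => [|i s IH]; first by rewrite !big_nil ip0l.
by rewrite !big_cons ipDl IH.
Qed.

(** A row killed by the Gram matrix gives a combination orthogonal to every [e i], hence to itself,
    hence zero; independence then makes the row zero and the matrix invertible. *)
Lemma gram_solvable (k : nat) (e : 'I_k -> H) :
    (forall c : 'I_k -> R[i], \sum_i c i *: e i = 0 -> forall i, c i = 0) ->
  forall w : 'I_k -> R[i], exists c : 'I_k -> R[i],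
    forall j, ip (\sum_i c i *: e i) (e j) = w j.
Proof.
move=> indep w.
pose G : 'M[R[i]]_k := \matrix_(i, j) ip (e i) (e j).
have GE (c : 'rV[R[i]]_k) j : ip (\sum_i c 0 i *: e i) (e j) = (c *m G) 0 j.
  by rewrite ip_suml mxE; apply: eq_bigr => i _; rewrite mxE.
have Gu : G \in unitmx.
  rewrite -row_free_unit -kermx_eq0; apply/rowV0P => c /sub_kermxP cG.
  apply/rowP => i; rewrite mxE; apply: (indep (fun i => c 0 i)); apply: ip_eq0.
  rewrite [X in ip _ X](_ : _ = \sum_i c 0 i *: e i)// ipC ip_suml rmorph_sum /=.
  rewrite big1 // => j _.
  by rewrite rmorphM /= -ipC GE cG mxE mulr0.
exists (fun i => (\row_j w j *m invmx G) 0 i) => j.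
by rewrite GE mulmxKV// mxE.
Qed.

Let q_sub c f g : q (f - c *: g) =
  q f - 2 * complex.Re (c^* * ip f g) + complex.Re (c * c^*) * q g.
Proof.
rewrite /q -scaleNr addrC ipDl !ipDr (ipC f g) rmorphN /=.
have : complex.Im (ip g g) = 0.
  by have := ipC g g; case: (ip g g) => x y [] /eqP; rewrite -subr_eq0 opprK -mulr2n mulrn_eq0 /= => /eqP.
case: (ip f f) => x y; case: (ip g g) => z t /= ->; case: (ip f g) => u v; case: c => c1 c2 /=.
by ring.
Qed.

Lemma cauchy_schwarz f g :
  complex.Re (ip f g) ^+ 2 + complex.Im (ip f g) ^+ 2 <= q f * q g.
Proof.
set w := ip f g; set N := _ + _.
have N0 : 0 <= N by rewrite addr_ge0// sqr_ge0.
have quad (t : R) : 0 <= q f - 2 * t * N + t ^+ 2 * N * q g.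
  have := ip_ge0 (f - (t%:C * w) *: g); rewrite -/(q _) q_sub -/w /N.
  case: (w) => x y /=; set X := (X in 0 <= X -> _); set Y := (Y in _ -> 0 <= Y).
  by suff -> : X = Y by []; rewrite /X /Y; ring.
have [g0|g0] := eqVneq (q g) 0.
  (* When [q g = 0] the quadratic is affine in [t], and the chosen [t] makes it equal to
     [- q f - 2]. *)
  rewrite g0 mulr0 leNgt; apply/negP => Ngt0.
  have := quad ((q f + 1) / N); rewrite g0 mulr0 addr0.
  have -> : 2 * ((q f + 1) / N) * N = 2 * (q f + 1) by field; rewrite gt_eqF.
  have := ip_ge0 f; rewrite -/(q f); lra.
have qg : 0 < q g by rewrite lt_def g0 ip_ge0.
have := quad (q g)^-1.
have -> : q f - 2 * (q g)^-1 * N + (q g)^-1 ^+ 2 * N * q g = q f - N / q g by field.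
by rewrite subr_ge0 ler_pdivrMr.
Qed.

Let qZ c f : q (c *: f) = complex.Re (c * c^*) * q f.
Proof.
have := q_sub (- c) 0 f; rewrite scaleNr opprK add0r => ->.
by rewrite /q !ip0l mulr0 rmorphN mulrNN /= mulr0 subr0 add0r.
Qed.

(** Completeness for geometrically fast sequences only, which a minimizing sequence can be chosen to
    be. The limit rate is weaker than the step rate; any geometric rate suffices below. *)
Hypothesis complete : forall u : nat -> H,
  (forall n, q (u n.+1 - u n) <= 16^-1 ^+ n) ->
  exists l K, forall n, q (l - u n) <= K * 4^-1 ^+ n.

(* A minimizing sequence for the distance from [f] to [D] is Cauchy by the parallelogram
   identity, fast enough for [complete], and its limit [l] has [f - l] orthogonal to [D]. *)
Lemma orthogonal_dense (D : set H) :
    D 0 -> (forall c f g, D f -> D g -> D (c *: f + g)) ->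
    (forall h, (forall d, D d -> ip d h = 0) -> h = 0) ->
  forall f (e : R), 0 < e -> exists2 g, D g & ip_norm ip (f - g) < e.
Proof.
move=> D0 Dlin Dorth f e e0.
pose S := [set q (f - d) | d in D].
have S0 : S !=set0 by exists (q (f - 0)), 0.
have Slb : lbound S 0 by move=> _ [d _ <-]; exact: ip_ge0.
have Sinf : has_inf S by split=> //; exists 0.
(* Between successive terms the parallelogram identity gives at most
   [2 eps n.+1 + 2 eps n <= 4 eps n], which is [16^-n], the rate required by [complete]. *)
pose eps n : R := 16^-1 ^+ n / 4.
have eps0 n : 0 < eps n by rewrite divr_gt0// exprn_gt0// invr_gt0.
have /choice[d hd] n : exists d, D d /\ q (f - d) < inf S + eps n.
  by have [_ [d Dd <-] ?] := inf_adherent (eps0 n) Sinf; exists d.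
have qinf x : D x -> inf S <= q (f - x).
  by move=> Dx; apply: ge_inf; [exists 0|exists x].
have para x y : q (x - y) = 2 * q (f - x) + 2 * q (f - y) - 4 * q (f - 2^-1 *: (x + y)).
  have -> : f - 2^-1 *: (x + y) = 2^-1 *: ((f - x) + (f - y)).
    rewrite addrACA -opprD [RHS]scalerDr scalerN.
    have -> : f + f = 2%:R *: f by rewrite scaler_nat mulr2n.
    rewrite scalerA mulVf ?scale1r//.
  have -> : x - y = (f - y) - 1 *: (f - x) by rewrite scale1r opprB [RHS]addrC addrA subrK.
  rewrite -[(f - x) + (f - y)]addrC; set g := f - x; set h := f - y.
  have -> : h + g = h - (-1) *: g by rewrite scaleN1r opprK.
  rewrite qZ !q_sub; case: (ip h g) => u v /=.
  by field.
have [n|l [K hl]] := complete (u := d).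
  have [Dn qn] := hd n; have [DSn qSn] := hd n.+1.
  rewrite para.
  have : inf S <= q (f - 2^-1 *: (d n.+1 + d n)).
    apply: qinf; rewrite -[_ *: _]addr0; apply: (Dlin) => //.
    by rewrite -[d n.+1]scale1r; exact: Dlin.
  have : eps n.+1 <= eps n.
    by rewrite /eps ler_wpM2r ?invr_ge0// exprSr ler_piMr ?exprn_ge0 ?invr_ge0// invf_le1 ?ler1n.
  have -> : 16^-1 ^+ n = 4 * eps n by rewrite /eps; field.
  lra.
have K0 : 0 <= K by have := le_trans (ip_ge0 _) (hl 0); rewrite expr0 mulr1.
have fl : f - l = 0.
  apply: Dorth => z Dz; rewrite ipC.
  suff -> : ip (f - l) z = 0 by rewrite conjc0.
  set w := ip (f - l) z; have z0 := ip_ge0 z; rewrite -/(q z) in z0.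
  have bound n : complex.Re w ^+ 2 + complex.Im w ^+ 2 <=
      (2 * ((q z + 1) + K * q z)) * 4^-1 ^+ n.
    have [Dn qn] := hd n.
    pose wn := ip (f - d n) z; pose N := complex.Re wn ^+ 2 + complex.Im wn ^+ 2.
    have h1 : N <= (q z + 1) * eps n.
      (* Comparing [d n] with its variation along [z] bounds the inner product [wn]; the [+ 1]
         replaces the optimal [1 / q z] and avoids a separate case [q z = 0]. *)
      pose t := (q z + 1)^-1.
      have t0 : 0 < t by rewrite invr_gt0 ltr_wpDl.
      have Ddz : D (d n + (t%:C * wn) *: z) by rewrite addrC; exact: Dlin.
      have := qinf _ Ddz; rewrite opprD addrA q_sub -/wn.
      have -> : complex.Re ((t%:C * wn)^* * wn) = t * N.
        by rewrite /N; case: (wn) => x y /=; ring.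
      have -> : complex.Re (t%:C * wn * (t%:C * wn)^*) = t ^+ 2 * N.
        by rewrite /N; case: (wn) => x y /=; ring.
      move=> h.
      have tz : t * q z = 1 - t by rewrite /t; field; rewrite gt_eqF// ltr_wpDl.
      have N0 : 0 <= N by rewrite addr_ge0// sqr_ge0.
      have tN : t * N <= eps n.
        have e1 : t ^+ 2 * N * q z = t * N * (1 - t) by rewrite -tz; ring.
        have e2 : 0 <= t ^+ 2 * N by rewrite mulr_ge0// sqr_ge0.
        rewrite e1 in h; have e3 : t * N * (1 - t) = t * N - t ^+ 2 * N by ring.
        rewrite e3 in h; lra.
      have -> : N = (q z + 1) * (t * N) by rewrite /t; field; rewrite gt_eqF// ltr_wpDl.
      by apply: ler_wpM2l tN; rewrite addr_ge0.
    have h2 := cauchy_schwarz (l - d n) z.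
    have h3 : q (l - d n) * q z <= K * 4^-1 ^+ n * q z by apply: ler_wpM2r => //; exact: hl.
    have h4 : eps n <= 4^-1 ^+ n.
      rewrite /eps ler_pdivrMr//; apply: (@le_trans _ _ (4^-1 ^+ n)).
        exact: powV_le.
      by rewrite ler_peMr// ?exprn_ge0// ler1n.
    have wE : w = wn - ip (l - d n) z by rewrite /w /wn !ipBl; ring.
    have h5 : (q z + 1) * eps n <= (q z + 1) * 4^-1 ^+ n.
      by apply: ler_wpM2l h4; rewrite addr_ge0.
    have h6 := le_trans h2 h3; have h7 := le_trans h1 h5; rewrite /N in h7.
    move: h6 h7; rewrite wE; case: (wn) => x y; case: (ip (l - d n) z) => x' y' /=.
    have := sqr_ge0 (x + x'); have := sqr_ge0 (y + y').
    set E := 4^-1 ^+ n.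
    have -> : (x - x') ^+ 2 = 2 * x ^+ 2 + 2 * x' ^+ 2 - (x + x') ^+ 2 by ring.
    have -> : (y - y') ^+ 2 = 2 * y ^+ 2 + 2 * y' ^+ 2 - (y + y') ^+ 2 by ring.
    have -> : 2 * (q z + 1 + K * q z) * E = 2 * ((q z + 1) * E) + 2 * (K * E * q z) by ring.
    lra.
  have w2 : complex.Re w ^+ 2 + complex.Im w ^+ 2 = 0.
    apply: (@geometric_eq0 _ _ (2 * ((q z + 1) + K * q z))) => n.
    rewrite ger0_norm; last by rewrite addr_ge0// sqr_ge0.
    apply: (le_trans (bound n)); apply: ler_wpM2l.
      by rewrite mulr_ge0// !addr_ge0// mulr_ge0.
    exact: powV_le.
  move: w2; case: (w) => x y /= /eqP; rewrite paddr_eq0 ?sqr_ge0//.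
  by rewrite !sqrf_eq0 => /andP[/eqP -> /eqP ->].
have /eqP := fl; rewrite subr_eq0 => /eqP fE.
have [n nK] : exists n, K * 4^-1 ^+ n < e ^+ 2.
  apply: contrapT => /forallNP h.
  have e2 : e ^+ 2 = 0.
    apply: (@geometric_eq0 _ _ K) => n; rewrite ger0_norm ?sqr_ge0//.
    have := h n; rewrite ltNge => /negP/negPn/le_trans; apply; apply: ler_wpM2l => //.
    exact: powV_le.
  by move/eqP: e2; rewrite expf_eq0 /= gt_eqF.
exists (d n); first by have [] := hd n.
rewrite /ip_norm -/(q _) fE -[ltRHS]gtr0_norm// -sqrtr_sqr ltr_sqrt ?exprn_gt0//.
exact: le_lt_trans (hl n) nK.
Qed.

End InnerProduct.

Local Open Scope quotient_scope.

(** * The space L2 *)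

Section ComplexIntegral.
Context {R : realType} (a b : R).
Hypothesis ab : a < b.
Local Notation mu := (@lebesgue_measure R).
Implicit Types f g h : R -> R[i].

Let I : set (measurableTypeR R) := `[a, b]%classic.
Let mI : measurable I. Proof. exact: measurable_itvR. Qed.
Let I_finite : (mu I < +oo)%E.
Proof. by rewrite /I lebesgue_measure_itv /= lte_fin ab -EFinB ltry. Qed.

Lemma complex_integral_ae f g : complex_integrable a b f -> complex_integrable a b g ->
  ae_equal a b f g -> complex_integral a b f = complex_integral a b g.
Proof.
move=> [fr fi] [gr gi] fg.
have m (h : R -> R) : mu.-integrable I (EFin \o h) -> measurable_fun I h.
  by case/integrableP => /measurable_EFinP.
apply: complex_eq; apply: (@ae_Rintegral_eq R a b) => //; try exact: m;
  by move: fg; apply: (@filterS _ _ (ae_filter_ringOfSetsType mu)) => x h Ix; rewrite h.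
Qed.

Lemma complex_integrable_lin c f g : complex_integrable a b f -> complex_integrable a b g ->
  complex_integrable a b (fun x => c * f x + g x).
Proof.
move=> [fr fi] [gr gi]; split.
  rewrite (_ : (fun x => _) = EFin \o (fun x => complex.Re c * complex.Re (f x) +
      (- complex.Im c * complex.Im (f x) + complex.Re (g x)))).
    by do 2![apply: (@integrable_realD _ _ _ mu) => //; first exact: integrable_realZ].
  by apply/funext => x /=; rewrite complex_ReD complex_ReM; congr EFin; ring.
rewrite (_ : (fun x => _) = EFin \o (fun x => complex.Re c * complex.Im (f x) +
      (complex.Im c * complex.Re (f x) + complex.Im (g x)))).
  by do 2![apply: (@integrable_realD _ _ _ mu) => //; first exact: integrable_realZ].
by apply/funext => x /=; rewrite complex_ImD complex_ImM; congr EFin; ring.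
Qed.

Lemma complex_integral_lin c f g : complex_integrable a b f -> complex_integrable a b g ->
  complex_integral a b (fun x => c * f x + g x) =
  c * complex_integral a b f + complex_integral a b g.
Proof.
move=> [fr fi] [gr gi].
have D (h1 h2 : R -> R) : mu.-integrable I (EFin \o h1) -> mu.-integrable I (EFin \o h2) ->
    \int[mu]_(x in I) (h1 x + h2 x) = \int[mu]_(x in I) h1 x + \int[mu]_(x in I) h2 x.
  by move=> i1 i2; rewrite RintegralD.
have Z (k : R) (h1 : R -> R) : mu.-integrable I (EFin \o h1) ->
    \int[mu]_(x in I) (k * h1 x) = k * \int[mu]_(x in I) h1 x.
  by move=> i1; rewrite RintegralZl.
have iZ (k : R) (h1 : R -> R) : mu.-integrable I (EFin \o h1) ->
    mu.-integrable I (EFin \o (fun x => k * h1 x)).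
  by move=> i1; apply: (@integrable_realZ _ _ _ mu).
have iD (h1 h2 : R -> R) : mu.-integrable I (EFin \o h1) -> mu.-integrable I (EFin \o h2) ->
    mu.-integrable I (EFin \o (fun x => h1 x + h2 x)).
  by move=> i1 i2; apply: (@integrable_realD _ _ _ mu).
apply: complex_eq; rewrite ?complex_ReD ?complex_ImD ?complex_ReM ?complex_ImM /complex_integral /=.
  transitivity (\int[mu]_(x in I) (complex.Re c * complex.Re (f x) +
      (- complex.Im c * complex.Im (f x) + complex.Re (g x)))).
    by apply: eq_Rintegral => x _; rewrite complex_ReD complex_ReM; ring.
  rewrite D; [|exact: iZ|by apply: iD => //; exact: iZ].
  by rewrite D ?Z //; [rewrite /I; ring|exact: iZ].
transitivity (\int[mu]_(x in I) (complex.Re c * complex.Im (f x) +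
    (complex.Im c * complex.Re (f x) + complex.Im (g x)))).
  by apply: eq_Rintegral => x _; rewrite complex_ImD complex_ImM; ring.
rewrite D; [|exact: iZ|by apply: iD => //; exact: iZ].
by rewrite D ?Z //; [rewrite /I; ring|exact: iZ].
Qed.

Lemma complex_integral_conj f : complex_integrable a b f ->
  complex_integral a b (fun x => (f x)^*) = (complex_integral a b f)^*.
Proof.
move=> [fr fi]; apply: complex_eq => /=.
  by apply: eq_Rintegral => x _; case: (f x).
rewrite -mulN1r -RintegralZl//; apply: eq_Rintegral => x _; rewrite mulN1r.
by case: (f x).
Qed.

Lemma normc2E (z : R[i]) : Normc.normc z ^+ 2 = complex.Re z ^+ 2 + complex.Im z ^+ 2.
Proof. by case: z => x y /=; rewrite sqr_sqrtr// addr_ge0// sqr_ge0. Qed.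

Lemma square_integrable_mul f g : square_integrable a b f -> square_integrable a b g ->
  complex_integrable a b (fun x => f x * (g x)^*).
Proof.
move=> [fr fi f2] [gr gi g2].
have s : mu.-integrable I (EFin \o (fun x => Normc.normc (f x) ^+ 2 + Normc.normc (g x) ^+ 2)).
  exact: integrable_realD.
have conjR z : complex.Re (z^* : R[i]) = complex.Re z by case: z.
have conjI z : complex.Im (z^* : R[i]) = - complex.Im z by case: z.
split.
  apply: (le_integrable mI _ _ s).
    apply/measurable_EFinP.
    rewrite (_ : (fun x => _) = (fun x => complex.Re (f x) * complex.Re (g x) + complex.Im (f x) * complex.Im (g x))).
      by apply: measurable_funD; apply: measurable_funM.
    by apply/funext => x; rewrite complex_ReM conjR conjI; ring.
  move=> x _; rewrite !abse_EFin lee_fin [leRHS]ger0_norm ?addr_ge0 ?sqr_ge0//.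
  rewrite complex_ReM conjR conjI !normc2E ler_norml.
  set x1 := complex.Re (f x); set x2 := complex.Im (f x).
  set y1 := complex.Re (g x); set y2 := complex.Im (g x).
  have := sqr_ge0 (x1 + y1); have := sqr_ge0 (x2 + y2).
  have := sqr_ge0 (x1 - y1); have := sqr_ge0 (x2 - y2).
  have := sqr_ge0 x1; have := sqr_ge0 x2; have := sqr_ge0 y1; have := sqr_ge0 y2.
  by rewrite !sqrrB !sqrrD; move=> *; apply/andP; split; lra.
apply: (le_integrable mI _ _ s).
  apply/measurable_EFinP.
  rewrite (_ : (fun x => _) = (fun x => complex.Im (f x) * complex.Re (g x) - complex.Re (f x) * complex.Im (g x))).
    by apply: measurable_funB; apply: measurable_funM.
  by apply/funext => x; rewrite complex_ImM conjR conjI; ring.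
move=> x _; rewrite !abse_EFin lee_fin [leRHS]ger0_norm ?addr_ge0 ?sqr_ge0//.
rewrite complex_ImM conjR conjI !normc2E ler_norml.
set x1 := complex.Re (f x); set x2 := complex.Im (f x).
set y1 := complex.Re (g x); set y2 := complex.Im (g x).
have := sqr_ge0 (x1 + y2); have := sqr_ge0 (x2 + y1).
have := sqr_ge0 (x1 - y2); have := sqr_ge0 (x2 - y1).
have := sqr_ge0 x1; have := sqr_ge0 x2; have := sqr_ge0 y1; have := sqr_ge0 y2.
by rewrite !sqrrB !sqrrD; move=> *; apply/andP; split; lra.
Qed.

Lemma abs_continuous_square_integrable f : abs_continuous a b f -> square_integrable a b f.
Proof.
move=> /(ac_complex_primitive ab)[g [fr fi]].
have [M M0 fM] := primitive_bounded fr; have [N N0 fN] := primitive_bounded fi.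
have mr := primitive_measurable ab fr; have mi := primitive_measurable ab fi.
split=> //.
apply: (@measurable_bounded_integrable _ _ _ mu) => //.
- rewrite (_ : (fun x => _) = (fun x => complex.Re (f x) ^+ 2 + complex.Im (f x) ^+ 2)).
    by apply: measurable_funD; apply: measurable_funX.
  by apply/funext => x; rewrite normc2E.
exists (M ^+ 2 + N ^+ 2); split; first exact: num_real.
move=> K MK x; rewrite /= in_itv /= => xab; apply: le_trans (ltW MK).
rewrite normc2E ger0_norm ?addr_ge0 ?sqr_ge0//.
by apply: lerD; rewrite -real_normK ?num_real//; apply: lerXn2r; rewrite ?nnegrE//; [exact: fM|exact: fN].
Qed.

End ComplexIntegral.

Section AeEqual.
Context {R : realType} (a b : R).
Implicit Types f g h : R -> R[i].

Lemma ae_equal_sym f g : ae_equal a b f g -> ae_equal a b g f.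
Proof. by apply: (@filterS _ _ (ae_filter_ringOfSetsType lebesgue_measure)) => x h Ix; rewrite h. Qed.

Lemma ae_equal_trans f g h : ae_equal a b f g -> ae_equal a b g h -> ae_equal a b f h.
Proof.
by apply: (@filterS2 _ _ (ae_filter_ringOfSetsType lebesgue_measure)) => x h1 h2 Ix; rewrite h1// h2.
Qed.

Lemma ae_equal_refl f : ae_equal a b f f.
Proof. exact: aeW. Qed.

Lemma ae_equal_map (F : R[i] -> R[i]) f g : ae_equal a b f g ->
  ae_equal a b (fun x => F (f x)) (fun x => F (g x)).
Proof. by apply: (@filterS _ _ (ae_filter_ringOfSetsType lebesgue_measure)) => x h Ix; rewrite h. Qed.

Lemma ae_equal_map2 (F : R[i] -> R[i] -> R[i]) f g f' g' : ae_equal a b f g -> ae_equal a b f' g' ->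
  ae_equal a b (fun x => F (f x) (f' x)) (fun x => F (g x) (g' x)).
Proof.
by apply: (@filterS2 _ _ (ae_filter_ringOfSetsType lebesgue_measure)) => x h1 h2 Ix; rewrite h1// h2.
Qed.

End AeEqual.

Section L2InnerProduct.
Context {R : realType} (a b : R).
Hypothesis ab : a < b.
Local Notation mu := (@lebesgue_measure R).
Local Notation H := (L2 a b).
Implicit Types f g h : H.

Let I : set (measurableTypeR R) := `[a, b]%classic.
Let mI : measurable I. Proof. exact: measurable_itvR. Qed.

Lemma L2_fun_square_integrable f : square_integrable a b (L2_fun f).
Proof. by have /asboolP := L2fun_valP (repr f : L2fun a b). Qed.

Lemma L2_fun_pi (F : L2fun a b) : ae_equal a b (L2_fun (\pi_H F)) F.
Proof. by apply/L2_piP; rewrite reprK. Qed.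

Lemma L2_of_square_integrable F : square_integrable a b F ->
  exists f : H, ae_equal a b (L2_fun f) F.
Proof.
move=> /asboolP sF; exists (\pi_H (MkL2fun sF)).
exact: L2_fun_pi.
Qed.

Lemma L2_fun_lin c f g :
  ae_equal a b (L2_fun (c *: f + g)) (fun x => c * L2_fun f x + L2_fun g x).
Proof.
have -> : c *: f + g = \pi_H (c *: (repr f : L2fun a b) + repr g).
  by rewrite L2_piD L2_pi_scale !reprK.
exact: L2_fun_pi.
Qed.

Lemma L2_fun_inj f g : ae_equal a b (L2_fun f) (L2_fun g) -> f = g.
Proof. by move=> /L2_piP/eqP; rewrite !reprK. Qed.

Lemma L2_fun0 : ae_equal a b (L2_fun (0 : H)) (cst 0).
Proof.
have -> : (0 : H) = 0 *: 0 + 0 by rewrite scale0r addr0.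
(* The representative of the zero class is unknown; written as [- 0 + 0], the class is represented
   almost everywhere by a function minus itself. *)
have -> : (0 : H) = (-1) *: 0 + 0 by rewrite scaler0 addr0.
apply: ae_equal_trans (L2_fun_lin _ _ _) _.
have h := L2_fun_lin (-1) (0 : H) 0.
move: h; apply: (@filterS _ _ (ae_filter_ringOfSetsType mu)) => x h Ix.
by rewrite mul0r add0r h//; rewrite mulN1r addNr.
Qed.

Lemma L2_inner_integrable f g : complex_integrable a b (fun x => L2_fun f x * (L2_fun g x)^*).
Proof. by apply: square_integrable_mul; exact: L2_fun_square_integrable. Qed.

Lemma L2_innerE f g F G : ae_equal a b (L2_fun f) F -> ae_equal a b (L2_fun g) G ->
  complex_integrable a b (fun x => F x * (G x)^*) ->
  L2_inner f g = complex_integral a b (fun x => F x * (G x)^*).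
Proof.
move=> fF gG iFG; apply: complex_integral_ae => //; first exact: L2_inner_integrable.
exact: (ae_equal_map2 (fun z w => z * w^*) fF gG).
Qed.

Lemma L2_innerDl c f g h : L2_inner (c *: f + g) h = c * L2_inner f h + L2_inner g h.
Proof.
rewrite /L2_inner -complex_integral_lin; try exact: L2_inner_integrable.
apply: complex_integral_ae; first exact: L2_inner_integrable.
  by apply: complex_integrable_lin; exact: L2_inner_integrable.
move: (L2_fun_lin c f g); apply: (@filterS _ _ (ae_filter_ringOfSetsType mu)) => x fg Ix.
by rewrite fg// mulrDl mulrA.
Qed.

Lemma L2_innerC f g : L2_inner g f = (L2_inner f g)^*.
Proof.
rewrite /L2_inner -complex_integral_conj; last exact: L2_inner_integrable.
congr complex_integral; apply/funext => x.
by rewrite rmorphM /= conjcK mulrC.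
Qed.

Lemma L2_inner_Re f : complex.Re (L2_inner f f) = \int[mu]_(x in I) Normc.normc (L2_fun f x) ^+ 2.
Proof.
rewrite /L2_inner /complex_integral /=; apply: eq_Rintegral => x _.
by rewrite normc2E complex_ReM; case: (L2_fun f x) => u v /=; ring.
Qed.

Lemma L2_inner_ge0 f : 0 <= complex.Re (L2_inner f f).
Proof. by rewrite L2_inner_Re; apply: Rintegral_ge0 => x _; rewrite sqr_ge0. Qed.

Lemma L2_inner_eq0 f : complex.Re (L2_inner f f) = 0 -> f = 0.
Proof.
rewrite L2_inner_Re => f0; apply: L2_fun_inj; apply: ae_equal_trans (ae_equal_sym L2_fun0).
have [_ _ fi] := L2_fun_square_integrable f.
have mf : measurable_fun I (fun x => (Normc.normc (L2_fun f x) ^+ 2)%:E).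
  by case/integrableP: fi.
have /(ae_eq_integral_abs mu mI mf) : (\int[mu]_(x in I) `|(Normc.normc (L2_fun f x) ^+ 2)%:E| = 0)%E.
  transitivity (\int[mu]_(x in I) (Normc.normc (L2_fun f x) ^+ 2)%:E)%E.
    by apply: eq_integral => x _; rewrite gee0_abs// lee_fin sqr_ge0.
  rewrite -[LHS]fineK; last by apply: integrable_fin_num.
  by move: f0; rewrite /Rintegral => ->.
apply: (@filterS _ _ (ae_filter_ringOfSetsType mu)) => x h /h [].
rewrite normc2E => /eqP; rewrite paddr_eq0 ?sqr_ge0// !sqrf_eq0 => /andP[/eqP r0 /eqP i0].
exact: complex_eq.
Qed.

(** The interval is bounded, so the constant 1 is square-integrable and can be the second factor of
    the product. *)
Lemma L2_fun_integrable f : complex_integrable a b (L2_fun f).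
Proof.
have one : square_integrable a b (cst 1).
  apply: (abs_continuous_square_integrable ab).
  exact: (complex_primitive_ac (complex_primitive_cst a b 1)).
have := square_integrable_mul (L2_fun_square_integrable f) one.
by congr complex_integrable; apply/funext => x; rewrite /cst rmorph1 mulr1.
Qed.

End L2InnerProduct.

Local Close Scope quotient_scope.

(** * Riesz-Fischer completeness *)

Section L2Complete.
Context {R : realType} (a b : R).
Hypothesis ab : a < b.
Local Notation mu := (@lebesgue_measure R).
Local Notation H := (L2 a b).

Let I : set (measurableTypeR R) := `[a, b]%classic.
Let mI : measurable I. Proof. exact: measurable_itvR. Qed.

Lemma L2_inner_sub f g F G : ae_equal a b (L2_fun f) F -> ae_equal a b (L2_fun g) G ->
  mu.-integrable I (EFin \o (fun x => Normc.normc (F x - G x) ^+ 2)) ->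
  complex.Re (L2_inner (f - g : H) (f - g)) = \int[mu]_(x in I) Normc.normc (F x - G x) ^+ 2.
Proof.
move=> fF gG iFG; rewrite L2_inner_Re.
have [_ _ ifg] := L2_fun_square_integrable (f - g).
apply: (@ae_Rintegral_eq R a b) => //.
- by case/integrableP: ifg => /measurable_EFinP.
- by case/integrableP: iFG => /measurable_EFinP.
have : ae_equal a b (L2_fun (f - g)) (fun x => F x - G x).
  rewrite -scaleN1r addrC; apply: ae_equal_trans (L2_fun_lin _ _ _) _.
  move: fF gG; apply: (@filterS2 _ _ (ae_filter_ringOfSetsType mu)) => x h1 h2 Ix.
  by rewrite h1// h2// mulN1r addrC.
by apply: (@filterS _ _ (ae_filter_ringOfSetsType mu)) => x h Ix; rewrite h.
Qed.

Lemma square_integrableB F G : square_integrable a b F -> square_integrable a b G ->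
  square_integrable a b (fun x => F x - G x).
Proof.
move=> /asboolP sF /asboolP sG.
have := (L2fun_submod_closed a b).2 (-1) G F sG sF => /asboolP.
congr square_integrable; apply/funext => x.
by rewrite [LHS](_ : _ = -1 * G x + F x)// mulN1r addrC.
Qed.

(** The series of [4 ^+ n * |U n.+1 - U n|^2] has integral at most 2, hence an almost everywhere
    finite sum [g]. Pointwise increments are then at most [sqrt g * 2^-n], which gives a pointwise
    limit with a square error of order [4^-n * g], and [g] is integrable. *)
Lemma L2_complete (u : nat -> H) :
  (forall n, complex.Re (L2_inner (u n.+1 - u n) (u n.+1 - u n)) <= 16^-1 ^+ n) ->
  exists l K, forall n, complex.Re (L2_inner (l - u n) (l - u n)) <= K * 4^-1 ^+ n.
Proof.
move=> hu.
pose U n := L2_fun (u n).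
have sU n : square_integrable a b (U n) by exact: L2_fun_square_integrable.
have mU n : measurable_fun I (fun x => complex.Re (U n x)) /\ measurable_fun I (fun x => complex.Im (U n x)).
  by have [] := sU n.
pose D n (x : R) : R := Normc.normc (U n.+1 x - U n x) ^+ 2.
have iD n : mu.-integrable I (EFin \o D n) by have [] := square_integrableB (sU n.+1) (sU n).
have D_le n : \int[mu]_(x in I) D n x <= 16^-1 ^+ n.
  have e := L2_inner_sub (ae_equal_refl _ _ (U n.+1)) (ae_equal_refl _ _ (U n)) (iD n).
  by rewrite -[leLHS]e; exact: hu.
pose T n (x : measurableTypeR R) : \bar R := (4 ^+ n * D n x)%:E.
have iT n : mu.-integrable I (T n) by apply: (@integrable_realZ _ _ _ mu).
have T0 n x : (0 <= T n x)%E.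
  by rewrite lee_fin; apply: mulr_ge0; [exact: exprn_ge0|exact: sqr_ge0].
have mT n : measurable_fun I (T n) by case/integrableP: (iT n).
pose G (x : measurableTypeR R) : \bar R := (\sum_(n <oo) T n x)%E.
have G0 x : (0 <= G x)%E by apply: nneseries_ge0 => n _ _; exact: T0.
have mG : measurable_fun I G.
  rewrite /G; have := @ge0_emeasurable_sum _ _ _ I T xpredT (fun k x _ _ => T0 k x) (fun k _ => mT k).
  by congr measurable_fun; apply/funext => x; apply: eq_eseriesl.
have intG : (\int[mu]_(x in I) G x <= 2%:E)%E.
  rewrite /G integral_nneseries//.
  apply: lime_le; first by apply: is_cvg_nneseries => n _ _; apply: integral_ge0 => x _; exact: T0.
  near=> n.
  apply: (@le_trans _ _ (\sum_(0 <= k < n) (4^-1 ^+ k)%:E)%E).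
    apply: lee_sum => k _.
    rewrite -[leLHS]fineK; last exact: integrable_fin_num.
    rewrite lee_fin -/(Rintegral mu I (fun x => 4 ^+ k * D k x)) RintegralZl//.
    have -> : 4^-1 ^+ k = 4 ^+ k * 16^-1 ^+ k :> R.
      by rewrite -exprMn; congr (_ ^+ _); field.
    by apply: ler_wpM2l => //; rewrite exprn_ge0.
  rewrite sumEFin lee_fin; apply: (@le_trans _ _ (2 - 2 * 4^-1 ^+ n)).
    elim: {+}n => [|k IH]; first by rewrite big_nil expr0 mulr1 subrr.
    rewrite big_nat_recr//= exprS; have : 0 <= 4^-1 ^+ k :> R by rewrite exprn_ge0 ?invr_ge0.
    by move: IH; set s := \sum_(_ <= _ < _) _; set t := 4^-1 ^+ k; lra.
  by rewrite gerBl mulr_ge0// exprn_ge0// invr_ge0.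
have iG : mu.-integrable I G.
  apply/integrableP; split=> //.
  rewrite (_ : \int[mu]_(x in I) `|G x| = \int[mu]_(x in I) G x)%E.
    by apply: le_lt_trans intG _; rewrite ltry.
  by apply: eq_integral => x _; rewrite gee0_abs.
have [N [mN N0 NG]] := integrable_ae mI iG.
pose g (x : R) : R := fine (G x).
have ig : mu.-integrable I (EFin \o g).
  apply: (le_integrable mI _ _ iG).
    by apply/measurable_EFinP; apply: measurableT_comp mG.
  move=> x _ /=; rewrite /g; have := G0 x; case: (G x) => [r r0||]//=.
  by rewrite normr0 leey.
have g0 x : 0 <= g x by rewrite fine_ge0.
have Dg n x : I x -> ~ N x -> D n x <= g x * 4^-1 ^+ n.
  move=> Ix nNx; have fG : G x \is a fin_num.
    by apply: contrapT => nf; apply: nNx; apply: NG => /= h; apply/nf/h.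
  have : (T n x <= G x)%E.
    rewrite /G; apply: (@le_trans _ _ (\sum_(0 <= k < n.+1) T k x)%E).
      by rewrite big_nat_recr//= leeDr//; apply: sume_ge0 => *; exact: T0.
    by apply: nneseries_lim_ge => *; exact: T0.
  rewrite -(fineK fG) lee_fin -/(g x) exprVn ler_pdivlMr ?exprn_gt0//.
  by rewrite mulrC.
(* Killing the values on the null set where [G] may be infinite makes the increment bound hold at
   every point of [I], so the pointwise limit needs no exceptional set. *)
pose W (p : R[i] -> R) n (x : R) : R := \1_(~` N) x * p (U n x).
have W_step (p : R[i] -> R) : {morph p : z w / z - w} -> (forall z, `|p z| <= Normc.normc z) ->
    forall x, I x -> forall n, `|W p n.+1 x - W p n x| <= Num.sqrt (g x) * 2^-1 ^+ n.
  move=> pB pn x Ix n; rewrite /W -mulrBr -pB indicE.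
  have s0 : 0 <= Num.sqrt (g x) * 2^-1 ^+ n.
    by rewrite mulr_ge0 ?sqrtr_ge0// exprn_ge0// invr_ge0.
  case: (boolP (x \in ~` N)) => [/set_mem/= nN|_]; last by rewrite mul0r normr0.
  rewrite mul1r; apply: (le_trans (pn _)).
  have nc0 : 0 <= Normc.normc (U n.+1 x - U n x) by case: (_ - _) => ? ?; exact: sqrtr_ge0.
  rewrite -(@ler_pXn2r _ 2) ?nnegrE//.
  rewrite exprMn sqr_sqrtr// -exprM mulnC exprM.
  have -> : 2^-1 ^+ 2 = 4^-1 :> R by field.
  exact: Dg.
have limW : forall r : R[i] -> R, {morph r : z w / z - w} -> (forall z, `|r z| <= Normc.normc z) ->
    (forall n, measurable_fun I (fun x => r (U n x))) ->
    exists L : R -> R, measurable_fun I L /\ forall x, I x -> forall n,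
      `|L x - W r n x| <= 2 * Num.sqrt (g x) * 2^-1 ^+ n.
  move=> r pB pn mp.
  have /choice[L hL] x : exists l, I x -> forall n, `|l - W r n x| <= 2 * Num.sqrt (g x) * 2^-1 ^+ n.
    have [Ix|nIx] := pselect (I x); last by exists 0.
    have [l hl] := geometric_limit (sqrtr_ge0 (g x)) (W_step r pB pn x Ix).
    by exists l.
  exists L; split=> //.
  apply: (@measurable_fun_cvg _ _ _ I (W r)) => [n|x Ix]; last exact: geometric_cvg (hL x Ix).
  apply: measurable_funM; last exact: mp.
  by apply: measurable_funTS; apply: measurable_indic; exact: measurableC.
have [Lr [mLr hLr]] := limW _ (@complex_ReB R) (@normc_Re R) (fun n => (mU n).1).
have [Li [mLi hLi]] := limW _ (@complex_ImB R) (@normc_Im R) (fun n => (mU n).2).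
pose F (x : R) : R[i] := Lr x +i* Li x.
pose V n (x : R) : R[i] := W (@complex.Re R) n x +i* W (@complex.Im R) n x.
have VU n : ae_equal a b (U n) (V n).
  exists N; split=> // x /= h; apply: contrapT => nN; apply: h => _.
  by apply: complex_eq; rewrite /= /W indicE mem_set ?mul1r.
have FV n x : I x -> Normc.normc (F x - V n x) ^+ 2 <= 8 * 4^-1 ^+ n * g x.
  move=> Ix; rewrite normc2E complex_ReB complex_ImB /=.
  have sq (y : R) : `|y| <= 2 * Num.sqrt (g x) * 2^-1 ^+ n -> y ^+ 2 <= 4 * 4^-1 ^+ n * g x.
    move=> h; rewrite -real_normK ?num_real//.
    have -> : 4 * 4^-1 ^+ n * g x = (2 * Num.sqrt (g x) * 2^-1 ^+ n) ^+ 2.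
      rewrite !exprMn sqr_sqrtr// -exprM mulnC exprM.
      have -> : 2^-1 ^+ 2 = 4^-1 :> R by field.
      by ring.
    by apply: lerXn2r => //; rewrite nnegrE//; apply: le_trans h.
  have h1 := sq _ (hLr x Ix n); have h2 := sq _ (hLi x Ix n).
  apply: (le_trans (lerD h1 h2)); rewrite le_eqVlt; apply/orP; left; apply/eqP; ring.
have mFV n : square_integrable a b (fun x => F x - V n x).
  have mV (p : R[i] -> R) : measurable_fun I (fun x => p (U n x)) -> measurable_fun I (W p n).
    move=> mp; apply: measurable_funM => //.
    by apply: measurable_funTS; apply: measurable_indic; exact: measurableC.
  have mr : measurable_fun I (fun x : measurableTypeR R => complex.Re (F x - V n x)).
    rewrite (_ : (fun x => _) = (fun x => Lr x - W (@complex.Re R) n x)); last first.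
      by apply/funext => x; rewrite complex_ReB.
    by apply: measurable_funB => //; apply: mV; have [] := mU n.
  have mi : measurable_fun I (fun x : measurableTypeR R => complex.Im (F x - V n x)).
    rewrite (_ : (fun x => _) = (fun x => Li x - W (@complex.Im R) n x)); last first.
      by apply/funext => x; rewrite complex_ImB.
    by apply: measurable_funB => //; apply: mV; have [] := mU n.
  split=> //.
  have i8 : mu.-integrable I (EFin \o (fun x => 8 * 4^-1 ^+ n * g x)).
    by apply: (@integrable_realZ _ _ _ mu).
  apply: (le_integrable mI _ _ i8).
    apply/measurable_EFinP.
    rewrite (_ : (fun x => _) = (fun x => complex.Re (F x - V n x) ^+ 2 + complex.Im (F x - V n x) ^+ 2)).
      by apply: measurable_funD; apply: measurable_funX.
    by apply/funext => x; rewrite normc2E.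
  move=> x Ix /=; rewrite lee_fin ger0_norm ?sqr_ge0//.
  by apply: (le_trans (FV n x Ix)); exact: ler_norm.
(* Square integrability is known for [F - V 0] through its bound by [g]; the class of [F] is
   obtained by adding back [u 0]. *)
have [l' hl'] := L2_of_square_integrable (mFV 0).
pose l := 1 *: l' + u 0.
have lF : ae_equal a b (L2_fun l) F.
  apply: ae_equal_trans (L2_fun_lin _ _ _) _.
  move: hl' (VU 0); apply: (@filterS2 _ _ (ae_filter_ringOfSetsType mu)) => x h1 h2 Ix.
  by rewrite mul1r h1// -/(U 0) h2// subrK.
exists l, (8 * \int[mu]_(x in I) g x) => n.
have [_ _ iFV] := mFV n.
rewrite (L2_inner_sub lF (VU n) iFV).
have -> : 8 * \int[mu]_(x in I) g x * 4^-1 ^+ n = \int[mu]_(x in I) (8 * 4^-1 ^+ n * g x).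
  by rewrite RintegralZl// mulrAC.
apply: le_Rintegral => //; last exact: FV.
by apply: (@integrable_realZ _ _ _ mu).
Unshelve. all: by end_near. Qed.

End L2Complete.

(** * Operators determined by Cauchy data *)

Section CauchyData.
Context {R : realType} {H : lmodType R[i]} (ip : H -> H -> R[i]) {m : nat}.
Hypothesis ipDl : forall c f g h, ip (c *: f + g) h = c * ip f h + ip g h.
Hypothesis ipC : forall f g, ip g f = (ip f g)^*.
Hypothesis ip_ge0 : forall f, 0 <= complex.Re (ip f f).
Hypothesis ip_eq0 : forall f, complex.Re (ip f f) = 0 -> f = 0.
Hypothesis ip_complete : forall u : nat -> H,
  (forall n, complex.Re (ip (u n.+1 - u n) (u n.+1 - u n)) <= 16^-1 ^+ n) ->
  exists l K, forall n, complex.Re (ip (l - u n) (l - u n)) <= K * 4^-1 ^+ n.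

Variables (Lmax : set (H * H)) (vA vB : H * H -> 'cV[R[i]]_m).
Variables (L : 'M[R[i]]_m) (kappa : R[i]).
Hypothesis Lmax_linear : linear_operator Lmax.
Hypothesis vAlin : forall c p q, Lmax p -> Lmax q -> vA (c *: p + q) = c *: vA p + vA q.
Hypothesis vBlin : forall c p q, Lmax p -> Lmax q -> vB (c *: p + q) = c *: vB p + vB q.
Hypothesis Lunit : L \in unitmx.
Hypothesis kappa0 : kappa != 0.
Hypothesis green : forall p q, Lmax p -> Lmax q ->
  ip p.2 q.1 - ip p.1 q.2 =
    kappa * (dot (L *m vB p) (vB q) - dot (L *m vA p) (vA q)).
Hypothesis cauchy : forall g c, exists p, [/\ Lmax p, p.2 = g & vA p = c].

Let ipBl f g h : ip (f - g) h = ip f h - ip g h.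
Proof. by rewrite -scaleN1r addrC ipDl mulN1r addrC. Qed.
Let ip0l f : ip 0 f = 0.
Proof. by have := ipDl (-1) 0 0 f; rewrite scaler0 addr0 mulN1r addNr. Qed.
Let ip0r f : ip f 0 = 0.
Proof. by rewrite ipC ip0l conjc0. Qed.
Let ipBr f g h : ip h (f - g) = ip h f - ip h g.
Proof. by rewrite ipC ipBl rmorphB /= -!ipC. Qed.

Let Lmax0 : Lmax 0. Proof. by have [] := Lmax_linear. Qed.
Let LmaxD c p q : Lmax p -> Lmax q -> Lmax (c *: p + q).
Proof. by have [_ lin _] := Lmax_linear; exact: lin. Qed.
Let vA0 : vA 0 = 0.
Proof. by have := vAlin (-1) Lmax0 Lmax0; rewrite scaler0 addr0 scaleN1r addNr. Qed.
Let vB0 : vB 0 = 0.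
Proof. by have := vBlin (-1) Lmax0 Lmax0; rewrite scaler0 addr0 scaleN1r addNr. Qed.

(** The fundamental system of the homogeneous equation, normalized at [a]. Green's identity is
    tested against it below because the term with [(e k).2] vanishes. *)
Let kernel : exists e : 'I_m -> H * H,
  forall k, [/\ Lmax (e k), (e k).2 = 0 & vA (e k) = delta_mx k 0].
Proof. by have [e he] := choice (fun k : 'I_m => cauchy 0 (delta_mx k 0)); exists e. Qed.

Let e := sval (cid kernel).
Let eL k : Lmax (e k). Proof. by rewrite /e; case: cid => e' /= /(_ k)[]. Qed.
Let e2 k : (e k).2 = 0. Proof. by rewrite /e; case: cid => e' /= /(_ k)[]. Qed.
Let eA k : vA (e k) = delta_mx k 0. Proof. by rewrite /e; case: cid => e' /= /(_ k)[]. Qed.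

Let comb (c : 'I_m -> R[i]) := \sum_k c k *: e k.

Let combE (c : 'I_m -> R[i]) : [/\ Lmax (comb c), (comb c).1 = \sum_k c k *: (e k).1,
  (comb c).2 = 0 & vA (comb c) = \col_k c k /\ vB (comb c) = \sum_k c k *: vB (e k)].
Proof.
have [L0 c1 c2 cA cB] : [/\ Lmax (comb c), (comb c).1 = \sum_k c k *: (e k).1,
    (comb c).2 = 0, vA (comb c) = \sum_k c k *: vA (e k) & vB (comb c) = \sum_k c k *: vB (e k)].
  rewrite /comb; elim: (index_enum _) => [|k s [IL I1 I2 IA IB]].
    by rewrite !big_nil.
  rewrite !big_cons vAlin ?vBlin//; split; try by rewrite ?IA ?IB.
  - exact: LmaxD.
  - by rewrite -I1.
  - by rewrite /= I2 e2 scaler0 addr0.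
split=> //; split=> //; rewrite cA; apply/colP => i.
rewrite summxE mxE (bigD1 i)//= big1 => [|j ji].
  by rewrite eA !mxE !eqxx mulr1 addr0.
by rewrite eA !mxE eq_sym (negbTE ji) mulr0.
Qed.

Let Phi : 'M[R[i]]_m := \matrix_(i, k) vB (e k) i 0.

Let PhiE c : vB (comb c) = Phi *m \col_k c k.
Proof.
have [_ _ _ [_ ->]] := combE c; apply/colP => i.
by rewrite summxE mxE; apply: eq_bigr => k _; rewrite !mxE mulrC.
Qed.

(* The transfer matrix of the homogeneous equation preserves the form [L]. *)
Let Phi_unit : Phi \in unitmx.
Proof.
suff h : Phi^t*%sesqui *m L *m Phi = L.
  have : invmx L *m (Phi^t*%sesqui *m L) *m Phi = 1%:M.
    by rewrite -mulmxA h mulVmx.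
  by case/mulmx1_unit.
have ecol k : vB (e k) = col k Phi by apply/colP => i; rewrite !mxE.
apply/matrixP => l k.
have := green (eL k) (eL l); rewrite !e2 ip0l ip0r subrr => /esym/eqP.
rewrite mulf_eq0 (negbTE kappa0) /= subr_eq0 !eA !ecol => /eqP h.
have cd (M : 'M[R[i]]_m) (u : 'cV[R[i]]_m) (N : 'M[R[i]]_m) :
    dot (M *m col k N) (col l N) = (N^t*%sesqui *m M *m N) l k.
  rewrite -mulmxA mxE /dot; apply: eq_bigr => j _.
  by rewrite mulrC !mxE; congr (_ * _); apply: eq_bigr => i _; rewrite !mxE.
rewrite -(cd L 0 Phi) h -[delta_mx k 0]mul1mx -[delta_mx l 0]mul1mx -!colE.
by rewrite (cd L 0 1%:M) mulmx1 trmx1 map_mx1 mul1mx.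
Qed.

(** The vectors [vB (e k)] are the columns of the invertible matrix [Phi], so they span, and [L] is
    invertible. *)
Let vB_form_inj (u v : 'cV[R[i]]_m) :
  (forall k, dot (L *m u) (vB (e k)) = dot (L *m v) (vB (e k))) -> u = v.
Proof.
move=> h; suff : L *m u = L *m v by move/(congr1 (mulmx (invmx L))); rewrite !mulKmx.
have hc w : dot w (L *m u) = dot w (L *m v).
  have [c ->] : exists c, w = vB (comb c).
    exists (fun k => (invmx Phi *m w) k 0); rewrite PhiE.
    have -> : \col_k (invmx Phi *m w) k 0 = invmx Phi *m w by apply/colP => k; rewrite mxE.
    by rewrite mulKVmx.
  have [_ _ _ [_ ->]] := combE c.
  elim: (index_enum _) => [|k s IH]; first by rewrite !big_nil !dot0l.
  by rewrite !big_cons !dotDl IH [dot (vB _) _]dotC [in RHS]dotC h.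
exact: dot_inj hc.
Qed.

Let e1_indep (c : 'I_m -> R[i]) : \sum_k c k *: (e k).1 = 0 -> forall k, c k = 0.
Proof.
move=> c0 k; have [cL c1 c2 [cA _]] := combE c.
have : comb c = 0 by rewrite [comb c]surjective_pairing c1 c2 c0.
by move=> z; move: cA; rewrite z vA0 => /colP/(_ k); rewrite !mxE.
Qed.

Let gram := gram_solvable ipDl ipC ip_eq0 e1_indep.

(** A homogeneous solution [p] takes any value at [a]. Its value at [b] is corrected by some [q]
    with zero data at [a] whose image is a combination of the [e k]: Green's identity against [e l]
    reads off [vB q], and the Gram matrix allows those inner products to be prescribed. *)
Lemma cauchy_data_surjective u v : exists p, [/\ Lmax p, vA p = u & vB p = v].
Proof.
have [cL _ _ [cA _]] := combE (fun k => u k 0).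
set p := comb _ in cL cA.
have [c hc] := gram (fun l => kappa * dot (L *m (v - vB p)) (vB (e l))).
have [q [qL q2 qA]] := cauchy (\sum_k c k *: (e k).1) 0.
have qB : vB q = v - vB p.
  apply: vB_form_inj => l.
  have := green qL (eL l); rewrite e2 ip0r subr0 q2 hc qA mulmx0 dot0l subr0.
  by move/(mulfI kappa0).
exists (1 *: p + q); split; first exact: LmaxD.
  by rewrite vAlin// qA addr0 scale1r cA; apply/colP => k; rewrite mxE.
by rewrite vBlin// qB scale1r addrC subrK.
Qed.

Definition Lcauchy0 : set (H * H) := [set p | [/\ Lmax p, vA p = 0 & vB p = 0]].

(* Subtract from [f] a solution [z] of the equation with right-hand side [g] and the
   projection of [f - z] onto the solutions of the homogeneous equation: the remainder
   [w] is the image of an element with zero Cauchy data, whence [ip w w = 0]. *)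
Lemma adjoint_Lcauchy0 : adjoint ip Lcauchy0 `<=` Lmax.
Proof.
move=> [f g] adj.
have [z [zL z2 _]] := cauchy g 0.
have [c hc] := gram (fun l => ip (f - z.1) (e l).1).
have [cL c1 c2 _] := combE c.
set w := f - z.1 - \sum_k c k *: (e k).1.
have worth l : ip w (e l).1 = 0 by rewrite /w ipBl hc subrr.
have [q [qL q2 qA]] := cauchy w 0.
have qB : vB q = 0.
  apply: vB_form_inj => l; rewrite mulmx0 dot0l.
  have := green qL (eL l); rewrite e2 ip0r subr0 q2 worth qA mulmx0 dot0l subr0.
  by move/esym/eqP; rewrite mulf_eq0 (negbTE kappa0) => /eqP.
have q0 : Lcauchy0 (q.1, q.2) by rewrite -surjective_pairing.
have := adj _ _ q0; rewrite /= q2 => wf.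
have := green qL zL; rewrite q2 z2 qA qB !mulmx0 !dot0l subrr mulr0 => /eqP.
rewrite subr_eq0 => /eqP wz.
have wsum : ip w (\sum_k c k *: (e k).1) = 0.
  elim: (index_enum _) => [|k s IH]; first by rewrite big_nil ip0r.
  by rewrite big_cons ipC ipDl rmorphD rmorphM /= -!ipC worth IH mulr0 addr0.
have w0 : w = 0.
  have ww : ip w w = ip w f - ip w z.1 - ip w (\sum_k c k *: (e k).1) by rewrite -!ipBr.
  by apply: ip_eq0; rewrite ww wf wz wsum subrr subr0.
have -> : (f, g) = 1 *: z + comb c.
  rewrite [z]surjective_pairing [comb c]surjective_pairing scale1r c1 c2 z2.
  congr pair; rewrite ?addr0//.
  by move/eqP: w0; rewrite /w subr_eq0 => /eqP <-; rewrite addrC subrK.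
exact: LmaxD.
Qed.

(** If [h] is orthogonal to the domain, the pair [(0, h)] belongs to the adjoint, hence to [Lmax],
    which is single-valued: [h = 0]. *)
Lemma Lcauchy0_dense : densely_defined ip Lcauchy0.
Proof.
move=> f r r0; apply: (orthogonal_dense ipDl ipC ip_ge0 ip_complete _ _ _ _ r0).
- by exists 0; split; rewrite // -[(0, 0)]/(0 : H * H).
- move=> c x y [x2 [xL xA xB]] [y2 [yL yA yB]]; exists (c *: x2 + y2).
  split; first exact: (LmaxD c xL yL).
    by rewrite (vAlin c xL yL) xA yA scaler0 addr0.
  by rewrite (vBlin c xL yL) xB yB scaler0 addr0.
move=> h horth; have [_ _ uniq] := Lmax_linear.
apply: (uniq 0); last exact: Lmax0.
apply: adjoint_Lcauchy0 => x y xy /=; rewrite ip0r; apply/esym.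
by apply: horth; exists y.
Qed.

End CauchyData.

(** * Quasi-derivatives *)

Lemma entryE (C : nmodType) (m : nat) (M : 'M[C]_m) (i j : 'I_m) : entry M i.+1 j.+1 = M i j.
Proof. by rewrite /entry /= !valK. Qed.

Lemma entry_out (C : nmodType) (m k s : nat) (M : 'M[C]_m) : (m <= s.-1)%N -> entry M k s = 0.
Proof.
move=> ms; rewrite /entry; case: insubP => // i _ _.
by rewrite insubF// ltnNge ms.
Qed.

Lemma entry_sum (C : pzRingType) (m : nat) (M : 'M[C]_m) (Z : nat -> C) (i : 'I_m) :
  \sum_(1 <= s < i.+2) entry M i.+1 s * Z s.-1 = \sum_(j < m | (j <= i)%N) M i j * Z j.
Proof.
rewrite big_add1 /= big_mkord (big_ord_widen m (fun s => entry M i.+1 s.+1 * Z s)) ?ltn_ord//.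
by apply: eq_big => [j|j _]; rewrite ?ltnS// entryE.
Qed.

(** One formula for all rows: in the last one the superdiagonal [entry] falls outside the matrix and
    takes its default value 0. *)
Lemma hessenberg_row (C : pzRingType) (m : nat) (M : 'M[C]_m) (Z : nat -> C) (i : 'I_m) :
  (forall j : 'I_m, (i.+1 < j)%N -> M i j = 0) ->
  \sum_j M i j * Z j = \sum_(j < m | (j <= i)%N) M i j * Z j + entry M i.+1 i.+2 * Z i.+1.
Proof.
move=> M0; rewrite (bigID (fun j : 'I_m => (j <= i)%N)) /=; congr (_ + _).
have [im|mi] := ltnP i.+1 m.
  rewrite (bigD1 (Ordinal im)) /= ?ltnn// big1 ?addr0; last first.
    move=> j /andP[]; rewrite -ltnNge => ij jN; rewrite M0 ?mul0r//.
    by rewrite ltn_neqAle ij andbT eq_sym; apply: contra_neq jN => jE; apply: val_inj.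
  by congr (_ * _); rewrite -(entryE M i (Ordinal im)).
rewrite big1 => [|j]; last first.
  by rewrite -ltnNge => ij; have := leq_ltn_trans (leq_trans mi ij) (ltn_ord j); rewrite ltnn.
by rewrite entry_out ?mul0r.
Qed.

Section QuasiSystem.
Context {R : realType} (a b : R) {m : nat}.
Hypothesis ab : a < b.
Hypothesis m0 : (0 < m)%N.
Local Notation mu := (@lebesgue_measure R).
Local Notation C := R[i].
Variable A : R -> 'M[C]_m.
Hypothesis hA : shin_zettl a b A.

Let I : set (measurableTypeR R) := `[a, b]%classic.

Local Notation "''D[' k ]" := (@quasi_derivative R a b m A k) (format "''D[' k ]").

Let inI x : I x -> a <= x <= b. Proof. by rewrite /I /= in_itv. Qed.

Lemma ae_forall (J : finType) (P : J -> R -> Prop) :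
  (forall j, \forall x \ae mu, P j x) -> \forall x \ae mu, forall j, P j x.
Proof.
exact: (@filter_forall _ _ _ _ (ae_filter_ringOfSetsType mu)).
Qed.

Let A_hessenberg : \forall x \ae mu, I x -> forall i j : 'I_m, (i.+1 < j)%N -> A x i j = 0.
Proof.
have [h _ _] := hA.
have : \forall x \ae mu, forall ij : 'I_m * 'I_m, (ij.1.+1 < ij.2)%N -> I x -> A x ij.1 ij.2 = 0.
  apply: ae_forall => -[i j] /=.
  have [ij|nij] := boolP (i.+1 < j)%N; last by apply: aeW.
  by move: (h i j ij); apply: (@filterS _ _ (ae_filter_ringOfSetsType mu)) => x hx _ Ix; exact: hx.
by apply: (@filterS _ _ (ae_filter_ringOfSetsType mu)) => x hx Ix i j ij; exact: (hx (i, j)).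
Qed.

Let A_super : \forall x \ae mu, I x -> forall i : 'I_m, (i.+1 < m)%N -> entry (A x) i.+1 i.+2 != 0.
Proof.
have [_ _ h] := hA.
have : \forall x \ae mu, forall i : 'I_m, (i.+1 < m)%N -> I x -> entry (A x) i.+1 i.+2 != 0.
  apply: ae_forall => i.
  have [im|nim] := boolP (i.+1 < m)%N; last by apply: aeW.
  move: (h i (Ordinal im) erefl); apply: (@filterS _ _ (ae_filter_ringOfSetsType mu)) => x hx _ Ix.
  rewrite -[i.+2]/((Ordinal im).+1) entryE; apply: hx.
  by move: Ix; rewrite /I /=.
by apply: (@filterS _ _ (ae_filter_ringOfSetsType mu)) => x hx Ix i im; exact: hx.
Qed.

(** The first-order form of [D^[m] y = F], with [Y i] in the role of [D^[i] y] and the forcing term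
    in the last row; [Dom_system] and [system_Dom] are the two directions of the equivalence. *)
Definition quasi_system (Y : 'I_m -> R -> C) (F : R -> C) : Prop :=
  forall i, complex_primitive a b (Y i)
    (fun x => \sum_j A x i j * Y j x + (if i.+1 == m then F x else 0)).

Lemma complex_integrable_ac_mul f h : abs_continuous a b f -> complex_integrable a b h ->
  complex_integrable a b (fun x => h x * f x).
Proof.
move=> /(ac_complex_primitive ab)[g [fr fi]] [hr hi].
split.
  rewrite (_ : (fun x => _) = EFin \o (fun x => complex.Re (f x) * complex.Re (h x) - complex.Im (f x) * complex.Im (h x))).
    by apply: (@integrable_realB _ _ _ mu); [exact: measurable_itvR|exact: primitive_mul_integrable fr hr|exact: primitive_mul_integrable fi hi].
  by apply/funext => x /=; rewrite complex_ReM; congr EFin; ring.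
rewrite (_ : (fun x => _) = EFin \o (fun x => complex.Re (f x) * complex.Im (h x) + complex.Im (f x) * complex.Re (h x))).
  by apply: (@integrable_realD _ _ _ mu); [exact: measurable_itvR|exact: primitive_mul_integrable fr hi|exact: primitive_mul_integrable fi hr].
by apply/funext => x /=; rewrite complex_ImM; congr EFin; ring.
Qed.

Lemma complex_integrable0 : complex_integrable a b (cst 0).
Proof. exact: complex_primitive_integrable (complex_primitive_cst a b 0). Qed.

Lemma complex_integrable_sum (J : finType) (f : J -> R -> C) :
  (forall j, complex_integrable a b (f j)) -> complex_integrable a b (fun x => \sum_j f j x).
Proof.
move=> fi; elim: (index_enum J) => [|j s IH].
  by have := complex_integrable0; congr complex_integrable; apply/funext => x; rewrite big_nil.
have := complex_integrable_lin 1 (fi j) IH.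
by congr complex_integrable; apply/funext => x; rewrite big_cons mul1r.
Qed.

(** Either branch of [xget] agrees almost everywhere with the quotient: the chosen function by its
    defining property, the default because it is the quotient itself. *)
Lemma quasi_derivative_ae y (k : nat) : (0 < k < m)%N -> abs_continuous a b ('D[k] y) ->
  ae_equal a b ('D[k] y) (fun x => (entry (A x) k k.+1)^-1 *
    (complex_derive ('D[k.-1] y) x - \sum_(1 <= s < k.+1) entry (A x) k s * 'D[s.-1] y x)).
Proof.
move=> km; rewrite (quasi_derivativeE a b A y km) /ac_representative.
set f := (fun x => _).
case: xgetP => [g _ [_ fg] _|_ _]; first exact: ae_equal_sym.
exact: ae_equal_refl.
Qed.

Lemma quasi_rhs_integrable Y F i : (forall j, abs_continuous a b (Y j)) -> complex_integrable a b F ->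
  complex_integrable a b (fun x => \sum_(j < m) A x i j * Y j x + (if i.+1 == m then F x else 0)).
Proof.
move=> acY iF; have [_ iA _] := hA.
have iS := complex_integrable_sum (fun j => complex_integrable_ac_mul (acY j) (iA i j)).
case: eqP => _.
  have := complex_integrable_lin 1 iS iF.
  by congr complex_integrable; apply/funext => x; rewrite mul1r.
by move: iS; congr complex_integrable; apply/funext => x; rewrite addr0.
Qed.

Lemma quasi_row y x (i : 'I_m) : (forall i j : 'I_m, (i.+1 < j)%N -> A x i j = 0) ->
  \sum_j A x i j * 'D[j] y x =
  \sum_(1 <= s < i.+2) entry (A x) i.+1 s * 'D[s.-1] y x + entry (A x) i.+1 i.+2 * 'D[i.+1] y x.
Proof.
move=> hx; rewrite (entry_sum (A x) (fun k => 'D[k] y x)).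
by rewrite (hessenberg_row (fun k => 'D[k] y x)) // => j; exact: hx.
Qed.

Lemma Dom_system y F : Dom a b A y -> complex_integrable a b F ->
  ae_equal a b ('D[m] y) F -> quasi_system (fun i => 'D[i] y) F.
Proof.
move=> Dy iF yF i.
have ac j : (j < m)%N -> abs_continuous a b ('D[j] y) by exact: Dy.
have [g gp] := ac_complex_primitive ab (ac i (ltn_ord i)).
apply: (complex_primitive_ae gp); first by apply: quasi_rhs_integrable => // j; exact: ac.
apply: ae_equal_trans (ae_equal_sym (complex_primitive_derive gp)) _.
case: eqP => [im|/eqP im].
  move: yF A_hessenberg; apply: (@filterS2 _ _ (ae_filter_ringOfSetsType mu)) => x hF hH Ix.
  rewrite -(hF Ix) (quasi_row _ _ (hH Ix)) (@entry_out _ _ _ i.+2) ?im ?leqnn// mul0r addr0.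
  have mi : m.-1 = i := esym (congr1 predn im).
  by rewrite quasi_derivative_top// mi ?im addrC subrK.
have im' : (0 < i.+1 < m)%N by rewrite /= ltn_neqAle im ltn_ord.
have := quasi_derivative_ae im' (ac i.+1 (_ : (i.+1 < m)%N)).
rewrite ltn_neqAle im ltn_ord => /(_ isT).
move: A_hessenberg A_super; apply: (@filterS3 _ _ (ae_filter_ringOfSetsType mu)) => x hH hS hD Ix.
rewrite (quasi_row _ _ (hH Ix)) (hD Ix) /= mulVKf ?addr0.
  by rewrite addrC subrK.
by apply: hS => //; case/andP: im'.
Qed.

Lemma system_ac Y F i : quasi_system Y F -> abs_continuous a b (Y i).
Proof. by move=> /(_ i)/complex_primitive_ac. Qed.

(** By induction on the row, the quotient defining [D^[i]] equals [Y i] almost everywhere, by the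
    equation and the non-vanishing superdiagonal. Since [Y i] is absolutely continuous, the
    representative exists, and [ac_ae_eq] identifies it with [Y i] on all of [[a, b]]. *)
Lemma system_Dom Y F : quasi_system Y F ->
  [/\ Dom a b A (Y (Ordinal m0)),
      forall (i : 'I_m) x, a <= x <= b -> 'D[i] (Y (Ordinal m0)) x = Y i x &
      ae_equal a b ('D[m] (Y (Ordinal m0))) F].
Proof.
move=> sY; set y := Y (Ordinal m0).
(* The [oapp] term is the next component [Y i.+1], taken as 0 past the last index so that the last
   row fits the same formula. *)
have ae_row (i : 'I_m) : (forall j : 'I_m, (j <= i)%N -> forall x, a <= x <= b -> 'D[j] y x = Y j x) ->
    ae_equal a b (fun x => complex_derive ('D[i] y) x - \sum_(1 <= s < i.+2) entry (A x) i.+1 s * 'D[s.-1] y x)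
      (fun x => if i.+1 == m then F x else entry (A x) i.+1 i.+2 * oapp (Y^~ x) 0 (insub i.+1)).
  move=> hj.
  have cp := complex_primitive_eq ab (sY i) (fun x xab => esym (hj i (leqnn _) x xab)).
  move: (complex_primitive_derive cp) A_hessenberg.
  apply: (@filterS2 _ _ (ae_filter_ringOfSetsType mu)) => x hd hH Ix.
  rewrite hd// (entry_sum (A x) (fun k => 'D[k] y x)).
  rewrite (_ : \sum_j A x i j * Y j x = \sum_(j < m | (j <= i)%N) A x i j * 'D[j] y x +
      entry (A x) i.+1 i.+2 * oapp (Y^~ x) 0 (insub i.+1)); last first.
    have := hessenberg_row (fun k => oapp (Y^~ x) 0 (insub k)) (hH Ix i).
    under eq_bigr do rewrite valK /=.
    move=> ->; congr (_ + _); apply: eq_bigr => j ji.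
    by rewrite valK /= (hj j ji x (inI Ix)).
  rewrite addrAC [X in X + _]addrC addKr.
  case: eqP => [im|_]; last by rewrite addr0.
  by rewrite entry_out ?im// mul0r add0r.
have key k : (k < m)%N -> forall i : 'I_m, (i <= k)%N ->
    abs_continuous a b ('D[i] y) /\ (forall x, a <= x <= b -> 'D[i] y x = Y i x).
  elim: k => [_ i|k IH km i].
    rewrite leqn0 => /eqP i0; have -> : i = Ordinal m0 by apply: val_inj.
    by split=> //; exact: system_ac sY.
  rewrite leq_eqVlt => /predU1P[ik|]; last exact: IH (ltnW km) i.
  pose k' := Ordinal (ltnW km).
  have row := ae_row k' (fun j jk => (IH (ltnW km) j jk).2).
  have km' : (0 < k.+1 < m)%N by [].
  rewrite ik (quasi_derivativeE a b A y km').
  have fY : ae_equal a b (fun x => (entry (A x) k.+1 k.+2)^-1 *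
      (complex_derive ('D[k] y) x - \sum_(1 <= s < k.+2) entry (A x) k.+1 s * 'D[s.-1] y x)) (Y i).
    move: row A_super; apply: (@filterS2 _ _ (ae_filter_ringOfSetsType mu)) => x h1 h2 Ix.
    rewrite h1//= (ltn_eqF km) mulKf; last exact: (h2 Ix k').
    by rewrite -ik valK.
  have acY := system_ac i sY.
  rewrite /ac_representative; case: xgetP => [g -> [acg fg]|]; last first.
    by move=> /(_ (Y i)) []; split.
  split=> // x; apply: (ac_ae_eq ab) => //.
  exact: ae_equal_trans (ae_equal_sym fg) fY.
have key' (i : 'I_m) := key i (ltn_ord i) i (leqnn i).
split.
- by move=> k km; have [] := key' (Ordinal km).
- by move=> i; have [] := key' i.
have lastP : (m.-1 < m)%N by rewrite prednK.
have := ae_row (Ordinal lastP) (fun j _ => (key' j).2).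
rewrite quasi_derivative_top//= prednK//.
apply: (@filterS _ _ (ae_filter_ringOfSetsType mu)) => x h Ix.
by rewrite h//= eqxx.
Qed.

Lemma quasi_system_solution F (c : 'I_m -> C) : complex_integrable a b F ->
  exists Y, quasi_system Y F /\ forall i, Y i a = c i.
Proof.
move=> iF; have [_ iA _] := hA.
have [|Y hY] := complex_linear_system ab c iA (F := fun (i : 'I_m) x => if i.+1 == m then F x else 0).
  by move=> i; case: eqP => // _; exact: complex_integrable0.
by exists Y; split=> i; have [] := hY i.
Qed.

Lemma quasi_system_lin (c : C) Y Z F G : quasi_system Y F -> quasi_system Z G ->
  quasi_system (fun i x => c * Y i x + Z i x) (fun x => c * F x + G x).
Proof.
move=> sY sZ i; have := complex_primitiveD (complex_primitiveZ ab c (sY i)) (sZ i).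
congr complex_primitive; apply/funext => x.
rewrite mulrDr addrACA; congr (_ + _).
  by rewrite mulr_sumr -big_split; apply: eq_bigr => j _; rewrite mulrDr mulrCA.
by case: eqP => // _; rewrite mulr0 addr0.
Qed.

(** Each row with vanishing components up to [i] reduces to the superdiagonal entry times [Y i.+1],
    so [Y i.+1] vanishes almost everywhere and then everywhere by continuity; the last row leaves
    [F = 0]. *)
Lemma quasi_system_unique Y F : quasi_system Y F ->
  (forall x, a <= x <= b -> Y (Ordinal m0) x = 0) ->
  (forall (i : 'I_m) x, a <= x <= b -> Y i x = 0) /\ ae_equal a b F (cst 0).
Proof.
move=> sY Y0.
have acY i := system_ac i sY.
have row (i : 'I_m) : (forall j : 'I_m, (j <= i)%N -> forall x, a <= x <= b -> Y j x = 0) ->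
    ae_equal a b (fun x => entry (A x) i.+1 i.+2 * oapp (Y^~ x) 0 (insub i.+1) + (if i.+1 == m then F x else 0)) (cst 0).
  move=> hj.
  have cp := complex_primitive_eq ab (sY i) (fun x xab => hj i (leqnn _) x xab).
  have d1 := complex_primitive_derive cp.
  have d2 := complex_primitive_derive (complex_primitive_cst a b 0).
  move: d1 d2 A_hessenberg; apply: (@filterS3 _ _ (ae_filter_ringOfSetsType mu)) => x h1 h2 hH Ix.
  rewrite -[RHS](h2 Ix) (h1 Ix); congr (_ + _).
  have := hessenberg_row (fun k => oapp (Y^~ x) 0 (insub k)) (hH Ix i).
  under eq_bigr do rewrite valK /=.
  move=> ->; rewrite big1 ?add0r// => j ji.
  by rewrite valK /= (hj j ji x (inI Ix)) mulr0.
have key k : (k < m)%N -> forall i : 'I_m, (i <= k)%N -> forall x, a <= x <= b -> Y i x = 0.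
  elim: k => [_ i|k IH km i].
    rewrite leqn0 => /eqP i0; have -> : i = Ordinal m0 by apply: val_inj.
    exact: Y0.
  rewrite leq_eqVlt => /predU1P[ik|]; last exact: IH (ltnW km) i.
  apply: ac_ae_eq => //; first exact: (complex_primitive_ac (complex_primitive_cst a b 0)).
  move: (row (Ordinal (ltnW km)) (IH (ltnW km))) A_super.
  apply: (@filterS2 _ _ (ae_filter_ringOfSetsType mu)) => x h1 h2 Ix.
  have := h1 Ix; rewrite /= (ltn_eqF km) addr0 -ik valK /= => /eqP.
  have := h2 Ix (Ordinal (ltnW km)) km; rewrite /= -ik => nz.
  by rewrite mulf_eq0 (negbTE nz) => /eqP.
split; first by move=> i; exact: (key i (ltn_ord i) i (leqnn i)).
have lastP : (m.-1 < m)%N by rewrite prednK.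
have := row (Ordinal lastP) (fun j _ => key j (ltn_ord j) j (leqnn j)).
apply: (@filterS _ _ (ae_filter_ringOfSetsType mu)) => x h Ix.
have := h Ix; rewrite /= prednK// eqxx entry_out ?mul0r ?add0r//.
Qed.

End QuasiSystem.

(** * The antidiagonal sign matrix *)

Section LambdaForm.
Context {R : realType} {m : nat}.
Local Notation C := R[i].
Local Notation La := (@Lambda R m).

Lemma Lambda_mulE (u : 'cV[C]_m) (i : 'I_m) : (La *m u) i 0 = (-1) ^+ i.+1 * u (rev_ord i) 0.
Proof.
rewrite mxE (bigD1 (rev_ord i))//= mxE /= -addSn subnKC ?ltn_ord// eqxx.
rewrite big1 ?addr0// => j ji; rewrite mxE; case: eqP => [ij|_]; last by rewrite mul0r.
by case/eqP: ji; apply: val_inj; rewrite /= -[X in (X - _)%N]ij -addSn addKn.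
Qed.

Lemma Lambda_unit : La \in unitmx.
Proof.
suff : La^T *m La = 1%:M by case/mulmx1_unit.
apply/matrixP => j k; rewrite mxE.
have -> : \sum_i La^T j i * La i k = \sum_i La i j * La i k.
  by apply: eq_bigr => i _; rewrite mxE.
rewrite (bigD1 (rev_ord j))//= big1 ?addr0 => [|i ij]; last first.
  rewrite mxE; case: eqP => [e|_]; last by rewrite mul0r.
  by case/eqP: ij; apply: val_inj; rewrite /= -[X in (X - _)%N]e -addnS addnK.
rewrite !mxE /=.
have e1 : (m - j.+1 + j).+1 = m by rewrite -addnS subnK ?ltn_ord.
rewrite e1 eqxx; case: eqP => [e|ne]; last first.
  rewrite mulr0; case: (eqVneq j k) => // jk; case: ne.
  by rewrite -jk.
have -> : j = k by apply: val_inj; apply/eqP; rewrite -(eqn_add2l (m - j.+1)); apply/eqP; exact: succn_inj (etrans e1 (esym e)).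
by rewrite eqxx -expr2 sqrr_sign.
Qed.

End LambdaForm.

(** * Lagrange's identity *)

Section Lagrange.
Context {R : realType} (a b : R) {m : nat}.
Hypothesis ab : a < b.
Hypothesis m0 : (0 < m)%N.
Local Notation mu := (@lebesgue_measure R).
Local Notation C := R[i].
Local Notation La := (@Lambda R m).
Variable A : R -> 'M[C]_m.
Hypothesis hA : shin_zettl a b A.
Hypothesis hAsym : formally_self_adjoint a b A.

Local Notation "''D[' k ]" := (@quasi_derivative R a b m A k) (format "''D[' k ]").
Let o := Ordinal m0.

(** Formal self-adjointness says that [La *m A x] is minus the conjugate transpose of [A x] times
    [La], so all terms containing the coefficients cancel. Only the forcing terms of the last row
    remain, and [La] pairs them with component 0. *)
Lemma lagrange_identity Y Z F G : quasi_system a b A Y F -> quasi_system a b A Z G ->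
  complex_integrable a b F -> complex_integrable a b G ->
  complex_primitive a b (fun x => dot (La *m \col_j Y j x) (\col_j Z j x))
    (fun x => - (F x * (Z o x)^*) + (-1) ^+ m * (Y o x * (G x)^*)).
Proof.
move=> sY sZ iF iG.
have acY i := system_ac i sY; have acZ i := system_ac i sZ.
pose Y' i x : C := \sum_j A x i j * Y j x + (if i.+1 == m then F x else 0).
pose Z' i x : C := \sum_j A x i j * Z j x + (if i.+1 == m then G x else 0).
have W : complex_primitive a b (fun x => dot (La *m \col_j Y j x) (\col_j Z j x))
    (fun x => dot (La *m \col_j Y' j x) (\col_j Z j x) + dot (La *m \col_j Y j x) (\col_j Z' j x)).
  have := complex_primitive_sum (fun i : 'I_m => complex_primitive_mul ab
    (complex_primitiveZ ab ((-1) ^+ i.+1) (sY (rev_ord i))) (complex_primitive_conj (sZ i))).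
  congr complex_primitive; apply/funext => x.
    by rewrite /dot; apply: eq_bigr => i _; rewrite Lambda_mulE !mxE.
  by rewrite /dot -big_split; apply: eq_bigr => i _; rewrite !Lambda_mulE !mxE.
have acc f : abs_continuous a b f -> abs_continuous a b (fun x => (f x)^*).
  by move=> /(ac_complex_primitive ab)[f' /complex_primitive_conj/complex_primitive_ac].
have icc f : complex_integrable a b f -> complex_integrable a b (fun x => (f x)^*).
  move=> [fr fi]; split.
    by move: fr; congr (integrable _ _ _); apply/funext => x; case: (f x).
  rewrite (_ : (fun x => _) = EFin \o (fun x => -1 * complex.Im (f x))).
    by apply: (@integrable_realZ _ _ _ mu) => //; exact: measurable_itvR.
  by apply/funext => x /=; rewrite mulN1r; case: (f x).
apply: (complex_primitive_ae W).
  have i1 := complex_integrable_ac_mul ab (acc _ (acZ o)) iF.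
  have i2 := complex_integrable_ac_mul ab (acY o) (icc _ iG).
  have := complex_integrable_lin (-1) i1 (complex_integrable_lin ((-1) ^+ m) i2 (complex_integrable0 a b)).
  by congr complex_integrable; apply/funext => x; rewrite mulN1r addr0 [Y o x * _]mulrC.
move: hAsym; apply: (@filterS _ _ (ae_filter_ringOfSetsType mu)) => x hx Ix.
have {hx}hx : La *m A x = - ((A x)^t*%sesqui *m La).
  rewrite {1}hx; last by rewrite inE in Ix *.
  rewrite /formal_adjoint mulmxN -mulmxA mulKVmx ?Lambda_unit//.
have lastP : (m.-1 < m)%N by rewrite prednK.
pose l := Ordinal lastP; pose e : 'cV[C]_m := delta_mx l 0.
have split1 (V : 'I_m -> R -> C) H : \col_i (\sum_j A x i j * V j x + (if i.+1 == m then H else 0)) =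
    A x *m (\col_j V j x) + H *: e.
  apply/colP => i; rewrite !mxE; congr (_ + _).
    by apply: eq_bigr => j _; rewrite mxE.
  rewrite eqxx andbT; have -> : (i == l) = (i.+1 == m) by rewrite -val_eqE /= -(eqn_add2r 1) !addn1 prednK.
  by case: eqP => _; rewrite ?mulr1 ?mulr0.
rewrite /Y' /Z' !split1 mulmxDr -scalemxAr.
set y := \col_j Y j x; set z := \col_j Z j x.
rewrite addrC [La *m (A x *m y) + _]addrC !dotDl addrC [A x *m z + _]addrC dotDr.
rewrite [dot (La *m y) (A x *m z)]dot_mulmx !mulmxA hx mulNmx.
have -> : dot (- (A x ^t* *m La *m y))%sesqui z = - dot (A x ^t* *m La *m y)%sesqui z.
  by rewrite -[X in dot X z]addr0 -scaleN1r dotDl dot0l addr0 mulN1r.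
(* Row 0 of [La] reads the last coordinate with sign -1; its last row reads coordinate 0 with sign
   [(-1) ^+ m]. *)
have -> : dot (La *m e) z = - (Z o x)^*.
  rewrite /dot (bigD1 o)//= Lambda_mulE !mxE.
  rewrite big1 ?addr0 => [|i io]; last first.
    rewrite Lambda_mulE mxE eqxx andbT -val_eqE /= -subn1.
    have i0 : (0 < i)%N by rewrite lt0n; apply: contra io => /eqP i0; apply/eqP/val_inj.
    case: eqP => [e1|_]; last by rewrite mulr0 mul0r.
    by exfalso; move: e1 i0 (ltn_ord i) m0; clear; lia.
  have -> : (rev_ord o == l) by rewrite -val_eqE /= subn1.
  by rewrite eqxx /= expr1 mulr1 mulN1r.
have -> : dot (La *m y) e = (-1) ^+ m * Y o x.
  rewrite /dot (bigD1 l)//= Lambda_mulE !mxE !eqxx /= prednK// rmorph1 mulr1.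
  rewrite big1 ?addr0 => [|i il]; last by rewrite !mxE (negbTE il) rmorph0 mulr0.
  by congr (_ * Y _ x); apply: val_inj; rewrite /= prednK// subnn.
by ring.
Qed.

End Lagrange.

(** * The maximal operator *)

Section MaximalOperator.
Context {R : realType} (a b : R) {m : nat}.
Hypothesis ab : a < b.
Hypothesis m0 : (0 < m)%N.
Local Notation mu := (@lebesgue_measure R).
Local Notation C := R[i].
Local Notation H := (L2 a b).
Local Notation La := (@Lambda R m).
Variable A : R -> 'M[C]_m.
Hypothesis hA : shin_zettl a b A.
Hypothesis hAsym : formally_self_adjoint a b A.
Implicit Types p q : H * H.

Local Notation "''D[' k ]" := (@quasi_derivative R a b m A k) (format "''D[' k ]").
Let o := Ordinal m0.

Definition represents p (y : R -> C) : Prop :=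
  [/\ Dom_max a b A y, ae_equal a b (L2_fun p.1) y &
      ae_equal a b (L2_fun p.2) (quasi_expression a b A y)].

Lemma L_restrictionP (S : set (R -> C)) p :
  L_restriction a b A S p <-> exists2 y, represents p y & S y.
Proof. by split=> [[y [? ? ? ?]]|[y [? ? ?] ?]]; exists y. Qed.

Lemma L_maxP p : L_max a b A p <-> exists y, represents p y.
Proof. by rewrite /L_max L_restrictionP; split=> [[y]|[y]]; exists y. Qed.

Let unit_im : ('i ^+ m : C) != 0.
Proof. by apply: expf_neq0; rewrite eq_complex /= oner_eq0 andbF. Qed.

Lemma represents_system p y : represents p y -> exists f : H,
  [/\ quasi_system a b A (fun i => 'D[i] y) (L2_fun f), ae_equal a b ('D[m] y) (L2_fun f) &
      ae_equal a b (L2_fun p.2) (fun x => 'i ^+ m * L2_fun f x)].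
Proof.
move=> [[Dy [f fy]] _ p2]; exists f; split.
- by apply: Dom_system => //; [exact: L2_fun_integrable|exact: ae_equal_sym].
- exact: ae_equal_sym.
- by apply: ae_equal_trans p2 _; apply: (ae_equal_map (fun z => 'i ^+ m * z)); exact: ae_equal_sym.
Qed.

Lemma system_represents Y (f : H) : quasi_system a b A Y (L2_fun f) ->
  exists p, [/\ represents p (Y o), p.2 = 'i ^+ m *: f &
    forall (i : 'I_m) x, a <= x <= b -> 'D[i] (Y o) x = Y i x].
Proof.
move=> sY; have [DY YE Df] := system_Dom ab m0 hA sY.
have [g gY] := L2_of_square_integrable (abs_continuous_square_integrable ab (system_ac o sY)).
exists (g, 'i ^+ m *: f); split=> //; split=> //.
  by split=> //; exists f; exact: ae_equal_sym.
have := L2_fun_lin ('i ^+ m) f 0; rewrite addr0 => h.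
apply: ae_equal_trans h _.
move: (L2_fun0 a b) Df; apply: (@filterS2 _ _ (ae_filter_ringOfSetsType mu)) => x h1 h2 Ix.
by rewrite /quasi_expression (h2 Ix) (h1 Ix) addr0.
Qed.

(** Two absolutely continuous functions in one L2 class agree on [[a, b]], so the difference of
    their systems has zero first component and [quasi_system_unique] applies. This yields both
    well-defined boundary values and a single-valued [L_max]. *)
Lemma represents_unique p q y z : represents p y -> represents q z -> p.1 = q.1 ->
  (forall (i : 'I_m) x, a <= x <= b -> 'D[i] y x = 'D[i] z x) /\ p = q.
Proof.
move=> py qz pq.
have [f [sy fy pf]] := represents_system py; have [g [sz gz qg]] := represents_system qz.
have [x xab|D0 F0] := quasi_system_unique (m0 := m0) ab hA (quasi_system_lin ab (-1) sy sz).
  rewrite /= !quasi_derivative0 mulN1r addrC; apply/eqP; rewrite subr_eq0; apply/eqP.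
  apply: (ac_ae_eq ab) => //; try by [case: py => -[/(_ 0%N m0)] | case: qz => -[/(_ 0%N m0)]].
  case: py qz => _ p1 _ [_ q1 _]; apply: ae_equal_trans (ae_equal_sym q1) _.
  by rewrite -pq.
split=> [i x xab|].
  have := D0 i x xab; rewrite mulN1r addrC => /eqP; rewrite subr_eq0 => /eqP ->//.
rewrite [p]surjective_pairing [q]surjective_pairing pq; congr pair.
apply: L2_fun_inj; apply: ae_equal_trans pf _.
apply: ae_equal_trans (ae_equal_sym qg).
apply: (ae_equal_map (fun z => 'i ^+ m * z)).
move: F0; apply: (@filterS _ _ (ae_filter_ringOfSetsType mu)) => x h Ix.
by have := h Ix; rewrite mulN1r addrC => /eqP; rewrite subr_eq0 => /eqP ->.
Qed.

Lemma represents_lin c p q y z : represents p y -> represents q z ->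
  exists w, represents (c *: p + q) w /\
    forall (i : 'I_m) x, a <= x <= b -> 'D[i] w x = c * 'D[i] y x + 'D[i] z x.
Proof.
move=> py qz.
have [f [sy fy pf]] := represents_system py; have [g [sz gz qg]] := represents_system qz.
have sw := quasi_system_lin ab c sy sz.
have [Dw wE Fw] := system_Dom ab m0 hA sw.
exists (fun x => c * 'D[0] y x + 'D[0] z x); split; last exact: wE.
have [_ p1 _] := py; have [_ q1 _] := qz.
split.
- split=> //; exists (c *: f + g); apply: ae_equal_trans (L2_fun_lin _ _ _) _.
  exact: ae_equal_sym.
- apply: ae_equal_trans (L2_fun_lin _ _ _) _.
  exact: (ae_equal_map2 (fun u v => c * u + v)).
- apply: ae_equal_trans (L2_fun_lin _ _ _) _.
  move: pf qg Fw; apply: (@filterS3 _ _ (ae_filter_ringOfSetsType mu)) => x h1 h2 h3 Ix.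
  by rewrite /quasi_expression (h3 Ix) (h1 Ix) (h2 Ix) mulrDr mulrCA.
Qed.

Lemma L_max_linear : linear_operator (L_max a b A).
Proof.
split.
- have s0 : quasi_system a b A (fun _ => cst 0) (L2_fun (0 : H)).
    move=> i; apply: (complex_primitive_ae (complex_primitive_cst a b 0)).
      apply: quasi_rhs_integrable => //; last exact: L2_fun_integrable.
      by move=> j; exact: (complex_primitive_ac (complex_primitive_cst a b 0)).
    move: (L2_fun0 a b); apply: (@filterS _ _ (ae_filter_ringOfSetsType mu)) => x h Ix.
    rewrite big1 => [|j _]; last by rewrite mulr0.
    by rewrite add0r; case: eqP => //; rewrite (h Ix).
  have [p [py p2 _]] := system_represents s0.
  apply/L_maxP; exists (cst 0); case: py => Dy p1 pe; split=> //=.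
    exact: L2_fun0.
  by move: pe; rewrite p2 scaler0.
- move=> c p q /L_maxP[y py] /L_maxP[z qz]; apply/L_maxP.
  by have [w [rw _]] := represents_lin c py qz; exists w.
- move=> f g h /L_maxP[y py] /L_maxP[z qz].
  by have [_ []] := represents_unique py qz erefl.
Qed.

(** The choice is harmless: [boundary_valuesE] computes the boundary values from any representative,
    and [cst 0] is reached only off [L_max]. *)
Definition rep p : R -> C := xget (cst 0) (represents p).

Lemma repP p : L_max a b A p -> represents p (rep p).
Proof. by move=> /L_maxP[y py]; rewrite /rep; case: xgetP => [z -> //|/(_ y)]. Qed.

Definition boundary_values (c : R) p : 'cV[C]_m := \col_i 'D[i] (rep p) c.

Lemma boundary_valuesE c p y : a <= c <= b -> represents p y ->
  boundary_values c p = \col_i 'D[i] y c.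
Proof.
move=> cab py; have Lp : L_max a b A p by apply/L_maxP; exists y.
have [h _] := represents_unique (repP Lp) py erefl.
by apply/colP => i; rewrite !mxE h.
Qed.

Lemma boundary_values_lin c k p q : a <= c <= b -> L_max a b A p -> L_max a b A q ->
  boundary_values c (k *: p + q) = k *: boundary_values c p + boundary_values c q.
Proof.
move=> cab Lp Lq; have [w [rw wE]] := represents_lin k (repP Lp) (repP Lq).
by rewrite (boundary_valuesE cab rw); apply/colP => i; rewrite !mxE wE.
Qed.

Let aab : a <= a <= b. Proof. by rewrite lexx ltW. Qed.
Let bab : a <= b <= b. Proof. by rewrite lexx ltW. Qed.

Lemma L_max_cauchy g (c : 'cV[C]_m) :
  exists p, [/\ L_max a b A p, p.2 = g & boundary_values a p = c].
Proof.
have [Y [sY Ya]] := quasi_system_solution ab hA (fun i => c i 0)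
  (L2_fun_integrable ab (('i ^+ m)^-1 *: g : H)).
have [p [rp p2 pE]] := system_represents sY.
exists p; split; first by apply/L_maxP; exists (Y o).
  by rewrite p2 scalerA mulfV// scale1r.
by rewrite (boundary_valuesE aab rp); apply/colP => i; rewrite mxE pE.
Qed.

(** Lagrange's identity integrated over [[a, b]] and multiplied by [- 'i ^+ m]; the conjugate of
    ['i ^+ m] is [(-1) ^+ m * 'i ^+ m], which accounts for the sign of its second term. The [+ 0] in
    the integrands below fit [complex_integral_lin]. *)
Lemma L_max_green p q : L_max a b A p -> L_max a b A q ->
  L2_inner p.2 q.1 - L2_inner p.1 q.2 =
  - 'i ^+ m * (dot (La *m boundary_values b p) (boundary_values b q)
             - dot (La *m boundary_values a p) (boundary_values a q)).
Proof.
move=> /repP rp /repP rq.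
have [f [sy fy pf]] := represents_system rp; have [g [sz gz qg]] := represents_system rq.
have fi := L2_fun_integrable ab f; have gi := L2_fun_integrable ab g.
have W := lagrange_identity ab m0 hAsym sy sz fi gi.
have /= <- := complex_primitive_integral ab W.
have [_ p1 _] := rp; have [_ q1 _] := rq.
rewrite !quasi_derivative0 in W *.
set y := rep p in p1 rp sy W *; set z := rep q in q1 rq sz W *.
have acc h : abs_continuous a b h -> abs_continuous a b (fun x => (h x)^*).
  by move=> /(ac_complex_primitive ab)[f' /complex_primitive_conj/complex_primitive_ac].
have icc h : complex_integrable a b h -> complex_integrable a b (fun x => (h x)^*).
  move=> [hr hi]; split.
    by move: hr; congr (integrable _ _ _); apply/funext => x; case: (h x).
  rewrite (_ : (fun x => _) = EFin \o (fun x => -1 * complex.Im (h x))).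
    by apply: (@integrable_realZ _ _ _ mu) => //; exact: measurable_itvR.
  by apply/funext => x /=; rewrite mulN1r; case: (h x).
have acy : abs_continuous a b y by case: rp => -[/(_ 0%N m0)].
have acz : abs_continuous a b z by case: rq => -[/(_ 0%N m0)].
have i1 := complex_integrable_ac_mul ab (acc _ acz) fi.
have i2 := complex_integrable_ac_mul ab acy (icc _ gi).
have c0 := complex_integrable0 a b.
have imc : ('i ^+ m : C)^* = (-1) ^+ m * 'i ^+ m.
  rewrite rmorphXn -exprMn /=; congr (_ ^+ _).
  by apply: complex_eq => /=; ring.
have conjE x : ((-1) ^+ m * 'i ^+ m) * ((L2_fun g x)^* * y x) = y x * ('i ^+ m * L2_fun g x)^*.
  transitivity (y x * (((-1) ^+ m * 'i ^+ m) * (L2_fun g x)^*)); first by ring.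
  by congr (_ * _); rewrite -imc; apply/esym; exact: rmorphM.
have e1 : L2_inner p.2 q.1 = complex_integral a b (fun x => 'i ^+ m * (L2_fun f x * (z x)^*) + 0).
  have -> : (fun x => 'i ^+ m * (L2_fun f x * (z x)^*) + 0) = (fun x => ('i ^+ m * L2_fun f x) * (z x)^*).
    by apply/funext => x; rewrite addr0 mulrA.
  apply: L2_innerE => //.
  have := complex_integrable_lin ('i ^+ m) i1 c0.
  by congr complex_integrable; apply/funext => x; rewrite addr0 mulrA.
have e2 : L2_inner p.1 q.2 = complex_integral a b (fun x => ((-1) ^+ m * 'i ^+ m) * ((L2_fun g x)^* * y x) + 0).
  have -> : (fun x => ((-1) ^+ m * 'i ^+ m) * ((L2_fun g x)^* * y x) + 0) = (fun x => y x * ('i ^+ m * L2_fun g x)^*).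
    by apply/funext => x; rewrite addr0; exact: conjE.
  apply: L2_innerE => //.
  have := complex_integrable_lin ((-1) ^+ m * 'i ^+ m) i2 c0.
  by congr complex_integrable; apply/funext => x; rewrite addr0; exact: conjE.
have e3 : complex_integral a b (fun x => - (L2_fun f x * (z x)^*) + (-1) ^+ m * (y x * (L2_fun g x)^*)) =
    complex_integral a b (fun x => -1 * (L2_fun f x * (z x)^*) + ((-1) ^+ m * ((L2_fun g x)^* * y x) + 0)).
  by congr complex_integral; apply/funext => x; rewrite mulN1r addr0 [y x * _]mulrC.
rewrite /= in e3 *; rewrite e3 e1 e2 !complex_integral_lin//; last exact: complex_integrable_lin.
by rewrite (complex_primitive_integral ab (complex_primitive_cst a b 0)) subrr; ring.
Qed.

End MaximalOperator.

Local Close Scope complex_scope.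

(** * Boundary maps *)

Section BoundaryMaps.
Context {R : realType} {m : nat}.
Hypothesis m0 : (0 < m)%N.
Local Notation C := R[i].
Local Notation La := (@Lambda R m).
Local Notation n := (m./2).
Implicit Types u v w : 'cV[C]_m.

Definition coord u (k : nat) : C := oapp (u^~ 0) 0 (insub k).

Lemma coordE u (i : 'I_m) : coord u i = u i 0.
Proof. by rewrite /coord valK. Qed.

Lemma coord_col (f : nat -> C) k : (k < m)%N -> coord (\col_(i < m) f i) k = f k.
Proof. by move=> km; rewrite -[k]/(val (Ordinal km)) coordE mxE. Qed.

Lemma coord_lin c u v k : coord (c *: u + v) k = c * coord u k + coord v k.
Proof. by rewrite /coord; case: insub => [i|] /=; rewrite ?mxE// mulr0 addr0. Qed.

(* [gam1 u v] and [gam2 u v] are the boundary maps of a function whose quasi-derivatives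
   take the values [u] at [a] and [v] at [b]. *)
Definition gam1 u v : 'cV[C]_m := \col_j
  if (j < n)%N then 'i ^+ m * (-1) ^+ j.+1 * coord u (m - j.+1)
  else if (j < n.*2)%N then 'i ^+ m * (-1) ^+ (j - n) * coord v (m - (j - n).+1)
  else 'i ^+ m * (coord v n + coord u n).

Definition gam2 u v : 'cV[C]_m := \col_j
  if (j < n)%N then coord u j
  else if (j < n.*2)%N then coord v (j - n)
  else ((-1) ^+ n / 2 + 'i) * coord v n + ((-1) ^+ n.+1 / 2 + 'i) * coord u n.

Lemma gam1_lin c u v u' v' : gam1 (c *: u + u') (c *: v + v') = c *: gam1 u v + gam1 u' v'.
Proof. by apply/colP => j; rewrite !mxE !coord_lin; do ![case: ifP => _]; ring. Qed.

Lemma gam2_lin c u v u' v' : gam2 (c *: u + u') (c *: v + v') = c *: gam2 u v + gam2 u' v'.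
Proof. by apply/colP => j; rewrite !mxE !coord_lin; do ![case: ifP => _]; ring. Qed.

Let half_lt : (n < m)%N.
Proof. by rewrite -{2}(odd_double_half m) -addnn; move: m0; case: (odd m) (odd_double_half m) => /=; lia. Qed.

Let halfE : m = (n + n + odd m)%N.
Proof. by rewrite addnn addnC odd_double_half. Qed.

Let sum_rows (g : nat -> C) : \sum_(j < m) g j =
  \sum_(j < n) g j + \sum_(j < n) g (n + j)%N + (if odd m then g n.*2 else 0).
Proof.
transitivity (\sum_(j < n + n + odd m) g j); first by rewrite -halfE.
rewrite !big_split_ord /=; congr (_ + _).
by case: (odd m); rewrite ?big_ord1 ?big_ord0 //= addn0 addnn.
Qed.

(** The form of [La] couples the indices [k] and [m - k.+1]; so each row [j < n] of the boundary
    maps at one end point accounts for two terms of the form, and the middle index [n] is left over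
    when [m] is odd. *)
Let sum_sym (f : nat -> C) : \sum_(j < m) f j =
  \sum_(j < n) f j + \sum_(j < n) f (m - j.+1)%N + (if odd m then f n else 0).
Proof.
have mE : m = (n + odd m + n)%N by rewrite addnAC -halfE.
transitivity (\sum_(j < n + odd m + n) f j); first by rewrite -mE.
rewrite !big_split_ord /= addrAC; congr (_ + _ + _).
  rewrite (reindex_inj rev_ord_inj) /=; apply: eq_bigr => j _.
  by rewrite [X in _ = f (X - _)%N]mE addnBA.
by case: (odd m); rewrite ?big_ord1 ?big_ord0 //= addn0.
Qed.

Let im_conj : ('i ^+ m : C)^* = (-1) ^+ m * 'i ^+ m.
Proof.
rewrite rmorphXn -exprMn /=; congr (_ ^+ _).
by apply: complex_eq => /=; ring.
Qed.


Let conjM (u v : C) : (u * v)^* = u^* * v^*.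
Proof. exact: rmorphM. Qed.

Let conj_sign k : ((-1) ^+ k : C)^* = (-1) ^+ k.
Proof. by rewrite rmorphXn; congr (_ ^+ _); apply: complex_eq => /=; ring. Qed.

Lemma gam_green u v u' v' :
  dot (gam1 u v) (gam2 u' v') - dot (gam2 u v) (gam1 u' v') =
  - 'i ^+ m * (dot (La *m v) v' - dot (La *m u) u').
Proof.
pose q u v k : C := (-1) ^+ k.+1 * coord u (m - k.+1)%N * (coord v k)^*.
have LaE x y : dot (La *m x) y = \sum_(j < m) q x y j.
  by apply: eq_bigr => j _; rewrite Lambda_mulE /q -!coordE.
pose g1 u v (j : nat) : C := if (j < n)%N then 'i ^+ m * (-1) ^+ j.+1 * coord u (m - j.+1)
  else if (j < n.*2)%N then 'i ^+ m * (-1) ^+ (j - n) * coord v (m - (j - n).+1)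
  else 'i ^+ m * (coord v n + coord u n).
pose g2 u v (j : nat) : C := if (j < n)%N then coord u j
  else if (j < n.*2)%N then coord v (j - n)
  else ((-1) ^+ n / 2 + 'i) * coord v n + ((-1) ^+ n.+1 / 2 + 'i) * coord u n.
have -> : dot (gam1 u v) (gam2 u' v') - dot (gam2 u v) (gam1 u' v') =
    \sum_(j < m) (g1 u v j * (g2 u' v' j)^* - g2 u v j * (g1 u' v' j)^*).
  by rewrite /dot sumrB; congr (_ - _); apply: eq_bigr => j _; rewrite !mxE.
rewrite (sum_rows (fun j => g1 u v j * (g2 u' v' j)^* - g2 u v j * (g1 u' v' j)^*)) !LaE.
rewrite (sum_sym (q v v')) (sum_sym (q u u')).
have nn : (n + n = n.*2)%N by rewrite addnn.
have lo x y (j : 'I_n) : q x y (m - j.+1)%N = - ((-1) ^+ m * (-1) ^+ j.+1) * coord x j * (coord y (m - j.+1)%N)^*.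
  have jm : (j.+1 <= m)%N by apply: leq_trans (ltn_ord j) (ltnW half_lt).
  rewrite /q (_ : m - (m - j.+1).+1 = j)%N; last by move: jm; clear; lia.
  have -> : (-1) ^+ m = (-1) ^+ (m - j.+1) * (-1) ^+ j.+1 :> C by rewrite -exprD subnK.
  by congr (_ * _ * _); rewrite -mulrA -expr2 sqrr_sign mulr1 exprS mulN1r.
have S1 : \sum_(j < n) (g1 u v j * (g2 u' v' j)^* - g2 u v j * (g1 u' v' j)^*) =
    'i ^+ m * (\sum_(j < n) q u u' j + \sum_(j < n) q u u' (m - j.+1)%N).
  rewrite -big_split mulr_sumr; apply: eq_bigr => j _.
  by rewrite /g1 /g2 ltn_ord /= lo /q !conjM conj_sign im_conj; ring.
have S2 : \sum_(j < n) (g1 u v (n + j)%N * (g2 u' v' (n + j)%N)^* - g2 u v (n + j)%N * (g1 u' v' (n + j)%N)^*) =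
    - 'i ^+ m * (\sum_(j < n) q v v' j + \sum_(j < n) q v v' (m - j.+1)%N).
  rewrite -big_split mulr_sumr; apply: eq_bigr => j _.
  rewrite /g1 /g2 ltnNge leq_addr /= -nn ltn_add2l ltn_ord addKn.
  by rewrite lo /q !conjM conj_sign im_conj !exprS; ring.
rewrite S1 S2.
(* The odd middle row, where the constants gamma and delta of [gam2] matter: twice their real parts
   are [(-1) ^+ n] and [- (-1) ^+ n], which give the terms at [b] and [a], and gamma plus the
   conjugate of delta is 0, which removes the mixed terms. *)
case: ifP => [mo|_]; last by ring.
rewrite /g1 /g2 ltnNge -nn leq_addr ltnn /= /q.
have mn : (m - n.+1 = n)%N by move: halfE; rewrite mo; lia.
rewrite mn !conjM.
pose e : C := (-1) ^+ n.
have ee : e * e = 1 by rewrite /e -expr2 sqrr_sign.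
have ii : 'i * 'i = -1 :> C by apply: complex_eq => /=; ring.
have iE : 'i ^+ m = e * 'i.
  rewrite {1}halfE mo addn1 exprSr addnn -mul2n exprM expr2 ii.
  by [].
have conjD (x y : C) : (x + y)^* = x^* + y^* by exact: rmorphD.
have conjI : ('i : C)^* = - 'i by exact: conjCi.
pose h : C := 2^-1.
have hh : h + h = 1 by rewrite /h; field.
have conjh : h^* = h by rewrite /h fmorphV rmorph_nat.
have conje : e^* = e by exact: conj_sign.
rewrite exprS -/e -/h iE.
do 4![move: (\sum_(j < n) _) => ?].
do 3!rewrite ?conjD ?conjM ?conje ?conjI ?conjh.
have -> : (-1 : C)^* = -1 by exact: rmorphN1.
move: (coord v n) (coord u n) ((coord v' n)^*) ((coord u' n)^*) => x y x' y'.
have -> : h = 2^-1 by [].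
move: ee ii; clear; move: e ('i : C) => e i ee ii.
by field: ee ii.
Qed.

(** With both maps zero, Green's identity equates the form at [b] and the form at [a] for arbitrary
    independent [u'] and [v']; taking one of these zero shows that each form vanishes, and [La] is
    invertible. *)
Lemma gam_inj u v : gam1 u v = 0 -> gam2 u v = 0 -> u = 0 /\ v = 0.
Proof.
move=> g1 g2.
have im0 : - 'i ^+ m != 0 :> C by rewrite oppr_eq0 expf_neq0// neq0Ci.
have H u' v' : dot (La *m v) v' = dot (La *m u) u'.
  have := gam_green u v u' v'; rewrite g1 g2 !dot0l subrr => /esym/eqP.
  by rewrite mulf_eq0 (negbTE im0) subr_eq0 => /eqP.
have Linj (w : 'cV[C]_m) : (forall w', dot (La *m w) w' = 0) -> w = 0.
  move=> h; have : La *m w = 0 by exact: dot_eq0.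
  by move/(congr1 (mulmx (invmx La))); rewrite mulKmx ?Lambda_unit// mulmx0.
by split; apply: Linj => w'; [rewrite -(H w' 0)|rewrite (H 0 w')]; rewrite dot0r.
Qed.

Lemma gam_surj w w' : exists u v, gam1 u v = w /\ gam2 u v = w'.
Proof.
pose t : C := ('i ^+ m)^-1.
have it : 'i ^+ m * t = 1 by rewrite /t mulfV// expf_neq0// neq0Ci.
pose e : C := (-1) ^+ n.
have ee : e * e = 1 by rewrite /e -expr2 sqrr_sign.
(* [un] and [vn] solve the middle rows: their sum is prescribed by [gam1], and eliminating [un] from
   [gam2] leaves [vn] with coefficient gamma minus delta, which is [e] and is its own inverse. *)
pose vn : C := e * (coord w' n.*2 - (- e / 2 + 'i) * t * coord w n.*2).
pose un : C := t * coord w n.*2 - vn.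
pose U k : C := if (k < n)%N then coord w' k else if odd m && (k == n) then un
  else t * (-1) ^+ (m - k) * coord w (m - k.+1).
pose V k : C := if (k < n)%N then coord w' (n + k) else if odd m && (k == n) then vn
  else t * (-1) ^+ (m - k.+1) * coord w (n + (m - k.+1)).
exists (\col_(k < m) U k), (\col_(k < m) V k).
have sq k : (-1) ^+ k * (-1) ^+ k = 1 :> C by rewrite -expr2 sqrr_sign.
have hi k : (k < n)%N -> [/\ (m - k.+1 < m)%N, (m - k.+1 < n)%N = false,
    odd m && (m - k.+1 == n)%N = false, (m - (m - k.+1) = k.+1)%N & (m - (m - k.+1).+1 = k)%N].
  by move: halfE half_lt; case: (odd m) => /= h1 h2 kn; split; try (apply/negbTE); lia.
split; apply/colP => j; rewrite !mxE.
  case: ifP => [jn|/negbT nj].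
    have [h1 h2 h3 h4 h5] := hi j jn.
    by rewrite coord_col// /U h2 h3 h4 h5 coordE; ring: it (sq j.+1).
  case: ifP => [j2|/negbT nj2].
    have jn : (j - n < n)%N by move: nj j2; rewrite -addnn; lia.
    have [h1 h2 h3 h4 h5] := hi _ jn.
    rewrite coord_col// /V h2 h3 h5 (_ : n + (j - n) = j)%N; last by move: nj; lia.
    by rewrite coordE; ring: it (sq (j - n)%N).
  have [mo jE] : odd m /\ (j : nat) = n.*2.
    by move: (ltn_ord j) nj2 halfE; rewrite -addnn; case: (odd m) => /=; lia.
  rewrite !coord_col// /U /V ltnn mo eqxx /= /un -jE coordE.
  by ring: it.
case: ifP => [jn|/negbT nj]; first by rewrite coord_col// /U jn coordE.
case: ifP => [j2|/negbT nj2].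
  have jn : (j - n < n)%N by move: nj j2; rewrite -addnn; lia.
  rewrite coord_col; last by move: (ltn_ord j); lia.
  by rewrite /V jn (_ : n + (j - n) = j)%N ?coordE//; move: nj; lia.
have [mo jE] : odd m /\ (j : nat) = n.*2.
  by move: (ltn_ord j) nj2 halfE; rewrite -addnn; case: (odd m) => /=; lia.
rewrite !coord_col// /U /V ltnn mo eqxx /= /un /vn -jE coordE exprS -/e.
by field: ee.
Qed.

End BoundaryMaps.

(** * Parametrization of the extensions *)

Section Extensions.
Context {R : realType} (a b : R) {m : nat}.
Hypothesis ab : a < b.
Hypothesis m0 : (0 < m)%N.
Local Notation C := R[i].
Local Notation H := (L2 a b).
Local Notation La := (@Lambda R m).
Local Notation ip := (@L2_inner R a b).
Variable A : R -> 'M[C]_m.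
Hypothesis hA : shin_zettl a b A.
Hypothesis hAsym : formally_self_adjoint a b A.
Variable s : R.
Hypothesis s1 : s ^+ 2 = 1.
Implicit Types (p q : H * H) (K : 'M[C]_m).

Local Notation Lmax := (L_max a b A).
Local Notation G1 p := (gam1 (boundary_values A a p) (boundary_values A b p)).
Local Notation G2 p := (gam2 (boundary_values A a p) (boundary_values A b p)).
Local Notation z := ((s%:C)%C * 'i : C).

Let aab : a <= a <= b. Proof. by rewrite lexx ltW. Qed.
Let bab : a <= b <= b. Proof. by rewrite lexx ltW. Qed.

Let half_lt : (m./2 < m)%N.
Proof. by rewrite -{2}(odd_double_half m) -addnn; move: m0; case: (odd m) (odd_double_half m) => /=; lia. Qed.

Lemma Gamma1E p y : represents A p y -> Gamma1 a b A y = G1 p.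
Proof.
move=> rp; rewrite (boundary_valuesE ab m0 hA aab rp) (boundary_valuesE ab m0 hA bab rp).
pose D c k := quasi_derivative a b A k y c.
apply/colP => j; rewrite !mxE; have jm := ltn_ord j; case: ifP => [jn|_].
  by rewrite (coord_col (D a)) //=; lia.
case: ifP => [jn|_]; first by rewrite (coord_col (D b)) //=; lia.
by rewrite (coord_col (D a)) ?(coord_col (D b)).
Qed.

Lemma Gamma2E p y : represents A p y -> Gamma2 a b A y = G2 p.
Proof.
move=> rp; rewrite (boundary_valuesE ab m0 hA aab rp) (boundary_valuesE ab m0 hA bab rp).
pose D c k := quasi_derivative a b A k y c.
apply/colP => j; rewrite !mxE; have jm := ltn_ord j; case: ifP => [jn|_].
  by rewrite (coord_col (D a)).
case: ifP => [jn|_]; first by rewrite (coord_col (D b)) //=; lia.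
by rewrite (coord_col (D a)) ?(coord_col (D b)).
Qed.

(** The maps [P] and [M] of the abstract boundary triple, with [z] equal to ['i] or [- 'i] according
    to the sign [s]: one section thus treats the dissipative and the accumulative case. *)
Definition outgoing p : 'cV[C]_m := z *: G2 p + G1 p.
Definition incoming p : 'cV[C]_m := - z *: G2 p + G1 p.

Let bv_lin := boundary_values_lin ab m0 hA.

Let Plin c p q : Lmax p -> Lmax q -> outgoing (c *: p + q) = c *: outgoing p + outgoing q.
Proof.
move=> Lp Lq; rewrite /outgoing !bv_lin// gam1_lin gam2_lin.
by apply/colP => i; rewrite !mxE; ring.
Qed.

Let Mlin c p q : Lmax p -> Lmax q -> incoming (c *: p + q) = c *: incoming p + incoming q.
Proof.
move=> Lp Lq; rewrite /incoming !bv_lin// gam1_lin gam2_lin.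
by apply/colP => i; rewrite !mxE; ring.
Qed.

Let zC : z^* = - z.
Proof. by apply: complex_eq => /=; ring. Qed.

Let NzC : (- z)^* = z.
Proof. by apply: complex_eq => /=; ring. Qed.

Let green p q : Lmax p -> Lmax q -> dot (outgoing p) (outgoing q) - dot (incoming p) (incoming q) =
  - ((2 * s)%:C)%C * 'i * (ip p.2 q.1 - ip p.1 q.2).
Proof.
move=> Lp Lq; rewrite (L_max_green ab m0 hA hAsym Lp Lq) -(gam_green m0) /outgoing /incoming.
move: (G1 p) (G2 p) (G1 q) (G2 q) => u1 u2 v1 v2; rewrite !dotDl !dotDr.
have -> : ((2 * s)%:C)%C = 2 * (s%:C)%C :> C by apply: complex_eq => /=; ring.
have zC' := zC; have NzC' := NzC; rewrite /= in zC' NzC' *.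
by rewrite zC' NzC'; ring.
Qed.

Let mi0 : - 'i ^+ m != 0 :> C.
Proof. by rewrite oppr_eq0 expf_neq0// neq0Ci. Qed.

Let z0 : z != 0.
Proof.
rewrite mulf_neq0 ?neq0Ci//.
have s0 : s != 0 by apply: contra_eq_neq s1 => ->; rewrite expr0n /= eq_sym oner_neq0.
by rewrite eq_complex /= eqxx andbT.
Qed.

Let ipDl := @L2_innerDl R a b.
Let ipC := @L2_innerC R a b.

Let surj := cauchy_data_surjective ipDl ipC (@L2_inner_eq0 R a b) (L_max_linear ab m0 hA)
  (fun c p q => @bv_lin a c p q aab) (fun c p q => @bv_lin b c p q bab) Lambda_unit mi0
  (@L_max_green R a b m ab m0 A hA hAsym) (L_max_cauchy ab m0 hA).

Let PM_surj u v : exists p, [/\ Lmax p, outgoing p = u & incoming p = v].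
Proof.
have [ua [ub [g1 g2]]] := gam_surj m0 (2^-1 *: (u + v)) ((2 * z)^-1 *: (u - v)).
have [p [Lp pa pb]] := surj ua ub.
exists p; split=> //; rewrite /outgoing /incoming pa pb g1 g2; apply/colP => i; rewrite !mxE.
- by move: z0; move: z => w w0; field.
- by move: z0; move: z => w w0; field.
Qed.


Lemma Lcauchy0_L_min : Lcauchy0 Lmax (boundary_values A a) (boundary_values A b) = L_min a b A.
Proof.
apply/seteqP; split=> p.
  move=> [Lp pa pb]; apply/L_restrictionP; exists (rep A p); first exact: repP.
  move=> k km; split.
    by move/colP/(_ (Ordinal km)): pa; rewrite !mxE.
  by move/colP/(_ (Ordinal km)): pb; rewrite !mxE.
move=> /L_restrictionP[y rp y0]; split.
- by apply/L_maxP; exists y.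
- by rewrite (boundary_valuesE ab m0 hA aab rp); apply/colP => i; rewrite !mxE; case: (y0 i).
- by rewrite (boundary_valuesE ab m0 hA bab rp); apply/colP => i; rewrite !mxE; case: (y0 i).
Qed.

Lemma Lker_L_min : Lker Lmax outgoing incoming = L_min a b A.
Proof.
rewrite -Lcauchy0_L_min; apply/seteqP; split=> p [Lp]; rewrite /outgoing /incoming.
  move: z0; move: z => w w0 h1 h2.
  have g2 : G2 p = 0.
    have : (w *: G2 p + G1 p) - (- w *: G2 p + G1 p) = (2 * w) *: G2 p.
      by apply/colP => i; rewrite !mxE; ring.
    rewrite h1 h2 subrr => /esym/eqP; rewrite scaler_eq0 mulf_eq0 pnatr_eq0 (negbTE w0).
    by move/eqP.
  have g1 : G1 p = 0 by move: h1; rewrite g2 scaler0 add0r.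
  by have [] := gam_inj m0 g1 g2.
have h1 := gam1_lin (-1) (0 : 'cV[C]_m) 0 0 0; have h2 := gam2_lin (-1) (0 : 'cV[C]_m) 0 0 0.
move: h1 h2; rewrite !scaler0 !addr0 !scaleN1r !addNr => h1 h2 pa pb.
by split; rewrite // /outgoing /incoming pa pb h1 h2 !scaler0 addr0.
Qed.

(** Collecting the terms multiplied by [K] turns the stated boundary condition into
    [K *m outgoing p - incoming p = 0]. *)
Lemma Lext_L_restriction K : Lext Lmax outgoing incoming K = L_restriction a b A
  [set y | (K - 1%:M) *m Gamma1 a b A y + z *: ((K + 1%:M) *m Gamma2 a b A y) = 0].
Proof.
have E p : (K *m outgoing p = incoming p) <->
    (K - 1%:M) *m G1 p + z *: ((K + 1%:M) *m G2 p) = 0.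
  rewrite /outgoing /incoming mulmxDr -scalemxAr mulmxBl mulmxDl !mul1mx.
  move: (G1 p) (G2 p) => v1 v2; move: (K *m v1) (K *m v2) (z) => u1 u2 w.
  have -> : u1 - v1 + w *: (u2 + v2) = (w *: u2 + u1) - (- w *: v2 + v1).
    by apply/colP => i; rewrite !mxE; ring.
  by split=> [->|/eqP]; rewrite ?subrr// subr_eq0 => /eqP.
apply/seteqP; split=> p.
  move=> [Lp Kp]; apply/L_restrictionP; exists (rep A p); first exact: repP.
  by rewrite /= (Gamma1E (repP Lp)) (Gamma2E (repP Lp)); apply/E.
move=> /L_restrictionP[y rp] /=; rewrite (Gamma1E rp) (Gamma2E rp) => yK; split.
  by apply/L_maxP; exists y.
exact/E.
Qed.

Let ker_dense : densely_defined ip (Lker Lmax outgoing incoming).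
Proof.
rewrite Lker_L_min -Lcauchy0_L_min.
exact: (Lcauchy0_dense ipDl ipC (@L2_inner_ge0 R a b) (@L2_inner_eq0 R a b) (@L2_complete R a b)
  (L_max_linear ab m0 hA) (fun c p q => @bv_lin a c p q aab) (fun c p q => @bv_lin b c p q bab)
  Lambda_unit mi0 (@L_max_green R a b m ab m0 A hA hAsym) (L_max_cauchy ab m0 hA)).
Qed.

Let ker_adjoint : adjoint ip (Lker Lmax outgoing incoming) `<=` Lmax.
Proof.
rewrite Lker_L_min -Lcauchy0_L_min.
exact: (adjoint_Lcauchy0 ipDl ipC (@L2_inner_eq0 R a b)
  (L_max_linear ab m0 hA) (fun c p q => @bv_lin a c p q aab) (fun c p q => @bv_lin b c p q bab)
  Lambda_unit mi0 (@L_max_green R a b m ab m0 A hA hAsym) (L_max_cauchy ab m0 hA)).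
Qed.

Definition maximal_sdissipative S :=
  sdissipative ip s S /\ forall T, sdissipative ip s T -> S `<=` T -> T = S.

(** The family [E] is abstract so that the result applies to [L_sub] and [L_sup], whose conditions
    are written with ['i] and a sign instead of [z]. *)
Lemma extension_parametrization (E : 'M[C]_m -> set (H * H)) :
  (forall K, E K = L_restriction a b A
    [set y | (K - 1%:M) *m Gamma1 a b A y + z *: ((K + 1%:M) *m Gamma2 a b A y) = 0]) ->
  [/\ forall K, self_adjoint ip (E K) <-> K \is unitarymx,
      set_bij [set K | contraction_mx K]
        [set S | maximal_sdissipative S /\ L_min a b A `<=` S] E &
      set_bij [set K | K \is unitarymx]
        [set S | self_adjoint ip S /\ L_min a b A `<=` S] E].
Proof.
move=> EE; have {EE}-> : E = Lext Lmax outgoing incoming.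
  by apply/funext => K; rewrite EE Lext_L_restriction.
rewrite -Lker_L_min; have Llin := L_max_linear ab m0 hA.
have sa := Lext_self_adjoint s1 Llin Plin Mlin green PM_surj ker_dense ker_adjoint.
have onto := maximal_Lext ipDl ipC s1 Llin Plin Mlin green PM_surj ker_dense ker_adjoint.
split; [exact: sa| |]; split.
- move=> K cK; split; last exact: Lker_sub_Lext.
  split; first exact: (Lext_sdissipative ipC Llin Plin Mlin green ker_dense).
  by move=> T; exact: (Lext_maximal ipDl ipC s1 Llin Plin Mlin green PM_surj ker_adjoint).
- by move=> K K' _ _; exact: Lext_inj.
- by move=> S [[dS mS] LS]; have [K cK ->] := onto S dS mS LS; exists K.
- by move=> K uK; split; [exact/sa|exact: Lker_sub_Lext].
- by move=> K K' _ _; exact: Lext_inj.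
- move=> S [sS LS]; have [dS mS] := self_adjoint_sdissipative ipDl ipC s1 sS.
  by have [K _ SK] := onto S dS mS LS; exists K => //; apply/sa; rewrite -SK.
Qed.

End Extensions.

Lemma sdissipative1 (R : realType) (a b : R) :
  @maximal_sdissipative R a b 1 = maximal_dissipative (@L2_inner R a b).
Proof.
have E : sdissipative (@L2_inner R a b) 1 = dissipative (@L2_inner R a b).
  apply/funext => S; apply/propext; split=> -[? ? h]; split=> // f g /h; rewrite ?mul1r//.
by apply/funext => S; rewrite /maximal_sdissipative E.
Qed.

Lemma sdissipativeN1 (R : realType) (a b : R) :
  @maximal_sdissipative R a b (-1) = maximal_accumulative (@L2_inner R a b).
Proof.
have E : sdissipative (@L2_inner R a b) (-1) = accumulative (@L2_inner R a b).
  by apply/funext => S; apply/propext; split=> -[? ? h]; split=> // f g /h; rewrite ?mulN1r oppr_ge0.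
by apply/funext => S; rewrite /maximal_sdissipative E.
Qed.

Theorem theorem3 (R : realType) (a b : R) (hab : a < b) (m : nat) (hm : (3 <= m)%N)
    (A : R -> 'M[R[i]]_m) (hA : shin_zettl a b A)
    (hAsym : formally_self_adjoint a b A) :
  let ip := @L2_inner R a b in
  [/\ (* (i) *)
      forall K : 'M[R[i]]_m, contraction_mx K ->
        [/\ maximal_dissipative ip (L_sub a b A K),
            L_min a b A `<=` L_sub a b A K,
            maximal_accumulative ip (L_sup a b A K) &
            L_min a b A `<=` L_sup a b A K],
      (* (ii) *)
      (forall L : set (L2 a b * L2 a b),
          maximal_dissipative ip L -> L_min a b A `<=` L ->
          exists2 K : 'M[R[i]]_m, contraction_mx K & L = L_sub a b A K) /\
      (forall L : set (L2 a b * L2 a b),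
          maximal_accumulative ip L -> L_min a b A `<=` L ->
          exists2 K : 'M[R[i]]_m, contraction_mx K & L = L_sup a b A K),
      (* (iii) *)
      (forall K : 'M[R[i]]_m,
          (self_adjoint ip (L_sub a b A K) <-> K \is unitarymx) /\
          (self_adjoint ip (L_sup a b A K) <-> K \is unitarymx)) &
      (* (iv) *)
      [/\ set_bij [set K : 'M[R[i]]_m | contraction_mx K]
            [set L | maximal_dissipative ip L /\ L_min a b A `<=` L]
            (L_sub a b A),
          set_bij [set K : 'M[R[i]]_m | contraction_mx K]
            [set L | maximal_accumulative ip L /\ L_min a b A `<=` L]
            (L_sup a b A),
          set_bij [set K : 'M[R[i]]_m | K \is unitarymx]
            [set L | self_adjoint ip L /\ L_min a b A `<=` L]
            (L_sub a b A) &
          set_bij [set K : 'M[R[i]]_m | K \is unitarymx]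
            [set L | self_adjoint ip L /\ L_min a b A `<=` L]
            (L_sup a b A)]].
Proof.
move=> ip; have m0 : (0 < m)%N by apply: leq_trans hm.
have param1 := extension_parametrization hab m0 hA hAsym (expr1n R 2).
(* [(-1) ^+ 1] computes to -1, so [sqrr_sign] supplies the hypothesis [s ^+ 2 = 1] in the
   accumulative case. *)
have paramN1 := extension_parametrization hab m0 hA hAsym (sqrr_sign R 1).
rewrite sdissipative1 in param1; rewrite sdissipativeN1 in paramN1.
have {param1}[|sa1 dis uni1] := param1 (L_sub a b A); first by move=> K; rewrite mul1r.
have {paramN1}[|sa2 acc uni2] := paramN1 (L_sup a b A).
  by move=> K; rewrite rmorphN1 mulN1r; congr (L_restriction _ _ _ _); apply/funext => y; rewrite /mkset scaleNr.
have [dis_fun _ dis_surj] := dis; have [acc_fun _ acc_surj] := acc.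
split=> //.
- by move=> K cK; have [] := dis_fun K cK; have [] := acc_fun K cK.
- split=> L mL LL.
    by have [K cK <-] := dis_surj L (conj mL LL); exists K.
  by have [K cK <-] := acc_surj L (conj mL LL); exists K.
Qed.
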